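(* Let $\alpha\in(0,2)$ and let $X\sim\mathcal{S}(\alpha,\beta,m_1,m_2)$ be an $\alpha$-stable random variable. Then, for every $g\in\mathcal{S}(\mathbb{R})$, $$\mathbb{E}\left((X-\beta)g(X)-\int_{\mathbb{R}}\left(g(X+u)-g(X)\mathbf{1}_{\{|u|\leq 1\}}(u)\right)u\,\nu_{\alpha}(du)\right)=0.$$
   Context: For $\alpha\in(0,2)$, $\beta\in\mathbb{R}$, $m_1,m_2\in[0,\infty)$ with $m_1+m_2>0$, $X\sim\mathcal{S}(\alpha,\beta,m_1,m_2)$ means that $\mathbb{E}(e^{izX})=e^{\eta_\alpha(z)}$, $z\in\mathbb{R}$, where $$\eta_\alpha(z)=iz\beta+\int_{\mathbb{R}}\left(e^{izu}-1-izu\mathbf{1}_{\{|u|\le1\}}(u)\right)\nu_\alpha(du),\qquad \nu_{\alpha}(du)=\left(\frac{m_1}{u^{1+\alpha}}\mathbf{1}_{(0,\infty)}(u)+\frac{m_2}{|u|^{1+\alpha}}\mathbf{1}_{(-\infty,0)}(u)\right)du.$$ $\mathcal{S}(\mathbb{R})$ is the Schwartz space on $\mathbb{R}$. *)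

(* Defs.v *)
From HB Require Import structures.
From mathcomp Require Import all_boot all_order all_algebra.
From mathcomp Require Import complex.
From mathcomp Require Import all_classical all_reals all_analysis.
From mathcomp Require Import measurable_realfun.

Set Implicit Arguments.
Unset Strict Implicit.
Unset Printing Implicit Defensive.

Import Order.TTheory GRing.Theory Num.Theory.
Import numFieldNormedType.Exports.

Local Open Scope classical_set_scope.
Local Open Scope ring_scope.
Local Open Scope complex_scope.

Section complex_integral.
Context d (T : measurableType d) (R : realType).
Variable mu : {measure set T -> \bar R}.

Definition cintegrable (f : T -> R[i]) : Prop :=
  mu.-integrable [set: T] (EFin \o (fun x => complex.Re (f x))) /\
  mu.-integrable [set: T] (EFin \o (fun x => complex.Im (f x))).

(* [Rintegral] is junk-valued on non-integrable functions: pair equations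
   about [cintegral] with [cintegrable]. *)
Definition cintegral (f : T -> R[i]) : R[i] :=
  Rintegral mu [set: T] (fun x => complex.Re (f x)) +i*
  Rintegral mu [set: T] (fun x => complex.Im (f x)).

End complex_integral.

Definition cexp (R : realType) (z : R[i]) : R[i] :=
  (expR (complex.Re z))%:C * (cos (complex.Im z) +i* sin (complex.Im z)).

Section levy_measure.
Context (R : realType).
Variables (alpha : R) (m1 m2 : {nonneg R}).

(* Both powers have a positive base wherever the indicator does not vanish. *)
Definition levy_density (u : R) : R :=
  m1%:num / (u `^ (1 + alpha)) * \1_[set v : R | 0 < v] u +
  m2%:num / (`|u| `^ (1 + alpha)) * \1_[set v : R | v < 0] u.

Definition levy_measure : set (measurableTypeR R) -> \bar R :=
  fun A => (\int[lebesgue_measure]_(u in A) (levy_density u)%:E)%E.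

Lemma levy_density_ge0 u : 0 <= levy_density u.
Proof.
by rewrite /levy_density addr_ge0// mulr_ge0// divr_ge0// powR_ge0.
Qed.

Lemma measurable_levy_density : measurable_fun [set: R] levy_density.
Proof.
have mpow : measurable_fun [set: R] (fun u : R => (u `^ (1 + alpha))^-1).
  rewrite [X in measurable_fun _ X](_ : _ = @powR R ^~ (- (1 + alpha))).
    exact: measurable_powR.
  by apply/funext => u; rewrite powRN.
apply: measurable_funD; apply: measurable_funM.
- apply: measurable_funM => //; exact: measurable_cst.
- apply: measurable_indic.
  rewrite (_ : [set v : R | 0 < v] = `]0, +oo[%classic) //.
  by apply/seteqP; split => x /=; rewrite in_itv/= andbT.
- apply: measurable_funM; first exact: measurable_cst.
  exact: (measurableT_comp mpow (@normr_measurable R _)).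
- apply: measurable_indic.
  rewrite (_ : [set v : R | v < 0] = `]-oo, 0[%classic) //.
Qed.

Let levy0 : levy_measure set0 = 0%E.
Proof. by rewrite /levy_measure integral_set0. Qed.

Let levy_ge0 A : (0 <= levy_measure A)%E.
Proof.
by apply: integral_ge0 => u _; rewrite lee_fin levy_density_ge0.
Qed.

Let levy_sigma_additive : semi_sigma_additive levy_measure.
Proof.
move=> F mF tF mUF; rewrite /levy_measure.
rewrite ge0_integral_bigcup//=.
- apply: is_cvg_ereal_nneg_natsum => n _.
  by apply: integral_ge0 => u _; rewrite lee_fin levy_density_ge0.
- apply/measurable_EFinP; apply: measurable_funTS.
  exact: measurable_levy_density.
- by move=> u _; rewrite lee_fin levy_density_ge0.
Qed.

HB.instance Definition _ := isMeasure.Build _ _ _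
  levy_measure levy0 levy_ge0 levy_sigma_additive.

End levy_measure.

Definition unit_indic (R : realType) (u : R) : R := \1_[set v : R | `|v| <= 1] u.

Definition stable_exponent (R : realType) (alpha beta : R) (m1 m2 : {nonneg R})
    (z : R) : R[i] :=
  'i%C * z%:C * beta%:C +
  cintegral (levy_measure alpha m1 m2) (fun u : R =>
    cexp ('i%C * z%:C * u%:C) - 1 - 'i%C * z%:C * u%:C * (unit_indic u)%:C).

Definition is_stable d (T : measurableType d) (R : realType)
    (P : probability T R) (X : {RV P >-> R})
    (alpha beta : R) (m1 m2 : {nonneg R}) : Prop :=
  forall z : R, cintegral P (fun w => cexp ('i%C * z%:C * (X w)%:C)) =
                cexp (stable_exponent alpha beta m1 m2 z).

Definition schwartz (R : realType) (f : R -> R) : Prop :=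
  (forall n x, derivable (f^`(n))%classic x 1) /\
  (forall k n, exists C : R, forall x, `|x ^+ k * (f^`(n))%classic x| <= C).

(* For maps R -> R[i], differentiation is componentwise, and bounds on the two
   components are equivalent to bounds on the modulus. *)
Definition cschwartz (R : realType) (g : R -> R[i]) : Prop :=
  schwartz (fun x => complex.Re (g x)) /\ schwartz (fun x => complex.Im (g x)).

(* Main.v *)
Require Import Defs.
From mathcomp Require Import all_boot all_order all_algebra.
From mathcomp Require Import complex.
From mathcomp Require Import all_classical all_reals all_analysis.
From mathcomp Require Import measurable_realfun ring lra.

Import Order.TTheory GRing.Theory Num.Theory.
Import numFieldNormedType.Exports.

Local Open Scope classical_set_scope.
Local Open Scope ring_scope.
Set Implicit Arguments.
Unset Strict Implicit.
Unset Printing Implicit Defensive.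

(** Write [c(z)] and [s(z)] for the real part of the exponent and for its
imaginary part without drift, so that [E cos (z X) = exp (c z) cos (z beta + s z)]
and [E sin (z X) = exp (c z) sin (z beta + s z)], and [N g] for the integral of
[u |-> (g (x + u) - g x 1_{|u| <= 1}) u] against the Levy measure.  Real and
imaginary parts of [g] are treated separately, so [g] is real below.

The identity is first proved for translates of one explicit kernel, the cosine
transform of the weight [(1 + e z) exp (- e z)] on [z > 0].  The Levy
density is homogeneous, so [c z = z^alpha c(1)], while rescaling the truncation
level gives [s z = z^alpha (s(1) - (m1 - m2) int_1^z v^-alpha dv)].  Hence the
characteristic function is differentiable for [z > 0], with
[z c' = alpha c] and [z s' = alpha s^], where [s^] is the imaginary part computed
with the continuous compensator [max (-1) (min v 1)] ([im_exponent_clampE],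
[has_deriv_im_closed]).  Integrating by parts the product of the weight and
[E sin (z (X - a))] expresses [E (X - beta) p(X - a)], for the kernel [p],
through [alpha c / z] and [alpha s^ / z] ([kernel_stein]).  On the other side,
the density of [u nu(du)] is [alpha] times a signed tail of the Levy measure, so by
Fubini [N p] is [alpha] times the Levy integral of the primitive of the compensated increment
of [p] ([jump_op_layer]); in the frequency domain this primitive produces exactly
[c / z] and [s^ / z] ([kernel_jump_op]).  Passing to the tail is what makes every
exchange of integrals absolutely convergent, even when [alpha <= 1] and neither
[X] nor the large jumps have a first moment.

For a general [g], integrate the identity for the translates of the kernel
against [g a da].  By an affine substitution this is the identity for the
mollification of [g] ([blur_kernel], [jump_op_mollify]), since [N] commutes with
superpositions of translates.  The kernel has a first moment, so when its width
tends to [0] dominated convergence gives the identity for [g] times the mass of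
the kernel ([real_stein]). *)

(** * Real-valued integrals over a whole space *)

Definition L1 d (T : measurableType d) (R : realType)
    (mu : {measure set T -> \bar R}) (f : T -> R) : Prop :=
  mu.-integrable [set: T] (EFin \o f).
Arguments L1 {d T R} mu f.

Section L1_theory.
Context d (T : measurableType d) (R : realType) (mu : {measure set T -> \bar R}).
Implicit Types f g : T -> R.

Lemma L1_meas f : L1 mu f -> measurable_fun [set: T] f.
Proof. by move=> /(measurable_int mu)/measurable_EFinP. Qed.

Lemma L1_le f g : measurable_fun [set: T] f -> L1 mu g ->
  (forall x, `|f x| <= g x) -> L1 mu f.
Proof.
move=> mf ig fg; apply: le_integrable ig => //; first exact/measurable_EFinP.
move=> x _ /=; rewrite lee_fin.
by rewrite (le_trans (fg x))// ler_norm.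
Qed.

Lemma L1_norm f : L1 mu f -> L1 mu (fun x => `|f x|).
Proof. exact: integrable_norm. Qed.

Lemma L1D f g : L1 mu f -> L1 mu g -> L1 mu (fun x => f x + g x).
Proof. by move=> h1 h2; apply: (integrableD _ h1 h2). Qed.

Lemma L1B f g : L1 mu f -> L1 mu g -> L1 mu (fun x => f x - g x).
Proof. by move=> h1 h2; apply: (integrableB _ h1 h2). Qed.

Lemma L1Zl (k : R) f : L1 mu f -> L1 mu (fun x => k * f x).
Proof. by move=> h1; apply: (integrableZl _ _ h1). Qed.

Lemma L1Zr (k : R) f : L1 mu f -> L1 mu (fun x => f x * k).
Proof. by move=> h1; apply: (integrableZr _ _ h1). Qed.

Lemma L1_bounded (P : probability T R) f (C : R) : measurable_fun [set: T] f ->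
  (forall x, `|f x| <= C) -> L1 P f.
Proof.
move=> mf fC; apply: (@measurable_bounded_integrable _ _ _ P) => //.
  by have := probability_setT P; rewrite /= => ->; rewrite ltry.
by exists C; split; [exact: num_real|move=> M CM x _; apply: le_trans (fC x) (ltW CM)].
Qed.

Lemma L1_mul_bounded f g (C : R) : measurable_fun [set: T] f -> L1 mu g ->
  (forall x, `|f x| <= C) -> L1 mu (fun x => f x * g x).
Proof.
move=> mf ig fC; apply: (@L1_le _ (fun x => C * `|g x|)).
- exact: (measurable_funM mf (L1_meas ig)).
- exact/L1Zl/L1_norm.
- by move=> x; rewrite normrM ler_wpM2r.
Qed.

Lemma Rint_le_norm f g : L1 mu g -> measurable_fun [set: T] f ->
  (forall x, `|f x| <= g x) ->
  `|Rintegral mu setT f| <= Rintegral mu setT g.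
Proof.
move=> ig mf fg; have iF : L1 mu f by apply: L1_le fg.
rewrite (le_trans (le_normr_Rintegral _ _))//.
apply: le_Rintegral => //; exact: L1_norm.
Qed.

Lemma Rint_dominated_cvg (f_ : nat -> T -> R) f g :
  (forall n, measurable_fun [set: T] (f_ n)) ->
  (forall x, f_ n x @[n --> \oo] --> f x) -> L1 mu g ->
  (forall n x, `|f_ n x| <= g x) ->
  L1 mu f /\ Rintegral mu setT (f_ n) @[n --> \oo] --> Rintegral mu setT f.
Proof.
move=> mf cf ig fg.
have mlim : measurable_fun [set: T] f.
  by apply: (measurable_fun_cvg mf) => x _; exact: cf.
have [| | | | |h1 _ h3] := @dominated_convergence _ _ _ mu setT measurableT
  (fun n => EFin \o f_ n) (EFin \o f) (EFin \o g).
- by move=> n; exact/measurable_EFinP.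
- exact/measurable_EFinP.
- apply: aeW => x _; apply: cvg_EFin; [exact: nearW|exact: cf].
- exact: ig.
- by apply: aeW => x n _ /=; rewrite lee_fin.
split => //.
apply: fine_cvg; rewrite fineK; first exact: h3.
exact: integrable_fin_num.
Qed.

Lemma RintZl (k : R) f : L1 mu f ->
  Rintegral mu setT (fun x => k * f x) = k * Rintegral mu setT f.
Proof. by move=> i; rewrite RintegralZl. Qed.

Lemma RintZr (k : R) f : L1 mu f ->
  Rintegral mu setT (fun x => f x * k) = Rintegral mu setT f * k.
Proof. by move=> i; rewrite RintegralZr. Qed.

Lemma RintD f g : L1 mu f -> L1 mu g -> Rintegral mu setT (fun x => f x + g x) =
  Rintegral mu setT f + Rintegral mu setT g.
Proof. by move=> i j; rewrite RintegralD. Qed.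

Lemma RintB f g : L1 mu f -> L1 mu g -> Rintegral mu setT (fun x => f x - g x) =
  Rintegral mu setT f - Rintegral mu setT g.
Proof. by move=> i j; rewrite RintegralB. Qed.

Lemma Rint0 (k : T -> R) : (forall x, k x = 0) -> Rintegral mu setT k = 0.
Proof.
move=> k0; rewrite (_ : k = cst 0); last exact/funext.
by rewrite Rintegral_cst// mul0r.
Qed.

Lemma eq_Rint f g : (forall x, f x = g x) ->
  Rintegral mu setT f = Rintegral mu setT g.
Proof. by move=> fg; apply: eq_Rintegral => x _. Qed.

End L1_theory.

Section Rint_fubini.
Context d1 d2 (T1 : measurableType d1) (T2 : measurableType d2) (R : realType).
Variable m1 : {sigma_finite_measure set T1 -> \bar R}.
Variable m2 : {sigma_finite_measure set T2 -> \bar R}.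
Variable H : T1 -> T2 -> R.
Hypothesis mH : measurable_fun [set: T1 * T2] (fun p => H p.1 p.2).

(** Integrability of all sections, and not just of almost all of them, makes both
inner integrals genuine real numbers at every point. *)
Lemma Rint_fubini :
  (forall s, L1 m2 (H s)) -> (forall t, L1 m1 (H ^~ t)) ->
  L1 m1 (fun s => Rintegral m2 setT (fun t => `|H s t|)) ->
  [/\ L1 m1 (fun s => Rintegral m2 setT (H s)),
      L1 m2 (fun t => Rintegral m1 setT (H ^~ t)) &
      Rintegral m1 setT (fun s => Rintegral m2 setT (H s)) =
      Rintegral m2 setT (fun t => Rintegral m1 setT (H ^~ t))].
Proof.
move=> i1 i2 i12.
pose f (p : T1 * T2) := (H p.1 p.2)%:E.
have mf : measurable_fun setT f by exact/measurable_EFinP.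
have iF : (m1 \x m2)%E.-integrable setT f.
  apply/integrable12ltyP => //.
  move/integrableP : i12 => [_]; apply: le_lt_trans.
  rewrite le_eqVlt; apply/orP; left; apply/eqP.
  apply: eq_integral => s _ /=.
  have := integrable_fin_num measurableT (L1_norm (i1 s)).
  move=> /fineK/= <-; rewrite ger0_norm //.
  exact: fine_ge0 (integral_ge0 _ _).
have E1 : (fun s => \int[m2]_t f (s, t))%E = EFin \o (fun s => Rintegral m2 setT (H s)).
  apply/funext => s /=; rewrite fineK //; exact: (integrable_fin_num measurableT (i1 s)).
have E2 : (fun t => \int[m1]_s f (s, t))%E = EFin \o (fun t => Rintegral m1 setT (H ^~ t)).
  apply/funext => t /=; rewrite fineK //; exact: (integrable_fin_num measurableT (i2 t)).
have iF1 := integrable_fubini_F iF; rewrite /fubini_F E1 in iF1.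
have F12 := integral12_prod_meas1 iF; rewrite /fubini_F E1 in F12.
have F21 := integral21_prod_meas1 iF; rewrite /fubini_G E2 in F21.
have iF2 : m2.-integrable setT (EFin \o (fun t => Rintegral m1 setT (H ^~ t))).
  have mG := measurable_fubini_G iF; rewrite /fubini_G E2 in mG.
  apply/integrableP; split=> //.
  have := (integrable21ltyP _ _ mf).1 iF; apply: le_lt_trans.
  apply: ge0_le_integral => //.
  - exact: measurableT_comp.
  - apply: (measurable_fun_fubini_tonelli_G (abse \o f)) => //=.
    exact: measurableT_comp.
  - move=> t _ /=.
    rewrite /= EFin_normr_Rintegral; [|by []|exact: i2].
    apply: le_abse_integral => //; exact: (measurable_int _ (i2 t)).
split=> //.
by rewrite /Rintegral; move: F12 F21 => /= -> ->.
Qed.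

(** A product bound makes all sections integrable, so Fubini applies. *)
Lemma Rint_fubini_dominated (G : T1 -> R) (w : T2 -> R) : L1 m1 G -> L1 m2 w ->
  (forall s t, `|H s t| <= G s * w t) ->
  [/\ forall s, L1 m2 (H s), forall t, L1 m1 (H ^~ t),
      L1 m1 (fun s => Rintegral m2 setT (H s)),
      L1 m2 (fun t => Rintegral m1 setT (H ^~ t)) &
      Rintegral m1 setT (fun s => Rintegral m2 setT (H s)) =
      Rintegral m2 setT (fun t => Rintegral m1 setT (H ^~ t))].
Proof.
move=> iG iw HGw.
have i1 s : L1 m2 (H s).
  apply: (@L1_le _ _ _ _ _ (fun t => G s * w t)) => //; last exact: L1Zl.
  exact: (measurableT_comp mH (measurable_pair1 s)).
have i2 t : L1 m1 (H ^~ t).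
  apply: (@L1_le _ _ _ _ _ (fun s => G s * w t)) => //; last exact: L1Zr.
  exact: (measurableT_comp mH (measurable_pair2 t)).
have [|a b c] := Rint_fubini i1 i2; last by split.
apply: (@L1_le _ _ _ _ _ (fun s => G s * Rintegral m2 setT w)).
- have mf : measurable_fun setT (fun s => (\int[m2]_t (`|H s t|)%:E)%E).
    apply: (measurable_fun_fubini_tonelli_F (fun p => (`|H p.1 p.2|)%:E)) => //.
    by apply/measurable_EFinP; exact: measurableT_comp.
  exact: (measurableT_comp (@fine_measurable R setT measurableT) mf).
- exact: L1Zr.
- move=> s; rewrite -RintegralZl//; apply: Rint_le_norm.
  + exact: L1Zl.
  + exact: L1_meas (L1_norm (i1 s)).
  + by move=> t; rewrite normr_id.
Qed.

End Rint_fubini.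

(** * Affine substitutions and the fundamental theorem by exhaustion *)

Section affine.
Context {R : realType}.
Local Notation leb := (@lebesgue_measure R).
Variables (b c : R).
Hypothesis c0 : c != 0.

Let phi (x : measurableTypeR R) : measurableTypeR R := b + c * x.

Let mphi : measurable_fun [set: measurableTypeR R] phi.
Proof. by apply: measurable_funD => //; exact: measurable_funM. Qed.

Let cn0 : 0 < `|c|. Proof. by rewrite normr_gt0. Qed.

Let phi_itv (p q : R) : leb (phi @^-1` `]p, q]) = ((`|c|^-1)%:E * leb `]p, q])%E.
Proof.
have [cpos|cneg|] := ltgtP 0 c; last by move/esym/eqP; rewrite (negbTE c0).
- rewrite (_ : phi @^-1` `]p, q] = `](p - b) / c, (q - b) / c]%classic); last first.
    apply/seteqP; split=> x /=; rewrite !in_itv/= /phi ltr_pdivrMr// ler_pdivlMr// ltrBlDr lerBrDr mulrC addrC => //.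
  rewrite !lebesgue_measure_itv/= !lte_fin ltr_pM2r ?invr_gt0// ltrD2r.
  case: ifPn => _; last by rewrite mule0.
  by rewrite -!EFinD -EFinM gtr0_norm//; congr EFin; field.
- rewrite (_ : phi @^-1` `]p, q] = `[(q - b) / c, (p - b) / c[%classic); last first.
    apply/seteqP; split=> x /=; rewrite !in_itv/= /phi ltr_ndivlMr// ler_ndivrMr// ltrBlDr lerBrDr mulrC addrC andbC => //.
  rewrite !lebesgue_measure_itv/= !lte_fin ltr_nM2r ?invr_lt0// ltrD2r.
  case: ifPn => _; last by rewrite mule0.
  by rewrite -!EFinD -EFinM ltr0_norm//; congr EFin; field.
Qed.

(** Both sides are measures in [A]; they agree on half-open intervals. *)
Lemma lebesgue_affine (A : set (measurableTypeR R)) : measurable A ->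
  leb (phi @^-1` A) = ((`|c|^-1)%:E * leb A)%E.
Proof.
move=> mA.
have [m mE] : exists m : {measure set (measurableTypeR R) -> \bar R},
    forall B, m B = (`|c|%:E * pushforward leb phi B)%E.
  unshelve eexists.
    apply: (mscale (NngNum (ltW cn0)) (pushforward leb phi)); exact: mphi.
  by [].
have -> : leb A = m A.
  apply: lebesgue_measure_unique => // X [[p q] _ <-].
  rewrite mE /pushforward phi_itv muleA -EFinM divff ?mul1e//.
  by rewrite normr_eq0.
rewrite mE muleA -EFinM mulVf ?mul1e// normr_eq0 //.
Qed.

Let ge0_integral_affine (g : measurableTypeR R -> \bar R) :
  measurable_fun setT g -> (forall x, 0 <= g x)%E ->
  (\int[leb]_x g (phi x) = (`|c|^-1)%:E * \int[leb]_x g x)%E.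
Proof.
move=> mg g0.
have cV0 : 0 <= `|c|^-1 by rewrite invr_ge0 ltW.
have := @ge0_integral_pushforward _ _ _ _ _ phi mphi leb setT g measurableT mg (fun x _ => g0 x).
rewrite preimage_setT => <-.
rewrite -(@ge0_integral_mscale _ _ _ leb setT measurableT (NngNum cV0))//.
apply: eq_measure_integral => A mA _.
have h := lebesgue_affine mA; etransitivity; [exact: h|by []].
Qed.

Lemma Rint_affine (f : R -> R) : L1 leb f ->
  L1 leb (fun x => f (b + c * x)) /\
  Rintegral leb setT (fun x => f (b + c * x)) = `|c|^-1 * Rintegral leb setT f.
Proof.
move=> iF; have mf := L1_meas iF.
have mEf : measurable_fun setT (EFin \o f) by exact/measurable_EFinP.
have mfp : measurable_fun setT (fun x => f (b + c * x)) by exact: (measurableT_comp mf mphi).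
split.
  apply/integrableP; split; first exact/measurable_EFinP.
  have := ge0_integral_affine (measurableT_comp (@abse_measurable R setT) mEf) (fun x => abse_ge0 _).
  move=> /= ->; rewrite lte_mul_pinfty ?lee_fin ?invr_ge0//.
  by case/integrableP : iF.
rewrite /Rintegral [X in fine X]integralE.
have /= h1 := ge0_integral_affine (measurable_funepos mEf) (funepos_ge0 _).
have /= h2 := ge0_integral_affine (measurable_funeneg mEf) (funeneg_ge0 _).
transitivity (fine ((`|c|^-1)%:E * \int[leb]_x (EFin \o f)^\+ x - (`|c|^-1)%:E * \int[leb]_x (EFin \o f)^\- x)%E).
  rewrite -h1 -h2; congr (fine (_ - _)%E); apply: eq_integral => x _; by rewrite ?funeposE ?funenegE.
have p1 := integrable_fin_num measurableT (integrable_funepos measurableT iF).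
have p2 := integrable_fin_num measurableT (integrable_funeneg measurableT iF).
rewrite -muleBr//; last by rewrite fin_num_adde_defr.
rewrite fineM//; last by rewrite fin_numB; apply/andP; split; [exact: p1|exact: p2].
by congr (_ * fine _); rewrite [RHS]integralE.
Qed.

End affine.

Section ftc_exhaustion.
Context {R : realType}.
Local Notation leb := (@lebesgue_measure R).
Variables (D : set R) (a_ b_ : nat -> R) (F f : R -> R) (la lb : R).
Hypothesis ab : forall n, a_ n < b_ n.
Hypothesis a_dec : forall m n, (m <= n)%N -> a_ n <= a_ m.
Hypothesis b_inc : forall m n, (m <= n)%N -> b_ m <= b_ n.
Hypothesis abD : forall x, D x <-> exists n, a_ n <= x <= b_ n.
Hypothesis Ff : forall x, D x -> is_derive x (1 : R) F (f x).
Hypothesis cf : forall x, D x -> {for x, continuous f}.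
Hypothesis Fa : F (a_ n) @[n --> \oo] --> la.
Hypothesis Fb : F (b_ n) @[n --> \oo] --> lb.

Let I n := `[a_ n, b_ n]%classic.

Let mI n : measurable (I n). Proof. exact: measurable_itv. Qed.

Let ID n x : I n x -> D x.
Proof. by rewrite /I/= in_itv/= => xab; apply/abD; exists n. Qed.

Let mD : measurable D.
Proof.
rewrite (_ : D = \bigcup_n I n); first exact: bigcup_measurable.
apply/seteqP; split => x.
  by move=> /abD[n xn]; exists n => //; rewrite /I/= in_itv.
by move=> [n _ /ID].
Qed.

Let f_ n x := f x * \1_(I n) x.

Let cfI n : {within I n, continuous f}.
Proof.
by apply: continuous_in_subspaceT => x /set_mem /ID; exact: cf.
Qed.

Let f_L1 n : L1 leb (f_ n).
Proof.
have h : leb.-integrable (I n) (EFin \o f).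
  by apply: continuous_compact_integrable => //; exact: segment_compact.
rewrite /L1 /f_; move/integrable_mkcond : h => /(_ (mI n)).
apply: eq_integrable => // x _.
rewrite /= patchE indicE; case: ifPn => xI; first by rewrite mulr1.
by rewrite mulr0.
Qed.

Let f_int n : Rintegral leb setT (f_ n) = F (b_ n) - F (a_ n).
Proof.
transitivity (\int[leb]_(x in I n) f x).
  rewrite [RHS]Rintegral_mkcond; apply: eq_Rintegral => x _.
  rewrite /f_ patchE indicE; case: ifPn => xI; first by rewrite mulr1.
  by rewrite mulr0.
rewrite /Rintegral (@continuous_FTC2 _ f F _ _ (ab n)) //.
- exact: cfI.
- have dF x : D x -> {for x, continuous F}.
    by move=> /Ff h; apply/differentiable_continuous/derivable1_diffP; exact: ex_derive.
  split.
  + move=> x; rewrite in_itv/= => /andP[ax xb].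
    by have h : D x by [apply/abD; exists n; rewrite !ltW]; have := Ff h => h'; exact: ex_derive.
  + by apply/cvg_at_right_filter/dF/abD; exists n; rewrite lexx ltW.
  + by apply/cvg_at_left_filter/dF/abD; exists n; rewrite lexx ltW.
- move=> x; rewrite in_itv/= => /andP[ax xb].
  have h : D x by apply/abD; exists n; rewrite !ltW.
  by have := Ff h => h'; rewrite derive1E derive_val.
Qed.

Let I_le m n x : (m <= n)%N -> I m x -> I n x.
Proof.
rewrite /I/= !in_itv/= => mn /andP[ax xb].
by rewrite (le_trans (a_dec mn))// (le_trans xb)// b_inc.
Qed.

Let f_cvg x : f_ n x @[n --> \oo] --> f x * \1_D x.
Proof.
have [/[dup] Dx /abD[N xN]|nDx] := pselect (D x).
  apply: cvg_near_cst; near=> n.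
  rewrite /f_ !indicE mem_set ?mem_set//.
  apply: (@I_le N); last by rewrite /I/= in_itv.
  by near: n; exact: nbhs_infty_ge.
rewrite [X in _ --> X](_ : _ = 0); last by rewrite indicE memNset// mulr0.
apply: cvg_near_cst; apply: nearW => n.
by rewrite /f_ indicE memNset ?mulr0// => /ID.
Unshelve. all: by end_near. Qed.

Let fab_cvg : Rintegral leb setT (f_ n) @[n --> \oo] --> lb - la.
Proof. by under eq_fun do rewrite f_int; exact: cvgB. Qed.

(** Exhausting [D] by compact intervals covers unbounded domains and integrands
that are singular at an end-point; only the limits of the primitive along the
end-points matter. *)
Lemma ftc_exhaust : L1 leb (fun x => f x * \1_D x) ->
  Rintegral leb setT (fun x => f x * \1_D x) = lb - la.
Proof.
move=> fD.
have [||||_ h] := @Rint_dominated_cvg _ _ _ leb f_ (fun x => f x * \1_D x) (fun x => `|f x * \1_D x|).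
- by move=> n; exact: L1_meas (f_L1 n).
- exact: f_cvg.
- exact: L1_norm.
- move=> n x; rewrite /f_ !normrM ler_wpM2l// !indicE.
  case: (boolP (x \in I n)) => xI; last by rewrite normr0.
  by rewrite mem_set//; exact: (ID (set_mem xI)).
exact: (cvg_unique _ h fab_cvg).
Qed.

(** For a nonnegative integrand the limits of the primitive bound the integral. *)
Lemma ge0_ftc_exhaust_L1 : (forall x, D x -> 0 <= f x) ->
  L1 leb (fun x => f x * \1_D x).
Proof.
move=> f0.
have f_0 n x : 0 <= f_ n x.
  rewrite /f_ indicE; case: (boolP (x \in I n)) => xI; rewrite ?mulr0// mulr1.
  exact/f0/(ID (set_mem xI)).
have fx0 x : 0 <= f x * \1_D x.
  rewrite indicE; case: (boolP (x \in D)) => xI; rewrite ?mulr0// mulr1.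
  exact/f0/set_mem.
have mfD : measurable_fun setT (fun x => f x * \1_D x).
  apply: (@measurable_fun_cvg _ _ _ setT f_); last by move=> x _; exact: f_cvg.
  by move=> n; exact: L1_meas (f_L1 n).
apply/integrableP; split; first exact/measurable_EFinP.
have h1 n : measurable_fun setT (EFin \o f_ n) by apply/measurable_EFinP; exact: (L1_meas (f_L1 n)).
have h2 n x : setT x -> (0 <= (EFin \o f_ n) x)%E by move=> _; rewrite lee_fin; exact: f_0.
have h3 x : setT x -> nondecreasing_seq ((fun n => EFin \o f_ n) ^~ x).
  move=> _ m n mn; rewrite lee_fin /f_ !indicE.
  case: (boolP (x \in I m)) => xI; last by rewrite mulr0; exact: f_0.
  by rewrite (mem_set (I_le mn (set_mem xI))).
have E : (\int[leb]_x limn (fun n => (EFin \o f_ n) x) = \int[leb]_x (f x * \1_D x)%:E)%E.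
  apply: eq_integral => x _; apply/cvg_lim => //.
  by apply: cvg_EFin; [exact: nearW|exact: f_cvg].
have := @cvg_monotone_convergence _ _ _ leb _ measurableT _ h1 h2 h3; rewrite E.
have -> : (\int[leb]_x `|(EFin \o (fun x => (f x * \1_D x)%R)) x| = \int[leb]_x (f x * \1_D x)%:E)%E.
  by apply: eq_integral => x _ /=; rewrite ger0_norm.
move=> hc; rewrite -(cvg_lim _ hc); last exact: ereal_hausdorff.
rewrite (_ : limn _ = (lb - la)%:E) ?ltry//.
apply/cvg_lim => //.
rewrite (_ : (fun n => _) = EFin \o (fun n => Rintegral leb setT (f_ n))).
  by apply: cvg_EFin; [exact: nearW|exact: fab_cvg].
apply/funext => n /=; rewrite fineK//.
exact: (integrable_fin_num measurableT (f_L1 n)).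
Qed.

End ftc_exhaustion.

(** * Integrals against a measure with a density *)

Section density.
Context d (T : measurableType d) (R : realType).
Variables (mu nu : {measure set T -> \bar R}) (r : T -> R).
Hypothesis r0 : forall x, 0 <= r x.
Hypothesis mr : measurable_fun [set: T] r.
Hypothesis nuE : forall A, measurable A -> nu A = (\int[mu]_(x in A) (r x)%:E)%E.

Import HBNNSimple.
Local Open Scope ereal_scope.

(** The case of simple functions, which monotone convergence extends. *)
Let density_nnsfun (f : {nnsfun T >-> R}) :
  \int[nu]_x (f x)%:E = \int[mu]_x (f x * r x)%:E.
Proof.
under [LHS]eq_integral do rewrite fimfunE -fsumEFin//.
rewrite [LHS]ge0_integral_fsum//; last 2 first.
  - by move=> y; exact/measurable_EFinP/measurableT_comp.
  - by move=> n x _; rewrite EFinM nnfun_muleindic_ge0.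
under [RHS]eq_integral.
  move=> x xD; rewrite EFinM fimfunE -fsumEFin// ge0_mule_fsuml; last first.
    by move=> y; rewrite EFinM nnfun_muleindic_ge0.
  over.
rewrite [RHS]ge0_integral_fsum//; last 2 first.
  - move=> y; apply: emeasurable_funM; last exact/measurable_EFinP.
    by apply/measurable_EFinP/measurableT_comp => //; exact: measurable_indic.
  - move=> n x _; apply: mule_ge0; last by rewrite lee_fin.
    by rewrite EFinM nnfun_muleindic_ge0.
apply: eq_fsbigr => y _.
rewrite [LHS]integralZl_indic_nnsfun//= integral_indic// setIT nuE//.
have [y0|y0] := ltP y 0%R.
  rewrite preimage_nnfun0// integral_set0 mule0.
  by rewrite integral0_eq// => x _; rewrite indic0 mulr0 mul0e.
rewrite -ge0_integralZl//; last 2 first.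
  - by apply/measurable_EFinP; exact: measurable_funTS.
  - by move=> x _; rewrite lee_fin.
rewrite integral_mkcond; apply: eq_integral => x _.
rewrite patchE indicE; case: ifPn => _; first by rewrite mulr1.
by rewrite mulr0 mul0e.
Qed.

Lemma ge0_integral_density (f : T -> \bar R) : measurable_fun setT f ->
  (forall x, 0 <= f x) ->
  \int[nu]_x f x = \int[mu]_x (f x * (r x)%:E).
Proof.
move=> mf f0.
pose f_ := nnsfun_approx measurableT mf.
transitivity (limn (fun n => \int[nu]_x (f_ n x)%:E)).
  rewrite -monotone_convergence//.
  - apply: eq_integral => ? /[!inE] xD; apply/esym/cvg_lim => //=.
    exact: cvg_nnsfun_approx.
  - by move=> n; exact/measurable_EFinP/measurable_funTS.
  - by move=> n ? _; rewrite lee_fin.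
  - by move=> ? _ ? ? mn; rewrite lee_fin; exact/lefP/nd_nnsfun_approx.
rewrite (_ : \int[mu]_x (f x * (r x)%:E) =
             limn (fun n => \int[mu]_x (f_ n x * r x)%:E)).
  by congr (limn _); apply/funext => n; exact: density_nnsfun.
rewrite -monotone_convergence//.
- apply: eq_integral => x _; apply/esym/cvg_lim => //=.
  under eq_fun do rewrite EFinM.
  by apply: cvgeZr => //; exact: cvg_nnsfun_approx.
- by move=> n; apply/measurable_EFinP; exact: measurable_funM.
- by move=> n x _; rewrite lee_fin mulr_ge0.
- move=> x _ m n mn; rewrite lee_fin ler_wpM2r//.
  exact/lefP/nd_nnsfun_approx.
Qed.

Lemma Rint_density (f : T -> R) : measurable_fun setT f ->
  L1 mu (fun x => f x * r x)%R ->
  L1 nu f /\ Rintegral nu setT f = Rintegral mu setT (fun x => f x * r x)%R.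
Proof.
move=> mf ifr; have mEf : measurable_fun setT (EFin \o f) by exact/measurable_EFinP.
have E1 : EFin \o (fun x => f x * r x)%R = fun x => (EFin \o f) x * (r x)%:E by [].
split.
  apply/integrableP; split => //.
  rewrite ge0_integral_density//; last exact: measurableT_comp.
  case/integrableP : ifr => _; congr (_ < _); apply: eq_integral => x _ /=.
  by rewrite normrM EFinM (ger0_norm (r0 x)).
rewrite /Rintegral; congr fine; rewrite integralE [RHS]integralE.
rewrite !ge0_integral_density//; [|exact: measurable_funeneg|exact: measurable_funepos].
congr (_ - _); apply: eq_integral => x _.
- by rewrite !funeposE /= EFinM maxe_pMl ?mul0e ?lee_fin.
- by rewrite !funenegE /=; rewrite maxe_pMl ?mul0e ?lee_fin -?EFinM ?mulNr.
Qed.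

End density.

(** * Integrals of powers *)

Section power_integrals.
Context {R : realType}.
Local Notation leb := (@lebesgue_measure R).

Lemma continuous_powR (x e : R) : 0 < x -> {for x, continuous (fun v => v `^ e)}.
Proof.
move=> x0; apply/differentiable_continuous/derivable1_diffP.
exact/derivable_powR/andP.
Qed.

Lemma cvg_seq_powR0 (s : R) (u_ : nat -> R) : 0 < s -> (forall n, 0 < u_ n) ->
  u_ n @[n --> \oo] --> 0 -> (u_ n) `^ s @[n --> \oo] --> 0.
Proof.
move=> s0 u0 cu.
have := powR_cvg0 s0 => /cvg_at_rightP h.
by apply: h.
Qed.

Lemma pow_tail (e u : R) : e < -1 -> 0 < u ->
  L1 leb (fun v => v `^ e * \1_[set v : R | u < v] v) /\
  Rintegral leb setT (fun v => v `^ e * \1_[set v : R | u < v] v) =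
    - (u `^ (e + 1) / (e + 1)).
Proof.
move=> e1 u0.
have en0 : e + 1 != 0 by rewrite lt_eqF//; lra.
pose a_ (n : nat) : R := u + n.+1%:R^-1.
pose b_ (n : nat) : R := u + n.+2%:R.
have ab n : a_ n < b_ n.
  rewrite ltrD2l (@le_lt_trans _ _ 1)// ?invf_le1// ?ler1n// ltr1n//.
have a_dec m n : (m <= n)%N -> a_ n <= a_ m.
  by move=> mn; rewrite lerD2l lef_pV2 ?posrE// ler_nat ltnS.
have b_inc m n : (m <= n)%N -> b_ m <= b_ n.
  by move=> mn; rewrite lerD2l ler_nat !ltnS.
have abD (x : R) : [set v : R | u < v] x <-> exists n, a_ n <= x <= b_ n.
  split=> /=; last first.
    by move=> [n /andP[+ _]]; apply: lt_le_trans; rewrite ltrDl invr_gt0.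
  move=> ux; have xu : 0 < x - u by rewrite subr_gt0.
  pose n := maxn (Num.bound (x - u)^-1) (Num.bound (x - u)).
  have h1 : (x - u)^-1 < n.+1%:R.
    rewrite (@lt_le_trans _ _ (Num.bound (x - u)^-1)%:R)//.
      by rewrite archi_boundP// invr_ge0 ltW.
    by rewrite ler_nat leqW// leq_maxl.
  have h2 : x - u < n.+2%:R.
    rewrite (@lt_le_trans _ _ (Num.bound (x - u))%:R)//.
      by rewrite archi_boundP// ltW.
    by rewrite ler_nat !leqW// leq_maxr.
  exists n; rewrite /a_ /b_; apply/andP; split; last by rewrite -lerBlDl ltW.
  rewrite -lerBrDl.
  by rewrite -[leRHS]invrK lef_pV2 ?posrE ?invr_gt0// ltW.
have pos (x : R) : [set v : R | u < v] x -> 0 < x by move=> /= ; exact: lt_trans.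
pose F (v : R) := v `^ (e + 1) / (e + 1).
have Ff (x : R) : [set v : R | u < v] x -> is_derive x (1 : R) F (x `^ e).
  move=> /pos x0; have h := is_derive1_powR (e + 1) x0.
  rewrite /F; apply: is_derive_eq.
  by rewrite addrK /GRing.scale/= ; field.
have cf (x : R) : [set v : R | u < v] x -> {for x, continuous (fun v => v `^ e)}.
  by move=> /pos x0; exact: continuous_powR.
have Fa : F (a_ n) @[n --> \oo] --> F u.
  apply: cvgMl; apply: (cvg_comp a_ (fun v => v `^ (e + 1))); last exact: continuous_powR u0.
  rewrite -[u]addr0; apply: cvgD; first exact: cvg_cst.
  exact: cvg_harmonic.
have Fb : F (b_ n) @[n --> \oo] --> 0.
  rewrite -(mul0r (e + 1)^-1); apply: cvgMl.
  have -> : (fun n => b_ n `^ (e + 1)) = (fun n => (b_ n)^-1 `^ (- (e + 1))).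
    apply/funext => n; rewrite -powR_inv1; last by rewrite /b_ addr_ge0// ltW.
    by rewrite -powRrM mulN1r opprK.
  apply: cvg_seq_powR0.
  - lra.
  - by move=> n; rewrite invr_gt0 /b_ addr_gt0.
  - apply: (@squeeze_cvgr _ _ _ _ (fun=> 0) (@harmonic R)).
    + apply: nearW => n; have bn : n.+1%:R <= b_ n by rewrite /b_ -[leLHS]add0r; apply: lerD; [exact: ltW|rewrite ler_nat].
      have b0 : 0 < b_ n by apply: lt_le_trans bn.
      by rewrite invr_ge0 ltW//= lef_pV2 ?posrE.
    + exact: cvg_cst.
    + exact: cvg_harmonic.
have iL := ge0_ftc_exhaust_L1 ab a_dec b_inc abD Ff cf Fa Fb (fun x _ => powR_ge0 _ _).
split => //.
by rewrite (ftc_exhaust ab a_dec b_inc abD Ff cf Fa Fb iL) sub0r.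
Qed.

Lemma pow_head (e : R) : -1 < e ->
  L1 leb (fun v => v `^ e * \1_[set v : R | 0 < v <= 1] v).
Proof.
move=> e1.
have en0 : e + 1 != 0 by rewrite gt_eqF//; lra.
pose a_ (n : nat) : R := n.+2%:R^-1.
pose b_ (n : nat) : R := 1.
have ab n : a_ n < b_ n.
  by rewrite invf_lt1// ltr1n.
have a_dec m n : (m <= n)%N -> a_ n <= a_ m.
  by move=> mn; rewrite lef_pV2 ?posrE// ler_nat !ltnS.
have b_inc m n : (m <= n)%N -> b_ m <= b_ n by [].
have abD (x : R) : [set v : R | 0 < v <= 1] x <-> exists n, a_ n <= x <= b_ n.
  split=> /=; last first.
    by move=> [n /andP[+ ->]]; rewrite andbT; apply: lt_le_trans; rewrite invr_gt0.
  move=> /andP[x0 x1].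
  exists (Num.bound x^-1); rewrite x1 andbT /a_ -[leRHS]invrK lef_pV2 ?posrE ?invr_gt0//.
  rewrite (@le_trans _ _ (Num.bound x^-1)%:R)//.
    by rewrite ltW// archi_boundP// invr_ge0 ltW.
  by rewrite ler_nat; apply: leqW; exact: leqW.
have pos (x : R) : [set v : R | 0 < v <= 1] x -> 0 < x by move=> /= /andP[].
pose F (v : R) := v `^ (e + 1) / (e + 1).
have Ff (x : R) : [set v : R | 0 < v <= 1] x -> is_derive x (1 : R) F (x `^ e).
  move=> /pos x0; have h := is_derive1_powR (e + 1) x0.
  rewrite /F; apply: is_derive_eq.
  by rewrite addrK /GRing.scale/= ; field.
have cf (x : R) : [set v : R | 0 < v <= 1] x -> {for x, continuous (fun v => v `^ e)}.
  by move=> /pos x0; exact: continuous_powR.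
have Fa : F (a_ n) @[n --> \oo] --> 0.
  rewrite -(mul0r (e + 1)^-1); apply: cvgMl; apply: cvg_seq_powR0.
  - lra.
  - by move=> n; rewrite invr_gt0.
  - by rewrite (cvg_shiftS (@harmonic R)); exact: cvg_harmonic.
have Fb : F (b_ n) @[n --> \oo] --> F 1 by apply: cvg_near_cst; apply: nearW.
exact: (ge0_ftc_exhaust_L1 ab a_dec b_inc abD Ff cf Fa Fb (fun x _ => powR_ge0 _ _)).
Qed.

End power_integrals.

(** * The Levy density *)

Section affine_cor.
Context {R : realType}.
Local Notation leb := (@lebesgue_measure R).

Lemma Rint_opp (f : R -> R) : L1 leb f -> L1 leb (fun x => f (- x)) /\
  Rintegral leb setT (fun x => f (- x)) = Rintegral leb setT f.
Proof.
move=> iF; have c0 : (-1 : R) != 0 by rewrite oppr_eq0 oner_eq0.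
have := Rint_affine 0 c0 iF.
have -> : (fun x => f (0 + -1 * x)) = (fun x => f (- x)).
  by apply/funext => x; rewrite add0r mulN1r.
by rewrite normrN1 invr1 mul1r.
Qed.

Lemma Rint_scale (c : R) (f : R -> R) : 0 < c -> L1 leb f ->
  L1 leb (fun x => f (c * x)) /\
  Rintegral leb setT (fun x => f (c * x)) = c^-1 * Rintegral leb setT f.
Proof.
move=> c0 iF; have := Rint_affine 0 (lt0r_neq0 c0) iF.
have -> : (fun x => f (0 + c * x)) = (fun x => f (c * x)).
  by apply/funext => x; rewrite add0r.
by rewrite gtr0_norm.
Qed.

Lemma Rint_shift (b : R) (f : R -> R) : L1 leb f ->
  L1 leb (fun x => f (b + x)) /\
  Rintegral leb setT (fun x => f (b + x)) = Rintegral leb setT f.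
Proof.
move=> iF; have := Rint_affine b (oner_neq0 R) iF.
have -> : (fun x => f (b + 1 * x)) = (fun x => f (b + x)).
  by apply/funext => x; rewrite mul1r.
by rewrite normr1 invr1 mul1r.
Qed.

End affine_cor.

Section levy.
Context {R : realType}.
Local Notation leb := (@lebesgue_measure R).
Variable alpha : R.
Hypothesis alpha_gt0 : 0 < alpha.
Hypothesis alpha_lt2 : alpha < 2.

Implicit Types m : {nonneg R}.

Lemma levy_density_gt0 m1 m2 (v : R) : 0 < v ->
  levy_density alpha m1 m2 v = m1%:num * v `^ (- (1 + alpha)).
Proof.
move=> v0; rewrite /levy_density !indicE mem_set// memNset/=; last first.
  by apply/negP; rewrite -leNgt ltW.
by rewrite mulr1 mulr0 addr0 powRN.
Qed.

Lemma levy_density_lt0 m1 m2 (v : R) : v < 0 ->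
  levy_density alpha m1 m2 v = m2%:num * (- v) `^ (- (1 + alpha)).
Proof.
move=> v0; rewrite /levy_density !indicE [in X in _ + X]mem_set// memNset/=; last first.
  by apply/negP; rewrite -leNgt ltW.
by rewrite mulr1 mulr0 add0r powRN ltr0_norm.
Qed.

Lemma levy_density0 m1 m2 : levy_density alpha m1 m2 0 = 0.
Proof.
by rewrite /levy_density !indicE !memNset/= ?ltxx// !mulr0 addr0.
Qed.

Lemma levy_densityN m1 m2 (v : R) :
  levy_density alpha m1 m2 (- v) = levy_density alpha m2 m1 v.
Proof.
have [v0|v0|->] := ltgtP v 0.
- by rewrite levy_density_gt0 ?oppr_gt0// levy_density_lt0.
- by rewrite levy_density_lt0 ?oppr_lt0// levy_density_gt0// opprK.
- by rewrite oppr0 !levy_density0.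
Qed.

Lemma levy_densityZ m1 m2 (z v : R) : 0 < z ->
  levy_density alpha m1 m2 (z * v) =
    z `^ (- (1 + alpha)) * levy_density alpha m1 m2 v.
Proof.
move=> z0; have [v0|v0|->] := ltgtP v 0; last by rewrite mulr0 levy_density0 mulr0.
- rewrite !levy_density_lt0 ?pmulr_rlt0// -mulrN powRM ?oppr_ge0 ?ltW//.
  by rewrite mulrCA.
- rewrite !levy_density_gt0 ?pmulr_rgt0// powRM ?ltW//.
  by rewrite mulrCA.
Qed.

(** Quadratic at [0] and of order [delta] at infinity, up to the unit sphere: the
majorant of all compensated integrands, integrable against the Levy density
exactly because [alpha < 2] and [delta < alpha]. *)
Definition levy_weight (delta v : R) : R :=
  v ^+ 2 * \1_[set w : R | `|w| <= 1] v + `|v| `^ delta * \1_[set w : R | 1 < `|w|] v.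

Lemma levy_weight_near delta v : `|v| <= 1 -> levy_weight delta v = v ^+ 2.
Proof.
move=> v1; rewrite /levy_weight !indicE mem_set// memNset/= ?mulr1 ?mulr0 ?addr0//.
by apply/negP; rewrite -leNgt.
Qed.

Lemma levy_weight_far delta v : 1 < `|v| -> levy_weight delta v = `|v| `^ delta.
Proof.
move=> v1; rewrite /levy_weight !indicE [in X in _ + X]mem_set// memNset/= ?mulr1 ?mulr0 ?add0r//.
by apply/negP; rewrite -ltNge.
Qed.

Lemma levy_weight_L1 m1 m2 delta : delta < alpha ->
  L1 leb (fun v => levy_weight delta v * levy_density alpha m1 m2 v).
Proof.
move=> da.
pose k (v : R) := v `^ (1 - alpha) * \1_[set w : R | 0 < w <= 1] v +
  v `^ (delta - (1 + alpha)) * \1_[set w : R | 1 < w] v.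
have e1 : -1 < 1 - alpha by have h := alpha_lt2; lra.
have e2 : delta - (1 + alpha) < -1 by lra.
have ik : L1 leb k.
  apply: L1D; first exact: pow_head.
  by have [] := pow_tail e2 ltr01.
have [ikN _] := Rint_opp ik.
have kE v : 0 < v -> k v = levy_weight delta v * v `^ (- (1 + alpha)).
  move=> v0; have [v1|v1] := leP `|v| 1.
  - rewrite levy_weight_near// /k !indicE mem_set/=; last by move: v1; rewrite gtr0_norm// => ->; rewrite v0.
    rewrite memNset/=; last by move: v1; rewrite gtr0_norm// => v1; apply/negP; rewrite -leNgt.
    rewrite mulr1 mulr0 addr0 -powR_mulrn ?ltW// -powRD ?(gt_eqF v0) ?implybT//.
    by congr (_ `^ _); ring.
  - rewrite levy_weight_far// /k !indicE [in X in _ + X]mem_set/=; last by move: v1; rewrite gtr0_norm.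
    rewrite memNset/=; last by move: v1; rewrite gtr0_norm// => v1; apply/negP; rewrite v0/= -ltNge.
    by rewrite mulr1 mulr0 add0r gtr0_norm// -powRD// (gt_eqF v0) implybT.
have k0 v : v <= 0 -> k v = 0.
  move=> v0; rewrite /k !indicE memNset/=; last by apply/negP; rewrite negb_and -leNgt v0.
  rewrite memNset/=; last by apply/negP; rewrite -leNgt (le_trans v0).
  by rewrite !mulr0 addr0.
have wN v : levy_weight delta (- v) = levy_weight delta v.
  have [v1|v1] := leP `|v| 1.
    by rewrite !levy_weight_near ?normrN// sqrrN.
  by rewrite !levy_weight_far ?normrN.
rewrite (_ : (fun _ => _) = (fun v => m1%:num * k v + m2%:num * k (- v))).
  by apply: L1D; exact: L1Zl.
apply/funext => v; have [v0|v0|->] := ltgtP v 0.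
- rewrite (k0 v) ?ltW// kE ?oppr_gt0// wN levy_density_lt0//; ring.
- rewrite (k0 (- v)) ?oppr_le0 ?ltW// kE// levy_density_gt0//; ring.
- by rewrite oppr0 !k0// levy_density0 !mulr0 addr0.
Qed.

Lemma levy_tail m1 m2 (u : R) : 0 < u ->
  L1 leb (fun v => \1_[set w : R | u < w] v * levy_density alpha m1 m2 v) /\
  Rintegral leb setT (fun v => \1_[set w : R | u < w] v * levy_density alpha m1 m2 v)
    = m1%:num * (u `^ (- alpha) / alpha).
Proof.
move=> u0; have e1 : - (1 + alpha) < -1 by have h := alpha_gt0; lra.
have [i1 i2] := pow_tail e1 u0.
rewrite (_ : (fun _ => _) = (fun v => m1%:num * (v `^ (- (1 + alpha)) * \1_[set w : R | u < w] v))); last first.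
  apply/funext => v; have [uv|vu] := ltP u v.
    rewrite levy_density_gt0 ?(lt_trans u0)// mulrC mulrA//.
  rewrite !indicE memNset/=; last by apply/negP; rewrite -leNgt.
  by rewrite mul0r !mulr0.
split; first exact: L1Zl.
rewrite RintegralZl// i2; congr (_ * _).
rewrite (_ : - (1 + alpha) + 1 = - alpha); last ring.
by rewrite invrN mulrN opprK.
Qed.

End levy.

(** * Derivative rules and Lipschitz bounds *)

(** A name that hides the derivative class, so that derivatives are computed by
explicit rules rather than by instance search. *)
Definition has_deriv (R : realType) (f : R -> R) (x a : R) : Prop :=
  is_derive x (1 : R) f a.

Section derivatives.
Context {R : realType}.
Implicit Types f g : R -> R.

Lemma has_deriv_cst (c x : R) : has_deriv (fun=> c) x 0.
Proof. exact: is_derive_cst. Qed.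

Lemma has_deriv_id (x : R) : has_deriv (fun t => t) x 1.
Proof. exact: is_derive_id. Qed.

Lemma has_derivD f g (x a b : R) : has_deriv f x a -> has_deriv g x b ->
  has_deriv (fun t => f t + g t) x (a + b).
Proof. exact: is_deriveD. Qed.

Lemma has_derivN f (x a : R) : has_deriv f x a ->
  has_deriv (fun t => - f t) x (- a).
Proof. exact: is_deriveN. Qed.

Lemma has_derivM f g (x a b : R) : has_deriv f x a -> has_deriv g x b ->
  has_deriv (fun t => f t * g t) x (a * g x + f x * b).
Proof.
move=> h1 h2; have h := is_deriveM h1 h2.
by apply: is_derive_eq h _; rewrite addrC /GRing.scale/= [g x * a]mulrC.
Qed.

Lemma has_deriv_comp f g (x a b : R) : has_deriv g (f x) b ->
  has_deriv f x a -> has_deriv (fun t => g (f t)) x (b * a).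
Proof.
move=> h1 h2; have h := is_derive1_comp h1 h2.
by apply: is_derive_eq h _; rewrite /GRing.scale/=.
Qed.

Lemma has_deriv_sin f (x a : R) : has_deriv f x a ->
  has_deriv (fun t => sin (f t)) x (cos (f x) * a).
Proof. by move=> h; apply: has_deriv_comp h; exact: is_derive_sin. Qed.

Lemma has_deriv_cos f (x a : R) : has_deriv f x a ->
  has_deriv (fun t => cos (f t)) x (- sin (f x) * a).
Proof. by move=> h; apply: has_deriv_comp h; exact: is_derive_cos. Qed.

Lemma has_deriv_exp f (x a : R) : has_deriv f x a ->
  has_deriv (fun t => expR (f t)) x (expR (f x) * a).
Proof. by move=> h; apply: has_deriv_comp h; exact: is_derive_expR. Qed.

Lemma has_derivV f (x a : R) : f x != 0 -> has_deriv f x a ->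
  has_deriv (fun t => (f t)^-1) x (- (f x) ^- 2 * a).
Proof.
move=> f0 h; have h2 := is_deriveV f0 h.
by apply: is_derive_eq h2 _.
Qed.

Lemma has_deriv_eq f (x a b : R) : has_deriv f x a -> a = b ->
  has_deriv f x b.
Proof. by move=> h <-. Qed.

Lemma has_deriv_continuous f (x a : R) : has_deriv f x a ->
  {for x, continuous f}.
Proof.
by case=> h _; exact/differentiable_continuous/derivable1_diffP.
Qed.

Lemma mean_value f (f' : R -> R) : (forall x, has_deriv f x (f' x)) ->
  forall x y, exists2 c, `|c - x| <= `|y - x| & f y - f x = f' c * (y - x).
Proof.
move=> df x y.
have cf (a b : R) : {within `[a, b], continuous f}.
  by apply: continuous_subspaceT => z; exact: has_deriv_continuous (df z).
have [xy|/ltW yx] := leP x y.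
- have [c] := MVT_segment xy (fun z _ => df z) (cf _ _).
  rewrite in_itv/= => /andP[xc cy] ->; exists c => //.
  by rewrite !ger0_norm ?subr_ge0// lerD2r.
- have [c] := MVT_segment yx (fun z _ => df z) (cf _ _).
  rewrite in_itv/= => /andP[yc cx] E; exists c.
    by rewrite !ler0_norm ?subr_le0// lerN2 lerD2r.
  by rewrite -opprB E -mulrN opprB.
Qed.

Lemma lipschitz_derive f (f' : R -> R) (C : R) :
  (forall x, has_deriv f x (f' x)) -> (forall x, `|f' x| <= C) ->
  forall x y, `|f y - f x| <= C * `|y - x|.
Proof.
move=> df bf x y; have [c _ ->] := mean_value df x y.
by rewrite normrM ler_wpM2r.
Qed.

End derivatives.

Ltac deriv := repeat first
  [ exact: has_deriv_cst | exact: has_deriv_id | apply: has_deriv_sin | apply: has_deriv_cos | apply: has_deriv_exp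
  | apply: has_derivN | apply: has_derivM | apply: has_derivD ].

Section trigonometric_bounds.
Context {R : realType}.

Lemma cos_lipschitz (x y : R) : `|cos y - cos x| <= `|y - x|.
Proof.
rewrite -[leRHS]mul1r; apply: (lipschitz_derive (fun=> is_derive_cos _)).
by move=> z; rewrite normrN sin_max.
Qed.

Lemma sin_lipschitz (x y : R) : `|sin y - sin x| <= `|y - x|.
Proof.
rewrite -[leRHS]mul1r; apply: (lipschitz_derive (fun=> is_derive_sin _)).
by move=> z; rewrite cos_max.
Qed.

(** Mean value theorem for the remainder, then the Lipschitz bound on [cos]. *)
Lemma sin_taylor1 (A t : R) : `|sin (A + t) - sin A - t * cos A| <= t ^+ 2.
Proof.
pose f s := sin (A + s) - s * cos A.
have df s : has_deriv f s (cos (A + s) - cos A).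
  by apply: has_deriv_eq; [rewrite /f; deriv|rewrite /=; ring].
have [c] := mean_value df 0 t; rewrite !subr0 => ct.
rewrite /f mul0r subr0 addr0 addrAC => ->.
rewrite normrM -(real_normK (num_real t)) expr2 ler_wpM2r//.
rewrite (le_trans (cos_lipschitz _ _))//.
by rewrite addrC addKr.
Qed.

End trigonometric_bounds.

(** * Measurability rules *)

Section measurability.
Context d (T : measurableType d) (R : realType).
Implicit Types f g : T -> R.

Lemma measfunD f g : measurable_fun [set: T] f -> measurable_fun [set: T] g ->
  measurable_fun [set: T] (fun x => f x + g x).
Proof. exact: measurable_funD. Qed.

Lemma measfunM f g : measurable_fun [set: T] f -> measurable_fun [set: T] g ->
  measurable_fun [set: T] (fun x => f x * g x).
Proof. exact: measurable_funM. Qed.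

Lemma measfunN f : measurable_fun [set: T] f -> measurable_fun [set: T] (fun x => - f x).
Proof. by move=> mf; exact: measurableT_comp. Qed.

Lemma measfunX f n : measurable_fun [set: T] f -> measurable_fun [set: T] (fun x => f x ^+ n).
Proof. by move=> mf; exact: measurable_funX. Qed.

Lemma measfun_continuous (h : R -> R) f : continuous h -> measurable_fun [set: T] f ->
  measurable_fun [set: T] (fun x => h (f x)).
Proof. by move=> ch mf; apply: measurableT_comp => //; exact: continuous_measurable_fun. Qed.

Lemma measfun_comp d' (T' : measurableType d') (h : T' -> R) (f : T -> T') :
  measurable_fun [set: T'] h -> measurable_fun [set: T] f ->
  measurable_fun [set: T] (fun x => h (f x)).
Proof. by move=> mh mf; apply: measurableT_comp. Qed.

Lemma measfun_sin f : measurable_fun [set: T] f -> measurable_fun [set: T] (fun x => sin (f x)).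
Proof. by apply: measfun_continuous => x; exact: continuous_sin. Qed.

Lemma measfun_cos f : measurable_fun [set: T] f -> measurable_fun [set: T] (fun x => cos (f x)).
Proof. by apply: measfun_continuous => x; exact: continuous_cos. Qed.

Lemma measfun_exp f : measurable_fun [set: T] f -> measurable_fun [set: T] (fun x => expR (f x)).
Proof. by apply: measfun_continuous => x; exact: continuous_expR. Qed.

Lemma measfun_norm f : measurable_fun [set: T] f -> measurable_fun [set: T] (fun x => `|f x|).
Proof. by move=> mf; exact: measurableT_comp. Qed.

Lemma measfun_powR f (e : R) : measurable_fun [set: T] f -> measurable_fun [set: T] (fun x => f x `^ e).
Proof. by move=> mf; apply: (measurableT_comp (measurable_powR e)). Qed.

Lemma measfun_indic (S : set R) f : measurable S -> measurable_fun [set: T] f ->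
  measurable_fun [set: T] (fun x => \1_S (f x) : R).
Proof. by move=> mS mf; apply: (measurableT_comp (measurable_indic mS)). Qed.

Lemma measfunV f : measurable_fun [set: T] f -> measurable_fun [set: T] (fun x => (f x)^-1).
Proof.
(* This expression of the inverse also gives [0] at [0]. *)
move=> mf; rewrite (_ : (fun _ => _) = fun x => f x * (f x ^+ 2) `^ (-1)).
  by apply: measfunM => //; apply: measfun_powR; exact: measfunX.
apply/funext => x; rewrite powR_inv1 ?sqr_ge0//.
have [->|x0] := eqVneq (f x) 0; first by rewrite invr0 mul0r.
by rewrite expr2 invfM mulrA divff// mul1r.
Qed.

Lemma measfun_max f g : measurable_fun [set: T] f -> measurable_fun [set: T] g ->
  measurable_fun [set: T] (fun x => Num.max (f x) (g x)).
Proof. exact: measurable_maxr. Qed.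

Lemma measfun_min f g : measurable_fun [set: T] f -> measurable_fun [set: T] g ->
  measurable_fun [set: T] (fun x => Num.min (f x) (g x)).
Proof. exact: measurable_minr. Qed.

End measurability.

Lemma measurable_set_gt (R : realType) (a : R) : measurable [set v : R | a < v].
Proof.
rewrite (_ : [set v : R | a < v] = `]a, +oo[%classic); first exact: measurable_itv.
by apply/seteqP; split => x /=; rewrite in_itv/= andbT.
Qed.

Lemma measurable_set_ball (R : realType) (a : R) : measurable [set v : R | `|v| <= a].
Proof.
rewrite (_ : [set v : R | `|v| <= a] = `[- a, a]%classic); first exact: measurable_itv.
by apply/seteqP; split => x /=; rewrite in_itv/= ler_norml.
Qed.

Lemma measurable_set_far (R : realType) (a : R) : measurable [set v : R | a < `|v|].
Proof.
rewrite (_ : [set v : R | a < `|v|] = ~` [set v : R | `|v| <= a]).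
  exact: measurableC (measurable_set_ball a).
by apply/seteqP; split => x /=; rewrite ltNge => /negP.
Qed.

Lemma measfun_levy_density (R : realType) d (T : measurableType d) (alpha : R) m1 m2 (f : T -> R) :
  measurable_fun [set: T] f ->
  measurable_fun [set: T] (fun x => levy_density alpha m1 m2 (f x)).
Proof. by apply: measurableT_comp; exact: measurable_levy_density. Qed.

Lemma measfun_unit_indic (R : realType) d (T : measurableType d) (f : T -> R) :
  measurable_fun [set: T] f ->
  measurable_fun [set: T] (fun x => unit_indic (f x)).
Proof. by apply: measfun_indic; exact: measurable_set_ball. Qed.

Ltac meas := repeat match goal with
  | h : measurable_fun _ ?f |- measurable_fun _ ?f => exact: h
  | |- measurable_fun _ (fun=> ?c) => exact: measurable_cst
  | |- measurable_fun _ (fun x => x) => exact: measurable_id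
  | |- measurable_fun _ (fun x => x.1) => exact: measurable_fst
  | |- measurable_fun _ (fun x => x.2) => exact: measurable_snd
  | |- measurable_fun _ (fun x => @?f x + @?g x) => apply: (@measfunD _ _ _ f g)
  | |- measurable_fun _ (fun x => - @?f x) => apply: (@measfunN _ _ _ f)
  | |- measurable_fun _ (fun x => @?f x * @?g x) => apply: (@measfunM _ _ _ f g)
  | |- measurable_fun _ (fun x => @?f x ^+ _) => apply: (@measfunX _ _ _ f)
  | |- measurable_fun _ (fun x => (@?f x)^-1) => apply: (@measfunV _ _ _ f)
  | |- measurable_fun _ (fun x => sin (@?f x)) => apply: (@measfun_sin _ _ _ f)
  | |- measurable_fun _ (fun x => cos (@?f x)) => apply: (@measfun_cos _ _ _ f)
  | |- measurable_fun _ (fun x => expR (@?f x)) => apply: (@measfun_exp _ _ _ f)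
  | |- measurable_fun _ (fun x => `|@?f x|) => apply: (@measfun_norm _ _ _ f)
  | |- measurable_fun _ (fun x => (@?f x) `^ _) => apply: (@measfun_powR _ _ _ f)
  | |- measurable_fun _ (fun x => Num.max (@?f x) (@?g x)) => apply: (@measfun_max _ _ _ f g)
  | |- measurable_fun _ (fun x => Num.min (@?f x) (@?g x)) => apply: (@measfun_min _ _ _ f g)
  | |- measurable_fun _ (levy_density _ _ _) => exact: measurable_levy_density
  | |- measurable_fun _ (fun x => levy_density _ _ _ (@?f x)) => apply: (@measfun_levy_density _ _ _ _ _ _ f)
  | |- measurable_fun _ (fun x => unit_indic (@?f x)) => apply: (@measfun_unit_indic _ _ _ f)
  | |- measurable_fun _ (fun x => \1_ ?S (@?f x)) => apply: (@measfun_indic _ _ _ S f);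
      [solve [exact: measurable_set_gt | exact: measurable_set_ball | exact: measurable_set_far | assumption]|]
  | h : measurable_fun [set: _] ?p |- measurable_fun _ (fun x => ?p (@?f x)) => apply: (@measfun_comp _ _ _ _ _ p f h)
  end.


(** * The exponent of the stable law *)

Section characteristic_exponent.
Context {R : realType}.
Local Notation leb := (@lebesgue_measure R).
Variables (alpha : R) (m1 m2 : {nonneg R}).
Hypothesis alpha_gt0 : 0 < alpha.
Hypothesis alpha_lt2 : alpha < 2.

Local Notation rho := (levy_density alpha m1 m2).
Local Notation delta := (alpha / 2).

Let rho_ge0 v : 0 <= rho v. Proof. exact: levy_density_ge0. Qed.

(** The primitive of the indicator of [[-1, 1]] that vanishes at [0]; it replaces
the truncation [v 1_{|v| <= 1}] after one integration in the jump size. *)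
Definition clamp (v : R) : R := Num.max (-1) (Num.min v 1).

Lemma clamp_near v : `|v| <= 1 -> clamp v = v.
Proof. by rewrite ler_norml => /andP[h1 h2]; rewrite /clamp min_l// max_r. Qed.

Lemma norm_clamp v : `|clamp v| <= 1.
Proof.
rewrite ler_norml /clamp le_max lexx/= ge_max ge_min lexx orbT andbT.
by rewrite (@le_trans _ _ 0)// oppr_le0.
Qed.

(** [z] times the integral over [[0, v]] of [u |-> cos (A + z u) - 1_{|u| <= 1} cos A]. *)
Definition wave (A z v : R) : R := sin (A + z * v) - sin A - z * clamp v * cos A.

Definition wave_bound (z : R) : R := z + 1 + 2 * z `^ (delta - 1).

(** Near [0] the second-order Taylor bound; far from [0] the bound
[min t 2 <= 2 t^(alpha / 2)] on increments of the sine, which keeps an integrable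
power of [z] at [0] and an integrable power of [v] at infinity. *)
Lemma wave_le (A z v : R) : 0 < z ->
  `|wave A z v| <= z * wave_bound z * levy_weight delta v.
Proof.
move=> z0; have ha := alpha_gt0; have hb := alpha_lt2.
have zp := powR_ge0 z (delta - 1).
have [v1|v1] := leP `|v| 1.
  rewrite levy_weight_near// /wave clamp_near//.
  rewrite (le_trans (sin_taylor1 _ _))// exprMn ler_wpM2r ?sqr_ge0//.
  rewrite expr2 (ler_wpM2l (ltW z0))// /wave_bound; lra.
rewrite levy_weight_far//.
have vd : 1 <= `|v| `^ delta.
  by rewrite -[leLHS](powRr0 `|v|) ler_powR// ?ltW//; lra.
have h1 : `|z * clamp v * cos A| <= z * `|v| `^ delta.
  rewrite !normrM (gtr0_norm z0) -mulrA (ler_wpM2l (ltW z0))//.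
  rewrite (le_trans _ vd)// -[leRHS]mulr1 ler_pM// ?norm_clamp//.
  by rewrite cos_max.
have h2 : `|sin (A + z * v) - sin A| <= 2 * (z * z `^ (delta - 1)) * `|v| `^ delta.
  rewrite (mulr_powRB1 (ltW z0)); last lra.
  rewrite -mulrA -(powRM _ (ltW z0))//.
  set t := z * `|v|.
  have t0 : 0 < t by rewrite mulr_gt0// (lt_trans _ v1).
  have [t1|t1] := leP t 1.
    have : t <= t `^ delta by rewrite ger1_powR ?t0//; lra.
    have : `|sin (A + z * v) - sin A| <= t.
      by rewrite (le_trans (sin_lipschitz _ _))// addrC addKr normrM (gtr0_norm z0).
    lra.
  have t2 : 1 <= t `^ delta.
    by rewrite -[leLHS](powRr0 t) ler_powR// ?ltW//; lra.
  rewrite (le_trans (ler_normB _ _))//.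
  have := sin_max (A + z * v); have := sin_max A; lra.
rewrite /wave (le_trans (ler_normB _ _))// (le_trans (lerD h2 h1))//.
rewrite /wave_bound; set p := _ `^ (_ - 1); set q := _ `^ delta.
have q0 : 0 <= q := powR_ge0 _ _.
rewrite -subr_ge0 [X in 0 <= X](_ : _ = z ^+ 2 * q); last by ring.
by rewrite mulr_ge0// sqr_ge0.
Qed.

Lemma measurable_clamp d (T : measurableType d) (f : T -> R) : measurable_fun [set: T] f ->
  measurable_fun [set: T] (fun x => clamp (f x)).
Proof. by move=> mf; rewrite /clamp; meas. Qed.

Lemma levy_weight_half_L1 : L1 leb (fun v => levy_weight delta v * rho v).
Proof. by apply: levy_weight_L1 => //; have h := alpha_gt0; lra. Qed.

Lemma measurable_wave d (T : measurableType d) (f g h : T -> R) :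
  measurable_fun [set: T] f -> measurable_fun [set: T] g -> measurable_fun [set: T] h ->
  measurable_fun [set: T] (fun x => wave (f x) (g x) (h x)).
Proof.
move=> mf mg mh; have mc := measurable_clamp mh; rewrite /wave.
apply: measfunD; first by meas.
by apply: measfunN; apply: measfunM; [apply: measfunM|meas].
Qed.

Lemma wave_L1 A z : 0 < z -> L1 leb (fun v => wave A z v * rho v).
Proof.
move=> z0; apply: (L1_le _ (L1Zl (z * wave_bound z) levy_weight_half_L1)).
  by apply: measfunM; [apply: measurable_wave|]; meas.
move=> v; rewrite normrM (ger0_norm (rho_ge0 v)) mulrA ler_wpM2r//.
exact: wave_le.
Qed.

Definition re_exponent (z : R) : R := Rintegral leb setT (fun v => (cos (z * v) - 1) * rho v).
Definition im_exponent_clamp (z : R) : R :=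
  Rintegral leb setT (fun v => (sin (z * v) - z * clamp v) * rho v).
Definition im_exponent (z : R) : R :=
  Rintegral leb setT (fun v => (sin (z * v) - z * v * unit_indic v) * rho v).

(** The phases [pi / 2] and [0] recover the integrands of the real part and of the
imaginary part with continuous compensator. *)
Lemma wave_pihalf z v : wave (pi / 2) z v = cos (z * v) - 1.
Proof. by rewrite /wave sin_pihalf cos_pihalf mulr0 subr0 [pi / 2 + _]addrC sinDpihalf. Qed.

Lemma wave0 z v : wave 0 z v = sin (z * v) - z * clamp v.
Proof. by rewrite /wave sin0 cos0 mulr1 subr0 add0r. Qed.

Lemma re_exponent_L1 z : 0 < z -> L1 leb (fun v => (cos (z * v) - 1) * rho v).
Proof.
move=> z0; have := wave_L1 (pi / 2) z0.
by under eq_fun do rewrite wave_pihalf.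
Qed.

Lemma im_exponent_clamp_L1 z : 0 < z ->
  L1 leb (fun v => (sin (z * v) - z * clamp v) * rho v).
Proof.
by move=> z0; have := wave_L1 0 z0; under eq_fun do rewrite wave0.
Qed.

Lemma wave_integral A z : 0 < z ->
  Rintegral leb setT (fun v => wave A z v * rho v) =
  sin A * re_exponent z + cos A * im_exponent_clamp z.
Proof.
move=> z0.
rewrite (_ : (fun _ => _) = fun v => sin A * ((cos (z * v) - 1) * rho v) +
    cos A * ((sin (z * v) - z * clamp v) * rho v)).
  rewrite RintegralD//; [|exact/L1Zl/re_exponent_L1|exact/L1Zl/im_exponent_clamp_L1].
  rewrite !RintegralZl//; [exact: im_exponent_clamp_L1|exact: re_exponent_L1].
by apply/funext => v; rewrite /wave sinD; ring.
Qed.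

(** Homogeneity of the Levy density under the substitution [v |-> z v]. *)
Lemma re_exponentE z : 0 < z -> re_exponent z = z `^ alpha * re_exponent 1.
Proof.
move=> z0; have [_] := Rint_scale z0 (re_exponent_L1 ltr01).
rewrite (_ : (fun _ => _) = (fun v => z `^ (- (1 + alpha)) * ((cos (z * v) - 1) * rho v))).
  rewrite RintegralZl//; last exact: re_exponent_L1.
  rewrite -/(re_exponent z) -/(re_exponent 1) powRN => h.
  have zz : z `^ (1 + alpha) != 0 by rewrite gt_eqF// powR_gt0.
  move/(congr1 (fun x => z `^ (1 + alpha) * x)) : h; rewrite mulVKf// => ->.
  rewrite mulrA; congr (_ * _).
  by rewrite powRD ?(gt_eqF z0) ?implybT// powRr1 ?ltW// mulrAC divff ?mul1r// gt_eqF.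
by apply/funext => v; rewrite levy_densityZ// mul1r; ring.
Qed.

Definition pow_primitive (v : R) : R :=
  if alpha == 1 then ln v else v `^ (1 - alpha) / (1 - alpha).

Lemma has_deriv_pow_primitive (v : R) : 0 < v -> has_deriv pow_primitive v (v `^ (- alpha)).
Proof.
move=> v0; rewrite /pow_primitive; case: eqVneq => [->|a1].
  by rewrite powR_inv1 ?ltW//; exact: is_derive1_ln.
have a1' : 1 - alpha != 0 by rewrite subr_eq0 eq_sym.
apply: has_deriv_eq.
  apply: has_derivM; [exact: (is_derive1_powR (1 - alpha) v0)|exact: has_deriv_cst].
rewrite mulr0 addr0 mulrAC divff// mul1r; congr (_ `^ _); ring.
Qed.

Lemma pow_interval (a b : R) : 0 < a -> a < b ->
  L1 leb (fun v => v `^ (- alpha) * \1_[set w : R | a < w <= b] v) /\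
  Rintegral leb setT (fun v => v `^ (- alpha) * \1_[set w : R | a < w <= b] v) =
    pow_primitive b - pow_primitive a.
Proof.
move=> a0 ab.
pose a_ (n : nat) : R := a + (b - a) * n.+2%:R^-1.
have ba0 : 0 < b - a by rewrite subr_gt0.
have abn n : a_ n < b.
  by rewrite -ltrBrDl gtr_pMr// invf_lt1// ltr1n.
have a_dec m n : (m <= n)%N -> a_ n <= a_ m.
  by move=> mn; rewrite lerD2l (ler_wpM2l (ltW ba0))// lef_pV2 ?posrE// ler_nat !ltnS.
have abD (x : R) : [set w : R | a < w <= b] x <-> exists n, a_ n <= x <= b.
  split=> /=; last first.
    move=> [n /andP[+ ->]]; rewrite andbT; apply: lt_le_trans.
    by rewrite ltrDl mulr_gt0// invr_gt0.
  move=> /andP[ax xb]; have xa : 0 < x - a by rewrite subr_gt0.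
  exists (Num.bound ((b - a) / (x - a))); rewrite xb andbT /a_ -lerBrDl.
  rewrite ler_pdivrMr// mulrC -ler_pdivrMr//.
  rewrite (@le_trans _ _ (Num.bound ((b - a) / (x - a)))%:R)//.
    by rewrite ltW// archi_boundP// divr_ge0// ltW.
  by rewrite ler_nat; apply: leqW; exact: leqW.
have pos (x : R) : [set w : R | a < w <= b] x -> 0 < x.
  by move=> /= /andP[/(lt_trans a0)].
have Ff (x : R) : [set w : R | a < w <= b] x ->
    is_derive x (1 : R) pow_primitive (x `^ (- alpha)).
  by move=> /pos; exact: has_deriv_pow_primitive.
have cf (x : R) : [set w : R | a < w <= b] x -> {for x, continuous (fun v => v `^ (- alpha))}.
  by move=> /pos x0; exact: continuous_powR.
have ca : a_ n @[n --> \oo] --> a + (b - a) * 0.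
  apply: cvgD; first exact: cvg_cst.
  by apply: cvgMr; rewrite (cvg_shiftS (@harmonic R)); exact: cvg_harmonic.
rewrite mulr0 addr0 in ca.
have Fa : pow_primitive (a_ n) @[n --> \oo] --> pow_primitive a.
  exact: (cvg_comp a_ pow_primitive ca (has_deriv_continuous (has_deriv_pow_primitive a0))).
have Fb : pow_primitive ((fun=> b) n) @[n --> \oo] --> pow_primitive b by apply: cvg_near_cst; apply: nearW.
have b_inc : forall m n, (m <= n)%N -> (fun=> b) m <= (fun=> b) n by [].
have iL := ge0_ftc_exhaust_L1 abn a_dec b_inc abD Ff cf Fa Fb (fun x _ => powR_ge0 _ _).
split => //; exact: (ftc_exhaust abn a_dec b_inc abD Ff cf Fa Fb iL).
Qed.

(** Truncation at a variable level, [unit_indic] being the level [1]. *)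
Definition cut (a v : R) : R := \1_[set w : R | `|w| <= a] v.

Lemma cut_in a v : `|v| <= a -> cut a v = 1.
Proof. by move=> h; rewrite /cut indicE mem_set. Qed.

Lemma cut_out a v : a < `|v| -> cut a v = 0.
Proof. by move=> h; rewrite /cut indicE memNset//=; apply/negP; rewrite -ltNge. Qed.

Let cut_moment_lt (a b : R) : 0 < a -> a < b ->
  L1 leb (fun v => v * (cut b v - cut a v) * rho v) /\
  Rintegral leb setT (fun v => v * (cut b v - cut a v) * rho v) =
    (m1%:num - m2%:num) * (pow_primitive b - pow_primitive a).
Proof.
move=> a0 ab; have [i1 e1] := pow_interval a0 ab; have [i2 e2] := Rint_opp i1.
set q := fun v => _ in i1 e1; rewrite -/(q _) in i2 e2.
have qin v : a < v -> v <= b -> q v = v `^ (- alpha).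
  by move=> av vb; rewrite /q indicE mem_set/= ?mulr1// av.
have qout v : ~~ (a < v <= b) -> q v = 0.
  by move=> av; rewrite /q indicE memNset/= ?mulr0//; exact/negP.
rewrite (_ : (fun _ => _) = fun v => m1%:num * q v - m2%:num * q (- v)).
  split; first by apply: L1B; exact: L1Zl.
  rewrite RintegralB//; [|exact: L1Zl|exact: L1Zl].
  rewrite !RintegralZl// e2 e1; ring.
have main v : 0 < v -> v * (cut b v - cut a v) * v `^ (- (1 + alpha)) = q v.
  move=> v0; have [va|av] := leP v a.
    rewrite !cut_in ?gtr0_norm// ?(le_trans va) ?ltW// subrr mulr0 mul0r qout//.
    by rewrite negb_and -leNgt va.
  rewrite (cut_out (a := a)) ?gtr0_norm//; have [vb|bv] := leP v b.
    rewrite cut_in ?gtr0_norm// qin// subr0 mulr1.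
    rewrite -{1}[v]powRr1 ?ltW// -powRD ?(gt_eqF v0) ?implybT//.
    by congr (_ `^ _); ring.
  rewrite cut_out ?gtr0_norm// subrr mulr0 mul0r qout//.
  by rewrite negb_and -!ltNge bv orbT.
have cutN c v : cut c (- v) = cut c v.
  have [h|h] := leP `|v| c; first by rewrite !cut_in ?normrN.
  by rewrite !cut_out ?normrN.
have qneg v : v <= 0 -> q v = 0.
  by move=> v0; rewrite qout// negb_and -leNgt (le_trans v0)// ltW.
apply/funext => v; have [v0|v0|->] := ltgtP v 0.
- rewrite (qneg v) ?ltW// levy_density_lt0// -main ?oppr_gt0// !cutN; ring.
- rewrite (qneg (- v)) ?oppr_le0 ?ltW// levy_density_gt0// -main//; ring.
- by rewrite oppr0 qneg// !mul0r !mulr0 subrr.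
Qed.

Lemma cut_moment (a b : R) : 0 < a -> 0 < b ->
  L1 leb (fun v => v * (cut b v - cut a v) * rho v) /\
  Rintegral leb setT (fun v => v * (cut b v - cut a v) * rho v) =
    (m1%:num - m2%:num) * (pow_primitive b - pow_primitive a).
Proof.
move=> a0 b0; have [ab|ba|->] := ltgtP a b; first exact: cut_moment_lt.
  have [i e] := cut_moment_lt b0 ba.
  rewrite (_ : (fun _ => _) = fun v => -1 * (v * (cut a v - cut b v) * rho v)).
    split; first exact: L1Zl.
    by rewrite RintegralZl// e; ring.
  by apply/funext => v; ring.
rewrite (_ : (fun _ => _) = cst 0).
  by split; [exact: integrable0|rewrite Rintegral_cst// mul0r subrr mulr0].
by apply/funext => v; rewrite subrr mulr0 mul0r.
Qed.

(** The two compensators differ by [sgn v] outside the unit ball, whose Levy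
integral is a difference of tails. *)
Lemma clamp_moment :
  L1 leb (fun v => (clamp v - v * unit_indic v) * rho v) /\
  Rintegral leb setT (fun v => (clamp v - v * unit_indic v) * rho v) =
    (m1%:num - m2%:num) / alpha.
Proof.
have [i1 e1] := levy_tail alpha_gt0 m1 m2 (@ltr01 R).
have [i2' e2'] := levy_tail alpha_gt0 m2 m1 (@ltr01 R).
have [i2 e2] := Rint_opp i2'; rewrite e2' in e2.
rewrite powR1 in e1 e2.
rewrite (_ : (fun _ => _) = fun v => \1_[set w : R | 1 < w] v * rho v -
    \1_[set w : R | 1 < w] (- v) * levy_density alpha m2 m1 (- v)).
  split; first exact: L1B.
  by rewrite RintegralB// e1 e2 -mulrBl div1r.
apply/funext => v; rewrite levy_densityN -mulrBl; congr (_ * _).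
have [v1|v1] := leP `|v| 1.
  rewrite clamp_near// /unit_indic !indicE mem_set// memNset/=; last first.
    by apply/negP; rewrite -leNgt (le_trans (ler_norm _)).
  rewrite memNset/=; last first.
    by apply/negP; rewrite -leNgt (le_trans (ler_norm _))// normrN.
  by rewrite mulr1 !subrr.
rewrite /unit_indic [\1_[set x : R | `|x| <= 1] v]indicE memNset/=; last first.
  by apply/negP; rewrite -ltNge.
rewrite mulr0 subr0 /clamp !indicE.
have [v0|v0] := leP 0 v.
  have v1' : 1 < v by rewrite -(ger0_norm v0).
  rewrite mem_set// memNset/=; last first.
    by apply/negP; rewrite -leNgt (le_trans _ ler01)// oppr_le0.
  by rewrite subr0 min_r ?ltW// max_r// (le_trans _ ler01)// oppr_le0 ler01.
have v1' : 1 < - v by rewrite -(ltr0_norm v0).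
rewrite memNset/=; last by apply/negP; rewrite -leNgt (le_trans (ltW v0)).
rewrite mem_set// sub0r min_l ?max_l//; first by rewrite lerNr ltW.
by rewrite (le_trans (ltW v0)).
Qed.

Lemma im_exponent_L1 z : 0 < z ->
  L1 leb (fun v => (sin (z * v) - z * v * unit_indic v) * rho v).
Proof.
move=> z0; have [i _] := clamp_moment.
have := L1D (im_exponent_clamp_L1 z0) (L1Zl z i); congr (L1 _ _).
by apply/funext => v; ring.
Qed.

Lemma im_exponent_clampE z : 0 < z ->
  im_exponent_clamp z = im_exponent z - z * ((m1%:num - m2%:num) / alpha).
Proof.
move=> z0; have [i e] := clamp_moment; rewrite -e -RintegralZl//.
rewrite -RintegralB//; [|exact: im_exponent_L1|exact: L1Zl].
by apply: eq_Rintegral => v _; ring.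
Qed.

(** Under the substitution [v |-> z v] the truncation level [1] becomes [z], and
the first moment of the shell between both levels is left over; for [alpha = 1]
this is the logarithmic term. *)
Lemma im_exponentE z : 0 < z -> im_exponent z =
  z `^ alpha * (im_exponent 1 - (m1%:num - m2%:num) * (pow_primitive z - pow_primitive 1)).
Proof.
move=> z0; have [i e] := cut_moment ltr01 z0; rewrite -e.
rewrite -RintegralB//; last exact: im_exponent_L1.
set H := fun v => _; have iH : L1 leb H by apply: L1B => //; exact: im_exponent_L1.
have [_] := Rint_scale z0 iH.
rewrite (_ : (fun _ => _) = (fun v => z `^ (- (1 + alpha)) *
    ((sin (z * v) - z * v * unit_indic v) * rho v))).
  rewrite RintegralZl//; last exact: im_exponent_L1.
  rewrite -/(im_exponent z) powRN => h.
  have zz : z `^ (1 + alpha) != 0 by rewrite gt_eqF// powR_gt0.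
  move/(congr1 (fun x => z `^ (1 + alpha) * x)) : h; rewrite mulVKf// => ->.
  rewrite mulrA; congr (_ * _).
  by rewrite powRD ?(gt_eqF z0) ?implybT// powRr1 ?ltW// mulrAC divff ?mul1r// gt_eqF.
apply/funext => v; rewrite /H levy_densityZ// !mul1r.
have -> : cut z (z * v) = unit_indic v.
  rewrite /cut /unit_indic !indicE; congr (_%:R); congr nat_of_bool.
  have E : (z * `|v| <= z) = (`|v| <= 1) by rewrite -[leRHS]mulr1 ler_pM2l.
  by apply/idP/idP; rewrite !inE/= normrM gtr0_norm// E.
by rewrite -/(cut 1 _); ring.
Qed.

End characteristic_exponent.

(** * Exponentially weighted integrals on the half-line *)

Section half_line.
Context {R : realType}.
Local Notation leb := (@lebesgue_measure R).

Definition heaviside (x : R) : R := \1_[set w : R | 0 < w] x.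

Lemma heaviside_gt0 x : 0 < x -> heaviside x = 1.
Proof. by move=> x0; rewrite /heaviside indicE mem_set. Qed.

Lemma heaviside_le0 x : x <= 0 -> heaviside x = 0.
Proof. by move=> x0; rewrite /heaviside indicE memNset//=; apply/negP; rewrite -leNgt. Qed.

Let a_ (n : nat) : R := n.+2%:R^-1.
Let b_ (n : nat) : R := n.+1%:R.

Let ab n : a_ n < b_ n.
Proof. by rewrite (@lt_le_trans _ _ 1) ?ler1n// invf_lt1// ltr1n. Qed.

Let a_dec m n : (m <= n)%N -> a_ n <= a_ m.
Proof. by move=> mn; rewrite lef_pV2 ?posrE// ler_nat !ltnS. Qed.

Let b_inc m n : (m <= n)%N -> b_ m <= b_ n.
Proof. by move=> mn; rewrite ler_nat. Qed.

Let abD (x : R) : [set w : R | 0 < w] x <-> exists n, a_ n <= x <= b_ n.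
Proof.
split=> /=; last first.
  by move=> [n /andP[+ _]]; apply: lt_le_trans; rewrite invr_gt0.
move=> x0; exists (maxn (Num.bound x^-1) (Num.bound x)); apply/andP; split.
  rewrite /a_ -[leRHS]invrK lef_pV2 ?posrE ?invr_gt0//.
  rewrite (@le_trans _ _ (Num.bound x^-1)%:R)//.
    by rewrite ltW// archi_boundP// invr_ge0 ltW.
  by rewrite ler_nat; do 2 apply: leqW; exact: leq_maxl.
rewrite (@le_trans _ _ (Num.bound x)%:R)//.
  by rewrite ltW// archi_boundP// ltW.
by rewrite ler_nat; apply: leqW; exact: leq_maxr.
Qed.

Lemma cvg_inv_nat : (n.+2%:R^-1 : R) @[n --> \oo] --> 0.
Proof. by rewrite (cvg_shiftS (@harmonic R)); exact: cvg_harmonic. Qed.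

Lemma ftc_half (F f : R -> R) (la lb : R) :
  (forall z, 0 < z -> has_deriv F z (f z)) ->
  (forall z, 0 < z -> {for z, continuous f}) ->
  F (n.+2%:R^-1) @[n --> \oo] --> la -> F (n.+1%:R) @[n --> \oo] --> lb ->
  L1 leb (fun z => f z * heaviside z) ->
  Rintegral leb setT (fun z => f z * heaviside z) = lb - la.
Proof. by move=> Ff cf Fa Fb; exact: (ftc_exhaust ab a_dec b_inc abD Ff cf Fa Fb). Qed.

Lemma ge0_ftc_half (F f : R -> R) (la lb : R) :
  (forall z, 0 < z -> has_deriv F z (f z)) ->
  (forall z, 0 < z -> {for z, continuous f}) ->
  F (n.+2%:R^-1) @[n --> \oo] --> la -> F (n.+1%:R) @[n --> \oo] --> lb ->
  (forall z, 0 < z -> 0 <= f z) -> L1 leb (fun z => f z * heaviside z).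
Proof. by move=> Ff cf Fa Fb; exact: (ge0_ftc_exhaust_L1 ab a_dec b_inc abD Ff cf Fa Fb). Qed.

Lemma cvg_exp_nat (c : R) : 0 < c -> expR (- (c * n.+1%:R)) @[n --> \oo] --> 0.
Proof.
move=> c0; apply: (@squeeze_cvgr _ _ _ _ (fun=> 0) (fun n => c^-1 * @harmonic R n)).
- apply: nearW => n; rewrite expR_ge0/= expRN -invfM lef_pV2 ?posrE ?expR_gt0//.
    by rewrite (le_trans _ (expR_ge1Dx _))// lerDr.
  by rewrite mulr_gt0.
- exact: cvg_cst.
- rewrite -(mulr0 c^-1); apply: cvgMr; exact: cvg_harmonic.
Qed.

Lemma exp_L1 (c : R) : 0 < c -> L1 leb (fun z => expR (- (c * z)) * heaviside z).
Proof.
move=> c0; pose F z := - c^-1 * expR (- (c * z)).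
have dF z : has_deriv F z (expR (- (c * z))).
  apply: has_deriv_eq; first by rewrite /F; deriv.
  by rewrite /=; field; rewrite gt_eqF.
have dE z : has_deriv (fun z => expR (- (c * z))) z (- c * expR (- (c * z))).
  apply: has_deriv_eq; first by deriv.
  by rewrite /=; ring.
apply: (@ge0_ftc_half F _ (F 0) 0).
- by move=> z _.
- by move=> z _; exact: has_deriv_continuous (dE z).
- by apply: (cvg_comp _ F cvg_inv_nat); exact: has_deriv_continuous (dF 0).
- by rewrite /F -(mulr0 (- c^-1)); apply: cvgMr; exact: cvg_exp_nat.
- by move=> z _; exact: expR_ge0.
Qed.

Lemma cvg_bounded0 (u_ v_ : nat -> R) (C : R) : u_ n @[n --> \oo] --> 0 ->
  (forall n, `|v_ n| <= C) -> u_ n * v_ n @[n --> \oo] --> 0.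
Proof.
move=> cu bv; apply/norm_cvg0P.
apply: (@squeeze_cvgr _ _ _ _ (fun=> 0) (fun n => `|u_ n| * C)).
- by apply: nearW => n; rewrite normr_ge0/= normrM ler_wpM2l.
- exact: cvg_cst.
- rewrite -(mul0r C); apply: cvgMl; exact/norm_cvg0P.
Qed.

(** The frequency weight of the mollifying kernel. Unlike [exp (- e z)], whose
cosine transform is the Cauchy kernel, its derivative vanishes at [0], and so its
cosine transform has a first moment. *)
Definition fweight (e z : R) : R := (1 + e * z) * expR (- (e * z)).

Lemma has_deriv_fweight e z : has_deriv (fweight e) z (- (e ^+ 2 * z * expR (- (e * z)))).
Proof.
apply: has_deriv_eq; first by rewrite /fweight; deriv.
by rewrite /=; ring.
Qed.

Lemma fweight_ge0 e z : 0 < e -> 0 < z -> 0 <= fweight e z.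
Proof. by move=> e0 z0; rewrite mulr_ge0 ?expR_ge0// addr_ge0// mulr_ge0// ltW. Qed.

Lemma linear_le_exp (t : R) : 0 <= t -> 1 + t <= 2 * expR (t / 2).
Proof. by move=> t0; have := expR_ge1Dx (t / 2); lra. Qed.

Lemma fweight_le e z : 0 < e -> 0 < z -> fweight e z <= 2 * expR (- (e / 2 * z)).
Proof.
move=> e0 z0; rewrite /fweight.
have -> : expR (- (e / 2 * z)) = expR (e * z / 2) * expR (- (e * z)).
  by rewrite -expRD; congr expR; field.
rewrite mulrA ler_wpM2r ?expR_ge0// linear_le_exp// mulr_ge0// ltW//.
Qed.

Lemma cvg_fweight e : 0 < e -> fweight e n.+1%:R @[n --> \oo] --> 0.
Proof.
move=> e0.
apply: (@squeeze_cvgr _ _ _ _ (fun=> 0) (fun n => 2 * expR (- (e / 2 * n.+1%:R)))).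
- by apply: nearW => n; rewrite fweight_ge0// fweight_le.
- exact: cvg_cst.
- rewrite -(mulr0 2); apply: cvgMr; apply: cvg_exp_nat; exact: divr_gt0.
Qed.

(** The factor is the growth in [z] of [wave_bound]: affine at infinity, a power
above [-1] at [0]. *)
Lemma fweight_growth_L1 e (s : R) : 0 < e -> -1 < s -> s < 0 ->
  L1 leb (fun z => (z + 1 + 2 * z `^ s) * fweight e z * heaviside z).
Proof.
move=> e0 s1 s0; pose c := e / 4.
have c0 : 0 < c by rewrite divr_gt0.
(* The constants absorb [z exp (- c z) <= 1 / c] for [c = e / 4]. *)
pose g z := (8 / e + 12) * (expR (- (c * z)) * heaviside z) +
   8 * (z `^ s * \1_[set w : R | 0 < w <= 1] z).
have ig : L1 leb g by apply: L1D; apply: L1Zl; [exact: exp_L1|exact: pow_head].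
apply: (L1_le _ ig).
  by rewrite /heaviside /fweight; meas.
move=> z; have [z0|z0] := ltP 0 z; last first.
  rewrite heaviside_le0// mulr0 normr0 /g heaviside_le0// !mulr0 add0r mulr_ge0// mulr_ge0 ?powR_ge0//.
have zs := powR_ge0 z s.
rewrite /g heaviside_gt0// !mulr1 normrM !ger0_norm ?fweight_ge0//; last first.
  by rewrite addr_ge0// ?addr_ge0// ?mulr_ge0// ltW.
rewrite (le_trans (ler_wpM2l _ (fweight_le e0 z0)))//.
  by rewrite addr_ge0// ?addr_ge0// ?mulr_ge0// ltW.
have E1 : expR (- (e / 2 * z)) = expR (- (c * z)) * expR (- (c * z)).
  by rewrite -expRD; congr expR; rewrite /c; field.
set E := expR (- (c * z)) in E1 *; rewrite E1.
have E0 : 0 < E := expR_gt0 _.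
have E_1 : E <= 1 by rewrite -expR0 ler_expR oppr_le0 mulr_ge0// ltW.
have zE : z * E <= 4 / e.
  rewrite /E expRN ler_pdivrMr ?expR_gt0//.
  have -> : 4 / e = c^-1 by rewrite /c invf_div.
  rewrite -ler_pdivrMl ?invr_gt0// invrK (le_trans _ (expR_ge1Dx _))//.
  by rewrite lerDr.
have EE : E * E <= E by rewrite ler_piMr// ltW.
have h1 : (z + 1) * (2 * (E * E)) <= (8 / e + 2) * E.
  have : (z * E) * E <= 4 / e * E by rewrite ler_wpM2r// ltW.
  have -> : 8 / e = 2 * (4 / e) by field; rewrite gt_eqF.
  lra.
have ind0 : 0 <= \1_[set w : R | 0 < w <= 1] z :> R by rewrite indicE.
have h2 : 2 * z `^ s * (2 * (E * E)) <= 10 * E + 8 * (z `^ s * \1_[set w : R | 0 < w <= 1] z).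
  have [z1|z1] := leP z 1.
    rewrite indicE mem_set/= ?z0//; have : z `^ s * (E * E) <= z `^ s.
      by rewrite ler_piMr// (le_trans EE).
    lra.
  have zs1 : z `^ s <= 1.
    by rewrite -[leRHS](powRr0 z) ler_powR ?ltW.
  have : z `^ s * (E * E) <= E * E by rewrite ler_piMl// mulr_ge0 ?ltW.
  have : 0 <= z `^ s * \1_[set w : R | 0 < w <= 1] z by rewrite mulr_ge0.
  lra.
lra.
Qed.

End half_line.

(** * The mollifying kernel and its cosine transform *)

Section kernel.
Context {R : realType}.
Local Notation leb := (@lebesgue_measure R).

(** The closed form of the cosine transform of [fweight e], see [kernel_fourier]. *)
Definition kernel (e x : R) : R := 2 * e ^+ 3 / (e ^+ 2 + x ^+ 2) ^+ 2.

Lemma fweight_L1 (e : R) : 0 < e -> L1 leb (fun z => fweight e z * heaviside z).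
Proof.
move=> e0.
have h : (-1 : R) < - 2^-1 by lra.
have h' : - 2^-1 < (0 : R) by lra.
apply: (L1_le _ (fweight_growth_L1 e0 h h')).
  by rewrite /heaviside /fweight; meas.
move=> z; have [z0|z0] := ltP 0 z; last by rewrite heaviside_le0// !mulr0 normr0.
rewrite heaviside_gt0// !mulr1 ger0_norm ?fweight_ge0// ler_peMl ?fweight_ge0//.
have := powR_ge0 z (- 2^-1); lra.
Qed.

Lemma zfweight_L1 (e : R) : 0 < e -> L1 leb (fun z => z * fweight e z * heaviside z).
Proof.
move=> e0.
have h : (-1 : R) < - 2^-1 by lra.
have h' : - 2^-1 < (0 : R) by lra.
apply: (L1_le _ (fweight_growth_L1 e0 h h')).
  by rewrite /heaviside /fweight; meas.
move=> z; have [z0|z0] := ltP 0 z; last by rewrite heaviside_le0// !mulr0 normr0.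
rewrite heaviside_gt0// !mulr1 ger0_norm; last by rewrite mulr_ge0 ?fweight_ge0// ltW.
rewrite ler_wpM2r ?fweight_ge0//.
have := powR_ge0 z (- 2^-1); lra.
Qed.

Lemma fweight_bounded_L1 (e : R) (f : R -> R) : 0 < e ->
  measurable_fun [set: R] f -> (forall z, `|f z| <= 1) ->
  L1 leb (fun z => f z * (fweight e z * heaviside z)).
Proof. by move=> e0 mf bf; exact: (@L1_mul_bounded _ _ R leb f (fun z => fweight e z * heaviside z) 1 mf (fweight_L1 e0) bf). Qed.

Lemma zexp_L1 (e : R) : 0 < e -> L1 leb (fun z => e ^+ 2 * z * expR (- (e * z)) * heaviside z).
Proof.
move=> e0.
apply: (L1_le _ (L1Zl (e ^+ 2) (zfweight_L1 e0))).
  by rewrite /heaviside; meas.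
move=> z; have [z0|z0] := ltP 0 z; last by rewrite heaviside_le0// !mulr0 normr0.
rewrite heaviside_gt0// !mulr1 ger0_norm; last first.
  by rewrite !mulr_ge0 ?expR_ge0 ?sqr_ge0// ltW.
have ez : 0 <= e ^+ 2 * z by rewrite mulr_ge0 ?sqr_ge0// ltW.
rewrite mulrA; apply: (ler_wpM2l ez); rewrite /fweight mulrDl mul1r lerDl.
by rewrite !mulr_ge0 ?expR_ge0// ltW.
Qed.

Lemma kernel_den (e x : R) : 0 < e -> e ^+ 2 + x ^+ 2 != 0.
Proof. by move=> e0; rewrite gt_eqF// ltr_wpDr ?sqr_ge0// exprn_gt0. Qed.

Lemma kernel_fourier (e x : R) : 0 < e ->
  Rintegral leb setT (fun z => cos (z * x) * (fweight e z * heaviside z)) = kernel e x.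
Proof.
move=> e0; have D0 := kernel_den x e0.
set D := e ^+ 2 + x ^+ 2 in D0.
(* [F] below is the real part of the primitive
   [- ((1 + e z) / l + e / l ^ 2) exp (- l z)] with [l = e - i x]. *)
pose a z := x / D * sin (z * x) - e / D * cos (z * x).
pose b z := 2 * e ^+ 2 * x / D ^+ 2 * sin (z * x) -
   e * (e ^+ 2 - x ^+ 2) / D ^+ 2 * cos (z * x).
pose F z := fweight e z * a z + expR (- (e * z)) * b z.
have dF z : has_deriv F z (cos (z * x) * fweight e z).
  apply: has_deriv_eq; first by rewrite /F /a /b /fweight; deriv.
  by rewrite /= /fweight /D; field.
have dw z : has_deriv (fun z => cos (z * x) * fweight e z) z
   (- sin (z * x) * x * fweight e z + cos (z * x) * (- (e ^+ 2 * z * expR (- (e * z))))).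
  apply: has_deriv_eq; first by rewrite /fweight; deriv.
  by rewrite /= /fweight; ring.
have bounded (p q : R) n : `|p * sin (n * x) - q * cos (n * x)| <= `|p| + `|q|.
  rewrite (le_trans (ler_normB _ _))// lerD// normrM ler_piMr ?sin_max ?cos_max//.
have iL : L1 leb (fun z => cos (z * x) * fweight e z * heaviside z).
  under eq_fun do rewrite -mulrA.
  by apply: fweight_bounded_L1 => //; [meas|move=> z; exact: cos_max].
transitivity (0 - F 0).
  rewrite -(@ftc_half _ F (fun z => cos (z * x) * fweight e z) (F 0) 0)//.
  - by apply: eq_Rintegral => z _; rewrite mulrA.
  - by move=> z _; exact: has_deriv_continuous (dw z).
  - by apply: (cvg_comp _ F cvg_inv_nat); exact: has_deriv_continuous (dF 0).
  - rewrite -[X in _ --> X]addr0; apply: cvgD.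
    + by apply: (cvg_bounded0 (cvg_fweight e0)) => n; exact: bounded.
    + by apply: (cvg_bounded0 (cvg_exp_nat e0)) => n; exact: bounded.
rewrite /F /a /b /fweight !mul0r mulr0 sin0 cos0 oppr0 expR0 /kernel -/D.
by rewrite /D; field.
Qed.

(** Integration by parts of [fweight e z * sin (z x)], which vanishes at both ends. *)
Lemma kernel_fourier_moment (e x : R) : 0 < e ->
  Rintegral leb setT (fun z => sin (z * x) * (e ^+ 2 * z * expR (- (e * z)) * heaviside z)) =
  x * kernel e x.
Proof.
move=> e0.
have i1 : L1 leb (fun z => sin (z * x) * (e ^+ 2 * z * expR (- (e * z)) * heaviside z)).
  apply: (@L1_mul_bounded _ _ _ _ _ _ 1); [by meas|exact: zexp_L1|by move=> z; exact: sin_max].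
have i2 : L1 leb (fun z => cos (z * x) * (fweight e z * heaviside z)).
  by apply: fweight_bounded_L1 => //; [meas|move=> z; exact: cos_max].
pose F z := fweight e z * sin (z * x).
pose f z := - (e ^+ 2 * z * expR (- (e * z))) * sin (z * x) + fweight e z * (cos (z * x) * x).
have dF z : has_deriv F z (f z).
  apply: has_deriv_eq; first by rewrite /F; apply: has_derivM; [exact: has_deriv_fweight|deriv].
  by rewrite /= /f; ring.
have cf z : {for z, continuous f}.
  have d : exists d, has_deriv f z d by eexists; rewrite /f /fweight; deriv.
  by case: d => d /has_deriv_continuous.
have iE : L1 leb (fun z => f z * heaviside z).
  have := L1D (L1Zl (-1) i1) (L1Zl x i2); congr (L1 _ _).
  by apply/funext => z; rewrite /f; ring.
have := @ftc_half _ F f 0 0 (fun z _ => dF z) (fun z _ => cf z) _ _ iE.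
rewrite subrr => h.
have : Rintegral leb setT (fun z => f z * heaviside z) =
   x * kernel e x - Rintegral leb setT (fun z => sin (z * x) * (e ^+ 2 * z * expR (- (e * z)) * heaviside z)).
  rewrite -kernel_fourier// -RintegralZl// -RintegralB//; last exact: L1Zl.
  by apply: eq_Rintegral => z _; rewrite /f; ring.
rewrite h; first by move=> /eqP; rewrite eq_sym subr_eq0 => /eqP.
- rewrite (_ : 0 = F 0); last by rewrite /F mul0r sin0 mulr0.
  by apply: (cvg_comp _ F cvg_inv_nat); exact: has_deriv_continuous (dF 0).
- by apply: (cvg_bounded0 (cvg_fweight e0)) => n; exact: sin_max.
Qed.

End kernel.

(** * The characteristic function on the positive half-line *)

Section characteristic_function.
Context {R : realType}.
Local Notation leb := (@lebesgue_measure R).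
Variables (alpha : R) (m1 m2 : {nonneg R}).
Hypothesis alpha_gt0 : 0 < alpha.
Hypothesis alpha_lt2 : alpha < 2.
Local Notation rho := (levy_density alpha m1 m2).
Local Notation dm := (m1%:num - m2%:num).
Local Notation kappa := (pow_primitive alpha).
Local Notation re_exp := (re_exponent alpha m1 m2).
Local Notation im_exp := (im_exponent alpha m1 m2).
Local Notation im_expc := (im_exponent_clamp alpha m1 m2).

Definition weight_mass : R := Rintegral leb setT (fun v => levy_weight (alpha / 2) v * rho v).

(** The linear combination is a Levy integral of [wave], bounded by [wave_le]. *)
Lemma exponent_le A z : 0 < z ->
  `|sin A * re_exp z + cos A * im_expc z| <= z * wave_bound alpha z * weight_mass.
Proof.
move=> z0; rewrite -wave_integral// -RintegralZl//; last exact: levy_weight_half_L1.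
apply: Rint_le_norm; [exact/L1Zl/levy_weight_half_L1|by apply: (@L1_meas _ _ _ leb); exact: wave_L1|].
move=> v; rewrite normrM (ger0_norm (levy_density_ge0 _ _ _ _)) mulrA ler_wpM2r ?levy_density_ge0//.
exact: wave_le.
Qed.

(** Explicit expressions of the exponent for [z > 0], used instead of the integrals
because their differentiability and measurability are visible. *)
Definition re_closed (z : R) : R := z `^ alpha * re_exp 1.
Definition im_closed (z : R) : R := z `^ alpha * (im_exp 1 - dm * (kappa z - kappa 1)).
Definition imc_closed (z : R) : R := im_closed z - z * (dm / alpha).

Lemma re_closedE z : 0 < z -> re_exp z = re_closed z.
Proof. exact: re_exponentE. Qed.

Lemma im_closedE z : 0 < z -> im_exp z = im_closed z.
Proof. exact: im_exponentE. Qed.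

Lemma imc_closedE z : 0 < z -> im_expc z = imc_closed z.
Proof. by move=> z0; rewrite im_exponent_clampE// im_closedE. Qed.

Lemma closed_le A z : 0 < z ->
  `|sin A * re_closed z + cos A * imc_closed z| <= z * wave_bound alpha z * weight_mass.
Proof. by move=> z0; rewrite -re_closedE// -imc_closedE// exponent_le. Qed.

Lemma measurable_pow_primitive : measurable_fun [set: R] kappa.
Proof.
rewrite /pow_primitive; case: eqVneq => _; first exact: measurable_ln.
by meas.
Qed.

Lemma measurable_re_closed : measurable_fun [set: R] re_closed.
Proof. by rewrite /re_closed; meas. Qed.

Lemma measurable_im_closed : measurable_fun [set: R] im_closed.
Proof. by have mk := measurable_pow_primitive; rewrite /im_closed; meas. Qed.

Lemma measurable_imc_closed : measurable_fun [set: R] imc_closed.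
Proof. by have mk := measurable_im_closed; rewrite /imc_closed; meas. Qed.

Lemma has_deriv_re_closed z : 0 < z -> has_deriv re_closed z (alpha * re_closed z / z).
Proof.
move=> z0; apply: has_deriv_eq.
  rewrite /re_closed; apply: has_derivM; [exact: (is_derive1_powR alpha z0)|exact: has_deriv_cst].
rewrite mulr0 addr0 /re_closed powRB ?(gt_eqF z0) ?implybT// powRr1 ?ltW//.
by rewrite !mulrA mulrAC.
Qed.

(** The derivative of the shell moment is [z^-alpha], and the term [m1 - m2] it
creates turns the truncated compensator into the continuous one. *)
Lemma has_deriv_im_closed z : 0 < z -> has_deriv im_closed z (alpha * imc_closed z / z).
Proof.
move=> z0; apply: has_deriv_eq.
  rewrite /im_closed; apply: has_derivM; first exact: (is_derive1_powR alpha z0).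
  apply: has_derivD; first exact: has_deriv_cst.
  apply: has_derivN; apply: has_derivM; first exact: has_deriv_cst.
  by apply: has_derivD; [exact: has_deriv_pow_primitive|exact: has_deriv_cst].
rewrite /= /imc_closed /im_closed powRB ?(gt_eqF z0) ?implybT// powRr1 ?ltW// powRN.
have za : z `^ alpha != 0 by rewrite gt_eqF// powR_gt0.
by field; rewrite (gt_eqF z0) (gt_eqF alpha_gt0) za.
Qed.

(** Real and imaginary parts of the characteristic function of a law with drift [b]. *)
Definition cf_re (b z : R) : R := expR (re_closed z) * cos (z * b + im_closed z).
Definition cf_im (b z : R) : R := expR (re_closed z) * sin (z * b + im_closed z).

Lemma has_deriv_cf_im b z : 0 < z -> has_deriv (cf_im b) z
  (alpha * (re_closed z * cf_im b z + imc_closed z * cf_re b z) / z + b * cf_re b z).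
Proof.
move=> z0; have dr := has_deriv_re_closed z0; have di := has_deriv_im_closed z0.
apply: has_deriv_eq.
  rewrite /cf_im; apply: has_derivM; first by apply: has_deriv_exp; exact: dr.
  apply: has_deriv_sin; apply: has_derivD; last exact: di.
  by apply: has_derivM; [exact: has_deriv_id|exact: has_deriv_cst].
by rewrite /= /cf_im /cf_re; ring.
Qed.

Lemma derivable_cf_re b z : 0 < z -> exists d, has_deriv (cf_re b) z d.
Proof.
move=> z0; have dr := has_deriv_re_closed z0; have di := has_deriv_im_closed z0.
eexists; rewrite /cf_re; apply: has_derivM; first by apply: has_deriv_exp; exact: dr.
apply: has_deriv_cos; apply: has_derivD; last exact: di.
by apply: has_derivM; [exact: has_deriv_id|exact: has_deriv_cst].
Qed.

Definition cf_im' b z := alpha * (re_closed z * cf_im b z + imc_closed z * cf_re b z) / z + b * cf_re b z.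

Lemma continuous_cf_im' b z : 0 < z -> {for z, continuous (cf_im' b)}.
Proof.
move=> z0; have dr := has_deriv_re_closed z0; have di := has_deriv_im_closed z0.
have [k dk] := derivable_cf_re b z0; have dj := has_deriv_cf_im b z0.
have d : exists d, has_deriv (cf_im' b) z d.
  eexists; rewrite /cf_im'; apply: has_derivD; last first.
    by apply: has_derivM; [exact: has_deriv_cst|exact: dk].
  apply: has_derivM; last by apply: has_derivV; [rewrite gt_eqF|exact: has_deriv_id].
  apply: has_derivM; first exact: has_deriv_cst.
  apply: has_derivD.
    by apply: has_derivM; [exact: dr|exact: dj].
  apply: has_derivM; last exact: dk.
  rewrite /imc_closed; apply: has_derivD; first exact: di.
  by apply: has_derivN; apply: has_derivM; [exact: has_deriv_id|exact: has_deriv_cst].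
by case: d => d /has_deriv_continuous.
Qed.

End characteristic_function.

(** * The Stein identity for the kernel, in the frequency domain *)

Section kernel_stein.
Context {R : realType}.
Local Notation leb := (@lebesgue_measure R).
Variables (alpha : R) (m1 m2 : {nonneg R}).
Hypothesis alpha_gt0 : 0 < alpha.
Hypothesis alpha_lt2 : alpha < 2.
Local Notation rho := (levy_density alpha m1 m2).
Local Notation rex := (re_closed alpha m1 m2).
Local Notation imx := (im_closed alpha m1 m2).
Local Notation imc := (imc_closed alpha m1 m2).
Local Notation cfr := (cf_re alpha m1 m2).
Local Notation cfi := (cf_im alpha m1 m2).

(** The jump operator applied to the kernel, up to the factor [alpha], in frequency
form. *)
Definition kernel_jump (e x : R) : R := Rintegral leb setT
  (fun z => (sin (z * x) * rex z + cos (z * x) * imc z) / z * (fweight e z * heaviside z)).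

Let growth (e z : R) := weight_mass alpha m1 m2 * (wave_bound alpha z * fweight e z * heaviside z).

Let growth_L1 e : 0 < e -> L1 leb (growth e).
Proof.
move=> e0; apply: L1Zl; apply: fweight_growth_L1 => //.
  by have h := alpha_gt0; lra.
by have h := alpha_lt2; lra.
Qed.

Let growth_le e A z : 0 < e ->
  `|(sin A * rex z + cos A * imc z) / z * (fweight e z * heaviside z)| <= growth e z.
Proof.
move=> e0; have [z0|z0] := ltP 0 z; last by rewrite /growth heaviside_le0// !mulr0 normr0.
rewrite /growth heaviside_gt0// !mulr1 normrM [X in _ * X]ger0_norm ?fweight_ge0//.
rewrite mulrA ler_wpM2r ?fweight_ge0//.
rewrite normrM [X in _ * X]gtr0_norm ?invr_gt0// ler_pdivrMr//.
have := closed_le m1 m2 alpha_gt0 alpha_lt2 A z0.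
by rewrite (_ : weight_mass _ _ _ * _ * _ = z * wave_bound alpha z * weight_mass alpha m1 m2)//; ring.
Qed.

Let mrex := measurable_re_closed alpha m1 m2.
Let mimc := measurable_imc_closed alpha m1 m2.

Variables (d : measure_display) (T : measurableType d) (P : probability T R).
Variables (Y : T -> R) (b : R).
Hypothesis mY : measurable_fun [set: T] Y.
Hypothesis Ycos : forall z, 0 < z -> Rintegral P setT (fun w => cos (z * Y w)) = cfr b z.
Hypothesis Ysin : forall z, 0 < z -> Rintegral P setT (fun w => sin (z * Y w)) = cfi b z.

Let one_L1 : L1 P (fun _ : T => 1 : R).
Proof. by apply: (@L1_bounded _ _ _ P _ 1) => // x; rewrite normr1. Qed.

Let swap (h : R -> R) (w : R -> R) : measurable_fun [set: R] h -> (forall x, `|h x| <= 1) ->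
  L1 leb w ->
  L1 leb (fun z => Rintegral P setT (fun s => h (z * Y s)) * w z) /\
  Rintegral P setT (fun s => Rintegral leb setT (fun z => h (z * Y s) * w z)) =
  Rintegral leb setT (fun z => Rintegral P setT (fun s => h (z * Y s)) * w z).
Proof.
move=> mh bh iw; have mw := L1_meas iw.
have [|s t|i1 i2 i3 i4 E] := @Rint_fubini_dominated _ _ T _ R P leb (fun s z => h (z * Y s) * w z)
  _ (fun _ => 1) (fun z => `|w z|) one_L1 (L1_norm iw).
- by meas.
- by rewrite mul1r normrM ler_piMl.
have E' : (fun z => Rintegral P setT (fun s => h (z * Y s) * w z)) =
    (fun z => Rintegral P setT (fun s => h (z * Y s)) * w z).
  apply/funext => z; rewrite RintegralZr//.
  apply: (@L1_bounded _ _ _ P _ 1) => // ; meas.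
by rewrite E' in i4 E.
Qed.

(** Fubini turns each expectation into a frequency integral of the characteristic
function, and the three integrals sum to that of the derivative of
[fweight e z * E sin (z Y)], which vanishes at [0] and at infinity. *)
Lemma kernel_stein e : 0 < e ->
  Rintegral P setT (fun s => Y s * kernel e (Y s)) =
  alpha * Rintegral P setT (fun s => kernel_jump e (Y s)) +
  b * Rintegral P setT (fun s => kernel e (Y s)).
Proof.
move=> e0.
have iW := fweight_L1 e0.
have iV : L1 leb (fun z => e ^+ 2 * z * expR (- (e * z)) * heaviside z) := zexp_L1 e0.
have [ik Ek] := swap (continuous_measurable_fun (@continuous_cos R)) (@cos_max R) iW.
have [im Em] := swap (continuous_measurable_fun (@continuous_sin R)) (@sin_max R) iV.
have [|s z|j1 j2 j3 j4 Ej] := @Rint_fubini_dominated _ _ T _ R P leb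
  (fun s z => (sin (z * Y s) * rex z + cos (z * Y s) * imc z) / z * (fweight e z * heaviside z))
  _ (fun _ => 1) (growth e) one_L1 (growth_L1 e0).
- have mr := mrex; have mi := mimc; rewrite /fweight /heaviside; meas.
- by rewrite mul1r; exact: growth_le.
have Ek1 : Rintegral P setT (fun s => kernel e (Y s)) =
    Rintegral leb setT (fun z => cfr b z * (fweight e z * heaviside z)).
  under eq_Rintegral do rewrite -kernel_fourier//.
  rewrite Ek; apply: eq_Rintegral => z _.
  by have [z0|z0] := ltP 0 z; [rewrite Ycos|rewrite heaviside_le0// !mulr0].
have Em1 : Rintegral P setT (fun s => Y s * kernel e (Y s)) =
    Rintegral leb setT (fun z => cfi b z * (e ^+ 2 * z * expR (- (e * z)) * heaviside z)).
  under eq_Rintegral do rewrite -kernel_fourier_moment//.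
  rewrite Em; apply: eq_Rintegral => z _.
  by have [z0|z0] := ltP 0 z; [rewrite Ysin|rewrite heaviside_le0// !mulr0].
pose J z := (cfi b z * rex z + cfr b z * imc z) / z * (fweight e z * heaviside z).
have EJ : (fun z => Rintegral P setT (fun s => (sin (z * Y s) * rex z + cos (z * Y s) * imc z) / z * (fweight e z * heaviside z))) = J.
  apply/funext => z; rewrite /J; have [z0|z0] := ltP 0 z; last first.
    rewrite heaviside_le0//; under eq_Rintegral do rewrite !mulr0.
    by rewrite Rintegral_cst// mul0r !mulr0.
  have is_ : L1 P (fun s => sin (z * Y s)).
    by apply: (@L1_bounded _ _ _ P _ 1); [meas|move=> x; exact: sin_max].
  have ic : L1 P (fun s => cos (z * Y s)).
    by apply: (@L1_bounded _ _ _ P _ 1); [meas|move=> x; exact: cos_max].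
  rewrite RintegralZr//; last exact/L1Zr/L1D/L1Zr/ic/L1Zr/is_.
  rewrite RintegralZr//; last exact/L1D/L1Zr/ic/L1Zr/is_.
  rewrite RintegralD//; [|exact/L1Zr|exact/L1Zr].
  by rewrite !RintegralZr// Ycos// Ysin.
rewrite EJ in j4 Ej.
have cE : (fun z => Rintegral P setT (fun s => cos (z * Y s)) * (fweight e z * heaviside z)) =
   (fun z => cfr b z * (fweight e z * heaviside z)).
  apply/funext => z; have [z0|z0] := ltP 0 z; [by rewrite Ycos|by rewrite heaviside_le0// !mulr0].
have sE : (fun z => Rintegral P setT (fun s => sin (z * Y s)) * (e ^+ 2 * z * expR (- (e * z)) * heaviside z)) =
   (fun z => cfi b z * (e ^+ 2 * z * expR (- (e * z)) * heaviside z)).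
  apply/funext => z; have [z0|z0] := ltP 0 z; [by rewrite Ysin|by rewrite heaviside_le0// !mulr0].
rewrite cE in ik; rewrite sE in im.
pose F z := fweight e z * cfi b z.
pose f z := - (e ^+ 2 * z * expR (- (e * z))) * cfi b z + fweight e z * cf_im' alpha m1 m2 b z.
have dF z : 0 < z -> has_deriv F z (f z).
  by move=> z0; apply: has_derivM; [exact: has_deriv_fweight|exact: has_deriv_cf_im].
have fE z : f z * heaviside z = alpha * J z + b * (cfr b z * (fweight e z * heaviside z)) -
    cfi b z * (e ^+ 2 * z * expR (- (e * z)) * heaviside z).
  by rewrite /f /J /cf_im'; ring.
have iE : L1 leb (fun z => f z * heaviside z).
  under eq_fun do rewrite fE.
  by apply: L1B => //; apply: L1D; exact: L1Zl.
have cf z : 0 < z -> {for z, continuous f}.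
  move=> z0; apply: continuousD; apply: continuousM.
  - have d1 : exists d, has_deriv (fun z => - (e ^+ 2 * z * expR (- (e * z)))) z d.
      by eexists; deriv.
    by case: d1 => d1 /has_deriv_continuous.
  - by apply: has_deriv_continuous; exact: has_deriv_cf_im.
  - by apply: has_deriv_continuous; exact: has_deriv_fweight.
  - exact: continuous_cf_im'.
have bs z : 0 < z -> `|cfi b z| <= 1.
  move=> z0; rewrite -Ysin//.
  have := @Rint_le_norm _ _ _ P (fun s => sin (z * Y s)) (fun=> 1) one_L1.
  rewrite Rintegral_cst// mul1r (_ : fine (P setT) = 1); last by rewrite probability_setT.
  by apply; [meas|move=> x; exact: sin_max].
(* Near [0] the sine expectation is small by dominated convergence. *)
have Fa : F n.+2%:R^-1 @[n --> \oo] --> 0.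
  rewrite [X in X @ _](_ : _ = (fun n => cfi b n.+2%:R^-1 * fweight e n.+2%:R^-1)); last first.
    by apply/funext => n; rewrite /F mulrC.
  apply: (@cvg_bounded0 _ _ _ (1 + e)).
    have := @Rint_dominated_cvg _ _ _ P (fun n s => sin (n.+2%:R^-1 * Y s)) (fun=> 0) (fun=> 1).
    rewrite Rintegral_cst// mul0r => -[].
    + by move=> n; meas.
    + move=> s; rewrite -[X in _ --> X](@sin0 R) -(mul0r (Y s)).
      apply: (cvg_comp (fun n => n.+2%:R^-1 * Y s) sin); last exact: continuous_sin.
      by apply: cvgMl; exact: cvg_inv_nat.
    + exact: one_L1.
    + by move=> n s; exact: sin_max.
    move=> _; rewrite [X in X @ _](_ : _ = (fun n => cfi b n.+2%:R^-1))//.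
    by apply/funext => n; rewrite Ysin// invr_gt0.
  move=> n; have n0 : (0 : R) < n.+2%:R^-1 by rewrite invr_gt0.
  have n1 : (n.+2%:R^-1 : R) <= 1 by rewrite invf_le1// ler1n.
  rewrite ger0_norm ?fweight_ge0// /fweight -[leRHS]mulr1 ler_pM ?expR_ge0//.
  - by rewrite addr_ge0// mulr_ge0// ltW.
  - by rewrite lerD2l ler_piMr// ltW.
  - by rewrite -expR0 ler_expR oppr_le0 mulr_ge0// ltW.
have Fb : F n.+1%:R @[n --> \oo] --> 0.
  by apply: (cvg_bounded0 (cvg_fweight e0)) => n; exact: bs.
have := ftc_half dF cf Fa Fb iE; rewrite subrr.
under eq_Rintegral do rewrite fE.
rewrite RintegralB//; last by apply: L1D; exact: L1Zl.
rewrite RintegralD//; [|exact: L1Zl|exact: L1Zl].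
rewrite (RintegralZl alpha measurableT j4) (RintegralZl b measurableT ik) -Ek1 -Em1 -Ej => /eqP.
by rewrite subr_eq0 => /eqP ->.
Qed.

End kernel_stein.

(** * Signed intervals *)

Section signed_interval.
Context {R : realType}.
Local Notation leb := (@lebesgue_measure R).

(** Integrating against [sgn_itv v] is integrating from [0] to [v], for both signs of
[v]. Taking open intervals matches the tails of the Levy measure at every [u]. *)
Definition sgn_itv (v u : R) : R := heaviside u * heaviside (v - u) - heaviside (- u) * heaviside (u - v).

Lemma heaviside_itv (x : R) : 0 <= heaviside x <= 1.
Proof. by have [h|h] := ltP 0 x; [rewrite heaviside_gt0// ler01 lexx|rewrite heaviside_le0// ler01 lexx]. Qed.

Lemma sgn_itv_gt0 v u : 0 < u -> sgn_itv v u = heaviside (v - u).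
Proof.
by move=> u0; rewrite /sgn_itv heaviside_gt0// mul1r (@heaviside_le0 _ (- u)) ?oppr_le0 ?ltW// mul0r subr0.
Qed.

Lemma sgn_itv_lt0 v u : u < 0 -> sgn_itv v u = - heaviside (u - v).
Proof.
by move=> u0; rewrite /sgn_itv heaviside_le0 ?ltW// mul0r (@heaviside_gt0 _ (- u)) ?oppr_gt0// mul1r sub0r.
Qed.

Lemma sgn_itv0 v : sgn_itv v 0 = 0.
Proof. by rewrite /sgn_itv oppr0 heaviside_le0// !mul0r subrr. Qed.

Lemma sgn_itv_v0 u : sgn_itv 0 u = 0.
Proof.
rewrite /sgn_itv sub0r subr0.
have [u0|u0|<-] := ltgtP 0 u; last by rewrite oppr0 heaviside_le0// !mul0r subrr.
  by rewrite (@heaviside_le0 _ (- u)) ?oppr_le0 ?ltW// mulr0 mul0r subrr.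
by rewrite (@heaviside_le0 _ u) ?ltW// mulr0 mul0r subrr.
Qed.

Lemma sgn_itvN v u : sgn_itv (- v) (- u) = - sgn_itv v u.
Proof. by rewrite /sgn_itv !opprK [- v + _]addrC [- u + _]addrC; ring. Qed.

Lemma sgn_itvE v u : 0 < v -> sgn_itv v u = \1_(`]0, v[%classic) u.
Proof.
move=> v0; rewrite indicE; have [u0|u0|<-] := ltgtP 0 u.
- rewrite sgn_itv_gt0//; have [vu|uv] := ltP 0 (v - u).
    by rewrite heaviside_gt0// mem_set//= in_itv/= u0 -subr_gt0.
  by rewrite heaviside_le0// memNset//= in_itv/= u0/= -subr_gt0; apply/negP; rewrite -leNgt.
- rewrite sgn_itv_lt0// heaviside_le0 ?oppr0; last by rewrite subr_le0 ltW// (lt_trans u0).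
  by rewrite memNset//= in_itv/= ltNge ltW.
- by rewrite sgn_itv0 memNset//= in_itv/= ltxx.
Qed.

Let sgn_itv_ftc_gt0 (F f : R -> R) v : 0 < v -> (forall x, has_deriv F x (f x)) ->
  continuous f -> L1 leb (fun u => f u * sgn_itv v u) /\
  Rintegral leb setT (fun u => f u * sgn_itv v u) = F v - F 0.
Proof.
move=> v0 dF cf.
have iC : leb.-integrable `[0, v] (EFin \o f).
  apply: continuous_compact_integrable; first exact: segment_compact.
  exact: continuous_subspaceT.
have iO : leb.-integrable `]0, v[ (EFin \o f).
  apply: integrableS iC => //; exact: subset_itv_oo_cc.
have iOC : leb.-integrable `]0, v] (EFin \o f).
  apply: integrableS iC => //; exact: subset_itv_oc_cc.
have E : (fun u => f u * sgn_itv v u) = f \_ `]0, v[.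
  apply/funext => u; rewrite sgn_itvE// patchE indicE; case: ifPn => _; rewrite ?mulr1 ?mulr0//.
rewrite E; split.
  by rewrite /L1; move: iO => /integrable_mkcond; rewrite restrict_EFin; apply.
rewrite -Rintegral_mkcond Rintegral_itv_bndo_bndc// Rintegral_itv_obnd_cbnd//.
rewrite /Rintegral (@continuous_FTC2 _ f F _ _ v0)//.
- exact: continuous_subspaceT.
- split.
  + by move=> x _; have [] := dF x.
  + apply/cvg_at_right_filter; exact: has_deriv_continuous (dF 0).
  + apply/cvg_at_left_filter; exact: has_deriv_continuous (dF v).
- by move=> x _; have [_ h] := dF x; rewrite derive1E.
Qed.

(** Negative [v] reduces to positive [v] by the reflection [u |-> - u]. *)
Lemma sgn_itv_ftc (F f : R -> R) v : (forall x, has_deriv F x (f x)) ->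
  continuous f -> L1 leb (fun u => f u * sgn_itv v u) /\
  Rintegral leb setT (fun u => f u * sgn_itv v u) = F v - F 0.
Proof.
move=> dF cf; have [v0|v0|<-] := ltgtP 0 v; first exact: sgn_itv_ftc_gt0.
- have dG x : has_deriv (fun x => - F (- x)) x (f (- x)).
    apply: has_deriv_eq.
      apply: has_derivN; apply: (@has_deriv_comp _ (fun x => - x) F _ _ _ (dF (- x))); deriv.
    by rewrite /=; ring.
  have cg : continuous (fun x => f (- x)).
    by move=> x; apply: (@continuous_comp _ _ _ -%R f); [exact: opp_continuous|exact: cf].
  have v0' : 0 < - v by rewrite oppr_gt0.
  have [i e] := sgn_itv_ftc_gt0 v0' dG cg.
  have [i2 e2] := Rint_opp i.
  have E : (fun x => f (- - x) * sgn_itv (- v) (- x)) = (fun x => -1 * (f x * sgn_itv v x)).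
    by apply/funext => x; rewrite opprK sgn_itvN; ring.
  rewrite E in i2 e2.
  have i3 : L1 leb (fun u => f u * sgn_itv v u).
    have := L1Zl (-1) i2; congr (L1 _ _); apply/funext => u; ring.
  split => //; rewrite RintegralZl// e in e2.
  move/(congr1 -%R) : e2; rewrite mulN1r opprK => ->.
  by rewrite opprK oppr0; ring.
- have E : (fun u => f u * sgn_itv 0 u) = cst 0.
    by apply/funext => u; rewrite sgn_itv_v0 mulr0.
  by rewrite E; split; [exact: integrable0|rewrite Rintegral_cst// mul0r subrr].
Qed.

Lemma measurable_sgn_itv d (T : measurableType d) (f g : T -> R) :
  measurable_fun [set: T] f -> measurable_fun [set: T] g ->
  measurable_fun [set: T] (fun x => sgn_itv (f x) (g x)).
Proof. by move=> mf mg; rewrite /sgn_itv /heaviside; meas. Qed.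

Lemma sgn_itv_L1 v : L1 leb (sgn_itv v).
Proof.
have [] := @sgn_itv_ftc id (fun=> 1) v (@has_deriv_id R) (fun x => @cvg_cst _ _ _ _ _).
by move=> + _; congr (L1 _ _); apply/funext => u; rewrite mul1r.
Qed.

Lemma clamp_gt (v : R) : 1 < v -> clamp v = 1.
Proof.
by move=> v1; rewrite /clamp min_r ?(ltW v1)// max_r// (le_trans _ ler01)// oppr_le0 ler01.
Qed.

Lemma clamp_lt (v : R) : v < -1 -> clamp v = -1.
Proof. by move=> v1; rewrite /clamp min_l ?max_l// ltW// (lt_trans v1)//; lra. Qed.

Lemma clampN (v : R) : clamp (- v) = - clamp v.
Proof.
have [v1|v1] := leP `|v| 1; first by rewrite !clamp_near ?normrN.
have [v0|v0] := leP 0 v.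
  by move: v1; rewrite ger0_norm// => v1; rewrite (clamp_gt v1) clamp_lt// ltrN2.
move: v1; rewrite ltr0_norm// => v1.
by rewrite (clamp_gt v1) clamp_lt ?opprK// ltrNr.
Qed.

Let sgn_itv_clamp_gt0 v : 0 < v ->
  Rintegral leb setT (fun u => unit_indic u * sgn_itv v u) = clamp v.
Proof.
move=> v0; have [v1|v1] := leP `|v| 1.
  have [_] := @sgn_itv_ftc id (fun=> 1) v (@has_deriv_id R) (fun x => @cvg_cst _ _ _ _ _).
  rewrite clamp_near// subr0 => {2}<-; apply: eq_Rintegral => u _.
  rewrite mul1r sgn_itvE// indicE; case: (boolP (u \in _)) => [|_]; last by rewrite mulr0.
  rewrite inE/= in_itv/= => /andP[u0 uv].
  rewrite /unit_indic indicE mem_set/= ?mul1r// gtr0_norm//.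
  by rewrite (le_trans (ltW uv))// -(gtr0_norm v0).
rewrite gtr0_norm// in v1.
rewrite clamp_gt//.
rewrite (_ : (fun _ => _) = \1_(`]0, 1]%classic)).
  have h := @lebesgue_measure_itv R `]0, 1]; rewrite /= lte_fin ltr01 oppr0 adde0 in h.
  by rewrite /Rintegral integral_indic// setIT; exact: (congr1 fine h).
apply/funext => u; rewrite sgn_itvE// /unit_indic !indicE -natrM mulnb.
congr (_%:R); congr nat_of_bool; apply/idP/idP.
  move=> /andP[/set_mem/= u1 /set_mem/=]; rewrite in_itv/= => /andP[u0 uv].
  by rewrite mem_set//= in_itv/= u0/= -(gtr0_norm u0).
move=> /set_mem/=; rewrite in_itv/= => /andP[u0 u1].
rewrite mem_set/= ?gtr0_norm//; apply: mem_set => /=.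
by rewrite in_itv/= u0/= (le_lt_trans u1).
Qed.

Lemma sgn_itv_clamp v :
  Rintegral leb setT (fun u => unit_indic u * sgn_itv v u) = clamp v.
Proof.
have measfun_unit_indic : measurable_fun setT (@unit_indic R) by apply: (@measfun_unit_indic R _ _ id).
have bunit u : `|unit_indic u| <= 1 :> R.
  by rewrite /unit_indic indicE; case: (_ \in _); rewrite ?normr1 ?normr0.
have i w : L1 leb (fun u => unit_indic u * sgn_itv w u).
  exact: (@L1_mul_bounded _ _ R leb (@unit_indic R) (sgn_itv w) 1 measfun_unit_indic (sgn_itv_L1 w) bunit).
have [v0|v0|<-] := ltgtP 0 v; first exact: sgn_itv_clamp_gt0.
- have v0' : 0 < - v by rewrite oppr_gt0.
  have := sgn_itv_clamp_gt0 v0'; have [_ <-] := Rint_opp (i (- v)).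
  have -> : (fun u => unit_indic (- u) * sgn_itv (- v) (- u)) =
      (fun u => -1 * (unit_indic u * sgn_itv v u)).
    apply/funext => u; rewrite sgn_itvN; have -> : unit_indic (- u) = unit_indic u :> R.
      by rewrite /unit_indic !indicE; congr (_%:R); congr nat_of_bool; apply/idP/idP; rewrite !inE/= normrN.
    by ring.
  rewrite (RintegralZl (-1) measurableT (i v)) clampN.
  by move/(congr1 -%R); rewrite mulN1r !opprK.
- rewrite clamp_near ?normr0//.
  have E : (fun u => unit_indic u * sgn_itv 0 u) = cst 0.
    by apply/funext => u; rewrite sgn_itv_v0 mulr0.
  by rewrite E Rintegral_cst// mul0r.
Qed.

End signed_interval.

(** * Test functions and the jump operator *)

Section measurable_param.
Context d1 d2 (T1 : measurableType d1) (T2 : measurableType d2) (R : realType).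
Variable m2 : {sigma_finite_measure set T2 -> \bar R}.

Lemma measurable_Rintegral_param (H : T1 -> T2 -> R) :
  measurable_fun [set: T1 * T2] (fun p => H p.1 p.2) ->
  (forall s, L1 m2 (H s)) ->
  measurable_fun [set: T1] (fun s => Rintegral m2 setT (H s)).
Proof.
move=> mH iH.
pose f (p : T1 * T2) := (H p.1 p.2)%:E.
have mf : measurable_fun setT f by exact/measurable_EFinP.
have mp := measurable_fun_fubini_tonelli_F (m2 := m2) _ (measurable_funepos mf) (funepos_ge0 _).
have mn := measurable_fun_fubini_tonelli_F (m2 := m2) _ (measurable_funeneg mf) (funeneg_ge0 _).
have mF : measurable_fun setT (fun s => (\int[m2]_t (H s t)%:E)%E).
  rewrite (_ : (fun _ => _) = (fun s => (fubini_F m2 f^\+ s - fubini_F m2 f^\- s)%E)).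
    exact: emeasurable_funB.
  apply/funext => s; rewrite integralE /fubini_F.
  by congr (_ - _)%E; apply: eq_integral => t _; rewrite ?funeposE ?funenegE.
exact: (measurableT_comp (@fine_measurable R setT measurableT) mF).
Qed.

End measurable_param.

Section jump_operator.
Context {R : realType}.
Local Notation leb := (@lebesgue_measure R).
Variables (alpha : R) (m1 m2 : {nonneg R}).
Hypothesis alpha_gt0 : 0 < alpha.
Hypothesis alpha_lt2 : alpha < 2.
Local Notation rho := (levy_density alpha m1 m2).

(** What the argument requires of [g] and is shared by Schwartz functions and by the
mollifying kernels. *)
Record test_function (g : R -> R) (C : R) : Prop := TestFunction {
  tf_measurable : measurable_fun [set: R] g;
  tf_bounded : forall x, `|g x| <= C;
  tf_decay : forall x, `|x * g x| <= C;
  tf_lipschitz : forall x y, `|g y - g x| <= C * `|y - x|;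
  tf_L1 : L1 leb g;
  tf_L1_moment : L1 leb (fun x => x * g x) }.

Definition jump_term (g : R -> R) (x u : R) : R := (g (x + u) - g x * unit_indic u) * u.

Lemma tf_ge0 g C : test_function g C -> 0 <= C.
Proof. by move=> h; rewrite (le_trans (normr_ge0 (g 0)))// tf_bounded. Qed.

Lemma unit_indic_in (u : R) : `|u| <= 1 -> unit_indic u = 1.
Proof. by move=> h; rewrite /unit_indic indicE mem_set. Qed.

Lemma unit_indic_out (u : R) : 1 < `|u| -> unit_indic u = 0.
Proof. by move=> h; rewrite /unit_indic indicE memNset//=; apply/negP; rewrite -ltNge. Qed.

Lemma levy_weight0_ge0 (u : R) : 0 <= levy_weight 0 u.
Proof.
have [h|h] := leP `|u| 1; first by rewrite levy_weight_near// sqr_ge0.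
by rewrite levy_weight_far// powR_ge0.
Qed.

Lemma jump_near g C x u : test_function g C -> `|u| <= 1 ->
  `|jump_term g x u| <= C * levy_weight 0 u.
Proof.
move=> ng u1; rewrite /jump_term unit_indic_in// mulr1 levy_weight_near// normrM.
rewrite (le_trans (ler_wpM2r (normr_ge0 _) (tf_lipschitz ng _ _)))//.
by rewrite addrC addKr -mulrA -expr2 real_normK ?num_real.
Qed.

(** Near [0] the increment is Lipschitz; far from [0], writing [u = (x + u) - x]
trades the growth in [u] for the decay of [g]. *)
Lemma jump_le g C x u : test_function g C ->
  `|jump_term g x u| <= C * (1 + `|x|) * levy_weight 0 u.
Proof.
move=> ng; have C0 := tf_ge0 ng; have [u1|u1] := leP `|u| 1.
  rewrite (le_trans (jump_near x ng u1))// ler_wpM2r ?levy_weight0_ge0//.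
  by rewrite ler_peMr// lerDl.
rewrite /jump_term unit_indic_out// mulr0 subr0 levy_weight_far// powRr0 mulr1.
rewrite (_ : _ * u = (x + u) * g (x + u) - x * g (x + u)); last by ring.
rewrite (le_trans (ler_normB _ _))// mulrDr mulr1 lerD// ?(tf_decay ng)//.
by rewrite normrM mulrC ler_wpM2r// (tf_bounded ng).
Qed.

Lemma measurable_jump_term d (T : measurableType d) g (f h : T -> R) : measurable_fun [set: R] g ->
  measurable_fun [set: T] f -> measurable_fun [set: T] h ->
  measurable_fun [set: T] (fun x => jump_term g (f x) (h x)).
Proof. by move=> mg mf mh; rewrite /jump_term; meas. Qed.

Lemma levy_weight0_L1 : L1 leb (fun u => levy_weight 0 u * rho u).
Proof. exact: levy_weight_L1. Qed.

Lemma jump_L1 g C x : test_function g C -> L1 leb (fun u => jump_term g x u * rho u).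
Proof.
move=> ng; apply: (L1_le _ (L1Zl (C * (1 + `|x|)) levy_weight0_L1)).
  apply: measfunM; last by meas.
  by apply: (measurable_jump_term (tf_measurable ng)); meas.
move=> u; rewrite normrM (ger0_norm (levy_density_ge0 _ _ _ _)) mulrA.
by rewrite ler_wpM2r ?levy_density_ge0// jump_le.
Qed.

Definition jump_op (g : R -> R) (x : R) : R :=
  Rintegral leb setT (fun u => jump_term g x u * rho u).

Lemma measurable_jump_op g C : test_function g C -> measurable_fun [set: R] (jump_op g).
Proof.
move=> ng; apply: (@measurable_Rintegral_param _ _ _ _ R leb (fun x u => jump_term g x u * rho u)).
  apply: measfunM; last by meas.
  by apply: (measurable_jump_term (tf_measurable ng)); meas.
by move=> x; exact: jump_L1 ng.
Qed.

Lemma far_density_le (u : R) : 1 < `|u| -> `|u| * rho u <= m1%:num + m2%:num.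
Proof.
move=> u1; have p a : 1 < a -> a * a `^ (- (1 + alpha)) <= 1.
  move=> a1; rewrite -{1}[a]powRr1 ?(ltW (lt_trans ltr01 a1))//.
  rewrite -powRD ?(gt_eqF (lt_trans ltr01 a1)) ?implybT//.
  rewrite -[leRHS](powRr0 a) ler_powR ?(ltW a1)//.
  by have h := alpha_gt0; lra.
have [u0|u0|u0] := ltgtP u 0; last by rewrite u0 normr0 mul0r addr_ge0.
- rewrite levy_density_lt0// ltr0_norm//= in u1 *.
  rewrite mulrCA (le_trans (ler_wpM2l _ (p _ u1)))// mulr1 lerDr//.
- rewrite levy_density_gt0// gtr0_norm//= in u1 *.
  rewrite mulrCA (le_trans (ler_wpM2l _ (p _ u1)))// mulr1 lerDl//.
Qed.

(** The large jumps contribute at most a multiple of the integral of [|g|], since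
[|u|] times the density is bounded there; this is uniform in [x], unlike
[jump_le]. *)
Lemma jump_op_bounded g C : test_function g C -> exists K, forall x, `|jump_op g x| <= K.
Proof.
move=> ng; pose M := m1%:num + m2%:num.
exists (Rintegral leb setT (fun u => C * (levy_weight 0 u * rho u)) +
        Rintegral leb setT (fun u => M * `|g u|)) => x.
have i1 : L1 leb (fun u => C * (levy_weight 0 u * rho u)) := L1Zl C levy_weight0_L1.
have i2 : L1 leb (fun u => M * `|g u|) := L1Zl M (L1_norm (tf_L1 ng)).
have [i3 e3] := Rint_shift x i2; rewrite -e3 -RintegralD//.
apply: Rint_le_norm; [exact: L1D|exact: L1_meas (jump_L1 _ ng)|].
move=> u; rewrite normrM (ger0_norm (levy_density_ge0 _ _ _ _)).
have C0 := tf_ge0 ng; have M0 : 0 <= M by rewrite addr_ge0.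
have [u1|u1] := leP `|u| 1.
  rewrite (le_trans (ler_wpM2r (levy_density_ge0 _ _ _ _) (jump_near x ng u1)))//.
  by rewrite mulrA lerDl mulr_ge0.
rewrite /jump_term unit_indic_out// mulr0 subr0 normrM -mulrA.
rewrite (le_trans (ler_wpM2l _ (far_density_le u1)))// mulrC lerDr.
by rewrite mulr_ge0// mulr_ge0 ?levy_density_ge0 ?levy_weight0_ge0.
Qed.

End jump_operator.

(** * The kernel as a test function *)

Section tf_kernel.
Context {R : realType}.
Local Notation leb := (@lebesgue_measure R).

(** The integrable majorant is [min 1 v^-2], which is a Levy weight times the density
for [alpha = 1], completed by the indicator of the unit ball because that density
is [0] at [0]. *)
Lemma quadratic_decay_L1 (f : R -> R) (C : R) : measurable_fun [set: R] f ->
  (forall x, (1 + x ^+ 2) * `|f x| <= C) -> L1 leb f.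
Proof.
move=> mf fC.
have C0 : 0 <= C by rewrite (le_trans _ (fC 0))// mulr_ge0// addr_ge0// sqr_ge0.
pose one : {nonneg R} := NngNum (@ler01 R).
pose r := levy_density 1 one one.
have i1 : L1 leb (\1_[set w : R | `|w| <= 1]).
  rewrite (_ : [set w : R | `|w| <= 1] = `[-1, 1]%classic).
    exact: integrable_indic_itv.
  by apply/seteqP; split => x /=; rewrite in_itv/= ler_norml.
have i2 : L1 leb (fun v => levy_weight 0 v * r v).
  by apply: levy_weight_L1 => //; rewrite ltr1n.
have iC := L1Zl C (L1D i1 i2); apply: (@L1_le _ _ R leb f _ mf iC) => x.
have D0 : 0 < 1 + x ^+ 2 by rewrite ltr_wpDr ?sqr_ge0.
have fD : `|f x| <= C / (1 + x ^+ 2) by rewrite ler_pdivlMr// mulrC.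
rewrite (le_trans fD)// ler_wpM2l//.
have r0 : 0 <= r x := levy_density_ge0 _ _ _ _.
have [x1|x1] := leP `|x| 1.
  rewrite indicE mem_set//= (@le_trans _ _ 1)//.
    by rewrite invf_le1// lerDl sqr_ge0.
  by rewrite lerDl mulr_ge0// levy_weight0_ge0.
rewrite indicE memNset/=; last by apply/negP; rewrite -ltNge.
rewrite add0r levy_weight_far// powRr0 mul1r.
have xx : x != 0 by rewrite -normr_gt0 (lt_trans _ x1).
have rE : r x = (x ^+ 2)^-1.
  have E : - (1 + 1) = - 2%:R :> R by [].
  have [x0|x0|x0] := ltgtP x 0; last by rewrite x0 eqxx in xx.
  - by rewrite /r levy_density_lt0// mul1r E powR_invn ?oppr_ge0 ?ltW// sqrrN.
  - by rewrite /r levy_density_gt0// mul1r E powR_invn// ltW.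
rewrite rE lef_pV2 ?posrE ?lerDr//.
by rewrite exprn_even_gt0.
Qed.

Lemma abs_le_quad (x : R) : 2 * `|x| <= 1 + x ^+ 2.
Proof.
rewrite -(real_normK (num_real x)) -subr_ge0.
by rewrite [X in 0 <= X](_ : _ = (1 - `|x|) ^+ 2) ?sqr_ge0//; ring.
Qed.

Lemma kernel1E (x : R) : kernel 1 x = 2 / (1 + x ^+ 2) ^+ 2.
Proof. by rewrite /kernel !expr1n mulr1. Qed.

Lemma kernel_scale (e x : R) : 0 < e -> kernel e x = e^-1 * kernel 1 (e^-1 * x).
Proof.
move=> e0; rewrite kernel1E /kernel.
have d1 := kernel_den x e0.
have d2 : 1 + (e^-1 * x) ^+ 2 != 0 by rewrite gt_eqF// ltr_wpDr ?sqr_ge0.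
by field; rewrite d1 gt_eqF.
Qed.

Lemma tf_scale (g : R -> R) (C c : R) : 0 < c -> test_function g C ->
  exists C', test_function (fun x => c * g (c * x)) C'.
Proof.
move=> c0 ng; have C0 := tf_ge0 ng.
exists (C * (1 + c + c ^+ 2)).
have mg := tf_measurable ng.
have [i1 _] := Rint_scale c0 (tf_L1 ng).
have [i2 _] := Rint_scale c0 (tf_L1_moment ng).
split.
- by meas.
- move=> x; rewrite normrM (gtr0_norm c0).
  have := ler_wpM2l (ltW c0) (tf_bounded ng (c * x)).
  have : 0 <= C * (1 + c ^+ 2) by rewrite mulr_ge0// addr_ge0// sqr_ge0.
  lra.
- move=> x; rewrite (_ : x * _ = (c * x) * g (c * x)); last by ring.
  rewrite (le_trans (tf_decay ng _))// ler_peMr// -addrA lerDl addr_ge0// ?sqr_ge0// ltW//.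
- move=> x y; rewrite -mulrBr normrM (gtr0_norm c0).
  have := ler_wpM2l (ltW c0) (tf_lipschitz ng (c * x) (c * y)).
  rewrite -mulrBr normrM (gtr0_norm c0).
  have : 0 <= C * (1 + c) * `|y - x| by rewrite !mulr_ge0// addr_ge0// ltW.
  lra.
- exact: L1Zl.
- by have := i2; congr (L1 _ _); apply/funext => x; ring.
Qed.

Lemma has_deriv_kernel1 (x : R) : has_deriv (kernel 1) x (- 8 * x / (1 + x ^+ 2) ^+ 3).
Proof.
have D0 : 1 + x ^+ 2 != 0 by rewrite gt_eqF// ltr_wpDr ?sqr_ge0.
rewrite (_ : kernel 1 = fun x => 2 * ((1 + x * x) * (1 + x * x))^-1); last first.
  by apply/funext => y; rewrite kernel1E !expr2.
rewrite expr2 in D0.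
apply: has_deriv_eq.
  apply: has_derivM; first exact: has_deriv_cst.
  apply: has_derivV; first by rewrite mulf_neq0.
  by deriv.
by rewrite /=; field; rewrite expr2.
Qed.

Lemma tf_kernel1 : test_function (@kernel R 1) 4.
Proof.
have D1 (x : R) : 1 <= 1 + x ^+ 2 by rewrite lerDl sqr_ge0.
have D0 (x : R) : 0 < 1 + x ^+ 2 by rewrite (lt_le_trans _ (D1 x)).
have mk : measurable_fun [set: R] (@kernel R 1).
  by apply: continuous_measurable_fun => x; exact: has_deriv_continuous (has_deriv_kernel1 x).
have k0 (x : R) : 0 <= kernel 1 x by rewrite kernel1E divr_ge0// exprn_ge0// ltW.
have kD2 (x : R) : (1 + x ^+ 2) * ((1 + x ^+ 2) * kernel 1 x) = 2.
  by rewrite kernel1E; field; rewrite gt_eqF.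
have kD (x : R) : (1 + x ^+ 2) * kernel 1 x <= 2.
  by rewrite -[leRHS](kD2 x) ler_peMl// mulr_ge0// ltW.
have measfunD (x : R) : `|x| * kernel 1 x <= 1.
  have := ler_wpM2r (k0 x) (abs_le_quad x); have := kD x; lra.
split => //.
- move=> x; rewrite ger0_norm//.
  have := ler_wpM2r (k0 x) (D1 x); have := kD x; lra.
- by move=> x; rewrite normrM (ger0_norm (k0 x)) (le_trans (measfunD x))// ler1n.
- apply: (lipschitz_derive has_deriv_kernel1) => x.
  have D3 : 0 < (1 + x ^+ 2) ^+ 3 by rewrite exprn_gt0.
  rewrite normrM [X in _ * X]ger0_norm ?invr_ge0 ?(ltW D3)// ler_pdivrMr//.
  rewrite normrM normrN (ger0_norm (ler0n _ _)).
  have h1 := abs_le_quad x.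
  have h2 : 1 + x ^+ 2 <= (1 + x ^+ 2) ^+ 3.
    by rewrite -[leLHS]expr1 ler_weXn2l.
  lra.
- apply: (@quadratic_decay_L1 _ 2) => // x; by rewrite ger0_norm.
- apply: (@quadratic_decay_L1 _ 1); first by meas.
  move=> x; rewrite normrM (ger0_norm (k0 x)).
  have h : 0 <= (1 + x ^+ 2) * kernel 1 x by rewrite mulr_ge0// ltW.
  have := ler_wpM2r h (abs_le_quad x).
  rewrite kD2; lra.
Qed.

Lemma tf_kernel (e : R) : 0 < e -> exists C, test_function (kernel e) C.
Proof.
move=> e0; have ei : 0 < e^-1 by rewrite invr_gt0.
have [C h] := tf_scale ei tf_kernel1; exists C.
by rewrite (_ : kernel e = fun x => e^-1 * kernel 1 (e^-1 * x))//; apply/funext => x; exact: kernel_scale.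
Qed.

Lemma kernel1_mass : 0 < Rintegral leb setT (@kernel R 1).
Proof.
have i1 : L1 leb (fun x => 2^-1 * \1_(`[0, 1]%classic) x).
  by apply: L1Zl; exact: integrable_indic_itv.
apply: (@lt_le_trans _ _ (Rintegral leb setT (fun x => 2^-1 * \1_(`[0, 1]%classic) x))).
  rewrite RintegralZl//; last exact: integrable_indic_itv.
  rewrite mulr_gt0// /Rintegral integral_indic// setIT.
  have h := @lebesgue_measure_itv R `[0, 1]; rewrite /= lte_fin ltr01 oppr0 adde0 in h.
  by rewrite (congr1 fine h).
apply: le_Rintegral => //; first exact: tf_L1 tf_kernel1.
move=> x _; rewrite -[leRHS]/(kernel 1 x) indicE; case: (boolP (x \in _)) => [|_]; last first.
  by rewrite mulr0 kernel1E divr_ge0// exprn_ge0// addr_ge0// sqr_ge0.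
rewrite inE/= in_itv/= mulr1 kernel1E => /andP[x0 x1].
have h : (1 + x ^+ 2) ^+ 2 <= 4.
  have h2 : x ^+ 2 <= 1 by rewrite expr_le1.
  have h3 : 0 <= x ^+ 2 by rewrite sqr_ge0.
  nra.
rewrite ler_pdivlMr; last by rewrite exprn_gt0// ltr_wpDr// sqr_ge0.
lra.
Qed.

End tf_kernel.

(** * The jump operator in the frequency domain *)

Section kernel_jump_op.
Context {R : realType}.
Local Notation leb := (@lebesgue_measure R).
Variables (alpha : R) (m1 m2 : {nonneg R}).
Hypothesis alpha_gt0 : 0 < alpha.
Hypothesis alpha_lt2 : alpha < 2.
Local Notation rho := (levy_density alpha m1 m2).

(** For [u > 0] this is [u^-alpha = alpha int_u^oo v^(- 1 - alpha) dv]; negative [u]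
are reduced to it by reflection. *)
Lemma moment_tail (u : R) :
  [/\ L1 leb (fun v => sgn_itv v u * rho v),
      L1 leb (fun v => `|sgn_itv v u| * rho v),
      alpha * Rintegral leb setT (fun v => sgn_itv v u * rho v) = u * rho u &
      alpha * Rintegral leb setT (fun v => `|sgn_itv v u| * rho v) = `|u| * rho u].
Proof.
have a0 : alpha != 0 by rewrite gt_eqF.
have pw w : 0 < w -> w `^ (- alpha) = w * w `^ (- (1 + alpha)).
  move=> w0; rewrite -{2}[w]powRr1 ?(ltW w0)// -powRD ?(gt_eqF w0) ?implybT//.
  by congr (_ `^ _); ring.
have posE (w v : R) : \1_[set w' : R | w < w'] v = heaviside (v - w).
  by rewrite /heaviside !indicE; congr (_%:R); congr nat_of_bool; apply/idP/idP; rewrite !inE/= subr_gt0.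
have [u0|u0|u0] := ltgtP u 0.
- have u0' : 0 < - u by rewrite oppr_gt0.
  have [i' e'] := levy_tail alpha_gt0 m2 m1 u0'; have [i e] := Rint_opp i'.
  rewrite e' pw// in e.
  have E : (fun v => \1_[set w : R | - u < w] (- v) * levy_density alpha m2 m1 (- v)) =
      (fun v => `|sgn_itv v u| * rho v).
    apply/funext => v; rewrite levy_densityN posE sgn_itv_lt0// normrN.
    have /andP[h _] := heaviside_itv (u - v); rewrite ger0_norm//.
    by rewrite opprK [u - v]addrC.
  rewrite E in i e.
  have E2 : (fun v => sgn_itv v u * rho v) = (fun v => -1 * (`|sgn_itv v u| * rho v)).
    apply/funext => v; rewrite sgn_itv_lt0// normrN.
    have /andP[h _] := heaviside_itv (u - v); rewrite ger0_norm//; ring.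
  rewrite E2; split => //; first exact: L1Zl.
  + rewrite RintegralZl// e levy_density_lt0//; field => //.
  + by rewrite e levy_density_lt0// ltr0_norm//; field.
- have [i e] := levy_tail alpha_gt0 m1 m2 u0; rewrite pw// in e.
  have E : (fun v => \1_[set w : R | u < w] v * rho v) = (fun v => sgn_itv v u * rho v).
    by apply/funext => v; rewrite posE sgn_itv_gt0.
  have E2 : (fun v => `|sgn_itv v u| * rho v) = (fun v => sgn_itv v u * rho v).
    apply/funext => v; rewrite sgn_itv_gt0//.
    by have /andP[h _] := heaviside_itv (v - u); rewrite ger0_norm.
  rewrite E in i e; rewrite E2; split => //.
  + by rewrite e levy_density_gt0//; field.
  + by rewrite e levy_density_gt0// gtr0_norm//; field.
- have E : (fun v => sgn_itv v u * rho v) = cst 0.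
    by apply/funext => v; rewrite u0 sgn_itv0 mul0r.
  have E2 : (fun v => `|sgn_itv v u| * rho v) = cst 0.
    by apply/funext => v; rewrite u0 sgn_itv0 normr0 mul0r.
  rewrite E E2 Rintegral_cst// mul0r mulr0 u0 normr0 mul0r.
  by split => //; exact: integrable0.
Qed.

(** Replacing [u rho u] by the tail integral of [moment_tail] and exchanging
integrals moves the primitive onto [g]; the Levy density then integrates
increments of a bounded function, which large jumps cannot make diverge. *)
Lemma jump_op_layer g C x : test_function g C ->
  jump_op alpha m1 m2 g x = alpha * Rintegral leb setT (fun v =>
    Rintegral leb setT (fun u => (g (x + u) - g x * unit_indic u) * sgn_itv v u) * rho v).
Proof.
move=> ng; pose h u := g (x + u) - g x * unit_indic u.
have mg := tf_measurable ng; have C0 := tf_ge0 ng.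
have mh : measurable_fun [set: R] h by rewrite /h; meas.
have bh u : `|h u| <= C + C.
  rewrite (le_trans (ler_normB _ _))// lerD ?(tf_bounded ng)// normrM.
  rewrite -[leRHS]mulr1 ler_pM// ?(tf_bounded ng)//.
  by rewrite /unit_indic indicE; case: (_ \in _); rewrite ?normr1 ?normr0.
have i1 u : L1 leb (fun v => h u * (sgn_itv v u * rho v)).
  by apply: L1Zl; have [] := moment_tail u.
have i2 v : L1 leb (fun u => h u * (sgn_itv v u * rho v)).
  under eq_fun do rewrite mulrA; apply: L1Zr.
  exact: (@L1_mul_bounded _ _ R leb h (sgn_itv v) _ mh (sgn_itv_L1 v) bh).
have a0 : alpha != 0 by rewrite gt_eqF.
have E3 : (fun u => Rintegral leb setT (fun v => `|h u * (sgn_itv v u * rho v)|)) =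
    (fun u => alpha^-1 * `|jump_term g x u * rho u|).
  apply/funext => u; have [_ j _ e] := moment_tail u.
  rewrite (_ : (fun v => _) = (fun v => `|h u| * (`|sgn_itv v u| * rho v))).
    rewrite (RintegralZl `|h u| measurableT j) -[X in _ * X](mulKf a0) e.
    rewrite /jump_term -/(h u) !normrM (ger0_norm (levy_density_ge0 _ _ _ _)); ring.
  by apply/funext => v; rewrite !normrM (ger0_norm (levy_density_ge0 _ _ _ _)).
have [||||_ _ E] := @Rint_fubini _ _ _ _ R leb leb (fun u v => h u * (sgn_itv v u * rho v)).
- apply: measfunM; first by meas.
  by apply: measfunM; [apply: measurable_sgn_itv|]; meas.
- exact: i1.
- exact: i2.
- by rewrite E3; apply: L1Zl; apply: L1_norm; exact: jump_L1 ng.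
rewrite /jump_op -[LHS](mulVKf a0); congr (_ * _).
rewrite -(RintZl _ (jump_L1 m1 m2 alpha_gt0 alpha_lt2 x ng)).
transitivity (Rintegral leb setT (fun u => Rintegral leb setT (fun v => h u * (sgn_itv v u * rho v)))).
  apply: eq_Rint => u; have [j _ e _] := moment_tail u.
  rewrite (RintZl _ j) -[X in _ = _ * X](mulKf a0) e /jump_term -/(h u); ring.
rewrite E; apply: eq_Rint => v.
rewrite -(RintZr _ (@L1_mul_bounded _ _ R leb h (sgn_itv v) _ mh (sgn_itv_L1 v) bh)).
by apply: eq_Rint => u; ring.
Qed.

(** Fourier inversion of the kernel, followed by integration of [cos] in the jump size. *)
Lemma kernel_increment e x v : 0 < e ->
  Rintegral leb setT (fun u => (kernel e (x + u) - kernel e x * unit_indic u) * sgn_itv v u) =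
  Rintegral leb setT (fun z => wave (z * x) z v / z * (fweight e z * heaviside z)).
Proof.
move=> e0.
have iW := fweight_L1 e0.
pose H (u z : R) := (cos (z * (x + u)) - unit_indic u * cos (z * x)) * sgn_itv v u * (fweight e z * heaviside z).
have [|u z|j1 j2 j3 j4 E] := @Rint_fubini_dominated _ _ _ _ R leb leb H _ (fun u => 2 * `|sgn_itv v u|)
    (fun z => fweight e z * heaviside z) (L1Zl 2 (L1_norm (sgn_itv_L1 v))) iW.
- rewrite /H; apply: measfunM; last by rewrite /fweight /heaviside; meas.
  by apply: measfunM; last apply: measurable_sgn_itv; meas.
- have w0 : 0 <= fweight e z * heaviside z.
    have [z0|z0] := ltP 0 z; last by rewrite heaviside_le0// mulr0.
    by rewrite heaviside_gt0// mulr1 fweight_ge0.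
  rewrite /H normrM (ger0_norm w0) ler_wpM2r// normrM ler_wpM2r//.
  rewrite (le_trans (ler_normB _ _))// (_ : 2 = 1 + 1 :> R)// lerD ?cos_max//.
  rewrite normrM -[leRHS]mulr1 ler_pM// ?cos_max//.
  by rewrite /unit_indic indicE; case: (_ \in _); rewrite ?normr1 ?normr0.
have ic y : L1 leb (fun z => cos (z * y) * (fweight e z * heaviside z)).
  by apply: (fweight_bounded_L1 e0); [meas|move=> z; exact: cos_max].
transitivity (Rintegral leb setT (fun u => Rintegral leb setT (H u))).
  apply: eq_Rint => u; rewrite -(kernel_fourier (x + u) e0) -(kernel_fourier x e0).
  rewrite [_ * unit_indic u]mulrC -(RintZl (unit_indic u) (ic x)).
  rewrite -(RintB (ic (x + u)) (L1Zl _ (ic x))).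
  rewrite -(RintZr _ (L1B (ic (x + u)) (L1Zl _ (ic x)))).
  by apply: eq_Rint => z; rewrite /H; ring.
rewrite E; apply: eq_Rint => z.
have [z0|z0] := ltP 0 z; last first.
  by rewrite (heaviside_le0 z0) !mulr0; apply: Rint0 => u; rewrite /H (heaviside_le0 z0) !mulr0.
pose F u := sin (z * (x + u)) / z.
have zn0 : z != 0 by rewrite gt_eqF.
have dF u : has_deriv F u (cos (z * (x + u))).
  by apply: has_deriv_eq; [rewrite /F; deriv|rewrite /=; field].
have cF : continuous (fun u => cos (z * (x + u))).
  move=> u; have d : exists d, has_deriv (fun u => cos (z * (x + u))) u d by eexists; deriv.
  by case: d => d /has_deriv_continuous.
have [k1 k2] := sgn_itv_ftc v dF cF.
have munit' : measurable_fun setT (@unit_indic R) by apply: (@measfun_unit_indic R _ _ id).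
have bunit u : `|unit_indic u| <= 1 :> R.
  by rewrite /unit_indic indicE; case: (_ \in _); rewrite ?normr1 ?normr0.
have k3 := @L1_mul_bounded _ _ R leb (@unit_indic R) (sgn_itv v) 1 munit' (sgn_itv_L1 v) bunit.
rewrite /H; set w := fweight e z * heaviside z.
rewrite (eq_Rint leb (g := fun u => w * (cos (z * (x + u)) * sgn_itv v u) -
    w * cos (z * x) * (unit_indic u * sgn_itv v u))); last by move=> u; ring.
rewrite (RintB (L1Zl _ k1) (L1Zl _ k3)) (RintZl _ k1) (RintZl _ k3) k2 sgn_itv_clamp.
by rewrite /F /wave addr0 [z * (x + v)]mulrDr; field.
Qed.

(** The Levy integral of [wave] is a combination of the real and imaginary parts of
the exponent, with the sine and cosine of the phase as coefficients. *)
Lemma kernel_jump_op e x : 0 < e ->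
  jump_op alpha m1 m2 (kernel e) x = alpha * kernel_jump alpha m1 m2 e x.
Proof.
move=> e0; have [C nk] := tf_kernel e0.
rewrite (jump_op_layer _ nk); congr (_ * _).
under eq_Rintegral do rewrite kernel_increment//.
have s1 : -1 < alpha / 2 - 1 by have h := alpha_gt0; lra.
have s0 : alpha / 2 - 1 < 0 by have h := alpha_lt2; lra.
have ig := fweight_growth_L1 e0 s1 s0.
have iw := levy_weight_half_L1 m1 m2 alpha_gt0 alpha_lt2.
pose H (v z : R) := wave (z * x) z v * rho v / z * (fweight e z * heaviside z).
have [|v z|j1 j2 j3 j4 E] := @Rint_fubini_dominated _ _ _ _ R leb leb H _ _ _ iw ig.
- rewrite /H; apply: measfunM; last by rewrite /fweight /heaviside; meas.
  by apply: measfunM; [apply: measfunM; [apply: measurable_wave|]|]; meas.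
- have [z0|z0] := ltP 0 z; last by rewrite /H heaviside_le0// !mulr0 normr0.
  have r0 : 0 <= rho v := levy_density_ge0 _ _ _ _.
  rewrite /H heaviside_gt0// !mulr1 normrM [X in _ * X]ger0_norm ?fweight_ge0//.
  rewrite mulrA ler_wpM2r ?fweight_ge0//.
  rewrite normrM [X in _ * X]gtr0_norm ?invr_gt0// ler_pdivrMr//.
  rewrite normrM (ger0_norm r0).
  have := ler_wpM2r r0 (wave_le alpha_gt0 alpha_lt2 (z * x) v z0).
  by rewrite /wave_bound; congr (_ <= _); ring.
transitivity (Rintegral leb setT (fun v => Rintegral leb setT (H v))).
  apply: eq_Rint => v.
  have [r0|r0] := eqVneq (rho v) 0.
    by rewrite r0 mulr0; apply/esym/Rint0 => z; rewrite /H r0 mulr0 !mul0r.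
  have i : L1 leb (fun z => wave (z * x) z v / z * (fweight e z * heaviside z)).
    have := L1Zl (rho v)^-1 (j1 v); congr (L1 _ _); apply/funext => z.
    rewrite -[RHS](mulKf r0) /H; congr (_ * _); ring.
  by rewrite -(RintZr _ i); apply: eq_Rint => z; rewrite /H; ring.
rewrite E /kernel_jump; apply: eq_Rint => z.
have [z0|z0] := ltP 0 z; last first.
  by rewrite (heaviside_le0 z0) !mulr0; apply: Rint0 => v; rewrite /H (heaviside_le0 z0) !mulr0.
have k := wave_L1 m1 m2 alpha_gt0 alpha_lt2 (z * x) z0.
rewrite -(re_closedE m1 m2 alpha_gt0 alpha_lt2 z0) -(imc_closedE m1 m2 alpha_gt0 alpha_lt2 z0).
rewrite -(wave_integral m1 m2 alpha_gt0 alpha_lt2 _ z0).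
by rewrite -(RintZr _ k) -(RintZr _ (L1Zr _ k)).
Qed.

End kernel_jump_op.

(** * Superpositions of translates *)

Section superposition.
Context {R : realType}.
Local Notation leb := (@lebesgue_measure R).
Variables (alpha : R) (m1 m2 : {nonneg R}).
Hypothesis alpha_gt0 : 0 < alpha.
Hypothesis alpha_lt2 : alpha < 2.
Local Notation rho := (levy_density alpha m1 m2).
Local Notation jop := (jump_op alpha m1 m2).

Definition blur (w f : R -> R) (c x : R) : R :=
  Rintegral leb setT (fun s => w s * f (x - c * s)).

Lemma blur_L1 w f C c x : L1 leb w -> test_function f C ->
  L1 leb (fun s => w s * f (x - c * s)).
Proof.
move=> iw nf; have mf := tf_measurable nf; have mw := L1_meas iw.
apply: (@L1_le _ _ R leb _ _ _ (L1Zr C (L1_norm iw))).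
  by meas.
by move=> s; rewrite normrM ler_wpM2l// (tf_bounded nf).
Qed.

(** The jump operator is linear and commutes with translations; the first moment of
[w] compensates the growth in [x] of the bound [jump_le]. *)
Lemma jump_op_blur w f C c x : L1 leb w -> L1 leb (fun s => s * w s) -> test_function f C ->
  blur w (jop f) c x = Rintegral leb setT (fun u =>
    (blur w f c (x + u) - blur w f c x * unit_indic u) * u * rho u).
Proof.
move=> iw isw nf; have mf := tf_measurable nf; have mw := L1_meas iw.
have C0 := tf_ge0 nf.
pose H s u := w s * (jump_term f (x - c * s) u * rho u).
pose G s := C * ((1 + `|x|) * `|w s| + `|c| * `|s * w s|).
have iG : L1 leb G.
  by apply: L1Zl; apply: L1D; apply: L1Zl; exact: L1_norm.
have iW := @levy_weight0_L1 R alpha m1 m2 alpha_gt0 alpha_lt2.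
have [|s u|j1 j2 j3 j4 E] := @Rint_fubini_dominated _ _ _ _ R leb leb H _ G _ iG iW.
- rewrite /H; apply: measfunM; first by meas.
  by apply: measfunM; [apply: (measurable_jump_term mf)|]; meas.
- have r0 : 0 <= rho u := levy_density_ge0 _ _ _ _.
  rewrite /H normrM normrM (ger0_norm r0) !mulrA ler_wpM2r//.
  rewrite (le_trans (ler_wpM2l (normr_ge0 _) (jump_le (x - c * s) u nf)))//.
  rewrite mulrA ler_wpM2r ?levy_weight0_ge0// /G.
  have h : `|x - c * s| <= `|x| + `|c| * `|s|.
    by rewrite (le_trans (ler_normB _ _))// normrM.
  have := ler_wpM2l (mulr_ge0 (normr_ge0 (w s)) C0) h.
  rewrite normrM; lra.
transitivity (Rintegral leb setT (fun s => Rintegral leb setT (H s))).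
  apply: eq_Rint => s; rewrite /H.
  by rewrite (RintZl (w s) (jump_L1 m1 m2 alpha_gt0 alpha_lt2 (x - c * s) nf)).
rewrite E; apply: eq_Rint => u.
have k1 := blur_L1 c (x + u) iw nf; have k2 := blur_L1 c x iw nf.
rewrite /blur -(RintZr (unit_indic u) k2) -(RintB k1 (L1Zr _ k2)).
rewrite -(RintZr u (L1B k1 (L1Zr _ k2))) -(RintZr (rho u) (L1Zr u (L1B k1 (L1Zr _ k2)))).
apply: eq_Rint => s; rewrite /H /jump_term.
by rewrite (_ : x + u - c * s = x - c * s + u); ring.
Qed.

(** An affine substitution turns an average of translates of [g] into a superposition
of translates of the kernel with weight [g]. *)
Lemma blur_kernel g C e x : 0 < e -> test_function g C ->
  blur (kernel 1) g e x = blur g (kernel e) 1 x.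
Proof.
move=> e0 ng; have [K nk] := tf_kernel e0.
have i := blur_L1 1 x (tf_L1 ng) nk.
have c0 : - e != 0 by rewrite oppr_eq0 gt_eqF.
have [i2 e2] := Rint_affine x c0 i.
rewrite normrN (gtr0_norm e0) in e2.
rewrite /blur -[RHS](mulKf (lt0r_neq0 e0)) mulrCA -e2 -(RintZl e i2).
have en0 : e != 0 by rewrite gt_eqF.
apply: eq_Rint => y; rewrite (_ : x - 1 * (x + - e * y) = e * y); last by ring.
rewrite (kernel_scale _ e0) (mulKf en0) mulNr mulrCA (mulrA e) divff// mul1r.
exact: mulrC.
Qed.

Lemma jump_op_mollify g C e x : 0 < e -> test_function g C ->
  blur (kernel 1) (jop g) e x = blur g (jop (kernel e)) 1 x.
Proof.
move=> e0 ng; have [K nk] := tf_kernel e0; have n1 := @tf_kernel1 R.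
rewrite (jump_op_blur e x (tf_L1 n1) (tf_L1_moment n1) ng).
rewrite (jump_op_blur 1 x (tf_L1 ng) (tf_L1_moment ng) nk).
by apply: eq_Rint => u; rewrite !(blur_kernel _ e0 ng).
Qed.

End superposition.

(** * From kernels to test functions *)

Section real_stein.
Context {R : realType}.
Local Notation leb := (@lebesgue_measure R).
Variables (alpha beta : R) (m1 m2 : {nonneg R}).
Hypothesis alpha_gt0 : 0 < alpha.
Hypothesis alpha_lt2 : alpha < 2.
Local Notation rho := (levy_density alpha m1 m2).
Local Notation jop := (jump_op alpha m1 m2).

Variables (d : measure_display) (T : measurableType d) (P : probability T R).
Variable X : T -> R.
Hypothesis measfunX : measurable_fun [set: T] X.
Hypothesis Xcos : forall z, 0 < z ->
  Rintegral P setT (fun w => cos (z * X w)) = cf_re alpha m1 m2 beta z.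
Hypothesis Xsin : forall z, 0 < z ->
  Rintegral P setT (fun w => sin (z * X w)) = cf_im alpha m1 m2 beta z.

Let cos_L1 z : L1 P (fun w => cos (z * X w)).
Proof. by apply: (@L1_bounded _ _ _ P _ 1); [meas|move=> x; exact: cos_max]. Qed.

Let sin_L1 z : L1 P (fun w => sin (z * X w)).
Proof. by apply: (@L1_bounded _ _ _ P _ 1); [meas|move=> x; exact: sin_max]. Qed.

(** [X - a] has the same exponent with drift [beta - a]. *)
Lemma translated_kernel_stein a e : 0 < e ->
  Rintegral P setT (fun w => (X w - beta) * kernel e (X w - a)) =
  Rintegral P setT (fun w => jop (kernel e) (X w - a)).
Proof.
move=> e0; have [K nk] := tf_kernel e0; have mk := tf_measurable nk.
have [B bB] := jump_op_bounded m1 m2 alpha_gt0 alpha_lt2 nk.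
have mj := measurable_jump_op m1 m2 alpha_gt0 alpha_lt2 nk.
pose Y w := X w - a.
have mY : measurable_fun [set: T] Y by rewrite /Y; meas.
have Ycos z : 0 < z -> Rintegral P setT (fun w => cos (z * Y w)) = cf_re alpha m1 m2 (beta - a) z.
  move=> z0.
  rewrite (eq_Rint P (g := fun w => cos (z * a) * cos (z * X w) + sin (z * a) * sin (z * X w))).
    rewrite (RintD (L1Zl _ (cos_L1 z)) (L1Zl _ (sin_L1 z))) (RintZl _ (cos_L1 z)) (RintZl _ (sin_L1 z)).
    rewrite (Xcos z0) (Xsin z0) /cf_re /cf_im.
    by rewrite (_ : z * (beta - a) + _ = z * beta + im_closed alpha m1 m2 z - z * a) ?cosB; ring.
  by move=> w; rewrite /Y mulrBr cosB; ring.
have Ysin z : 0 < z -> Rintegral P setT (fun w => sin (z * Y w)) = cf_im alpha m1 m2 (beta - a) z.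
  move=> z0.
  rewrite (eq_Rint P (g := fun w => cos (z * a) * sin (z * X w) - sin (z * a) * cos (z * X w))).
    rewrite (RintB (L1Zl _ (sin_L1 z)) (L1Zl _ (cos_L1 z))) (RintZl _ (cos_L1 z)) (RintZl _ (sin_L1 z)).
    rewrite (Xcos z0) (Xsin z0) /cf_re /cf_im.
    by rewrite (_ : z * (beta - a) + _ = z * beta + im_closed alpha m1 m2 z - z * a) ?sinB; ring.
  by move=> w; rewrite /Y mulrBr sinB; ring.
have S := kernel_stein alpha_gt0 alpha_lt2 mY Ycos Ysin e0.
have i1 : L1 P (fun w => Y w * kernel e (Y w)).
  by apply: (@L1_bounded _ _ _ P _ K); [meas|move=> w; exact: (tf_decay nk)].
have i2 : L1 P (fun w => kernel e (Y w)).
  by apply: (@L1_bounded _ _ _ P _ K); [meas|move=> w; exact: (tf_bounded nk)].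
have i3 : L1 P (fun w => jop (kernel e) (Y w)).
  by apply: (@L1_bounded _ _ _ P _ B); [meas|move=> w; exact: bB].
have a0 : alpha != 0 by rewrite gt_eqF.
have E3 w : kernel_jump alpha m1 m2 e (Y w) = alpha^-1 * jop (kernel e) (Y w).
  by rewrite (kernel_jump_op m1 m2 alpha_gt0 alpha_lt2 _ e0) mulKf.
rewrite (eq_Rint P (g := fun w => Y w * kernel e (Y w) - (beta - a) * kernel e (Y w))); last first.
  by move=> w; rewrite /Y; ring.
rewrite (RintB i1 (L1Zl _ i2)) (RintZl _ i2) S (eq_Rint P E3) (RintZl _ i3) mulVKf//.
by rewrite addrK.
Qed.

Variables (g : R -> R) (C : R).
Hypothesis ng : test_function g C.

Let mg := tf_measurable ng.

(** The identities for the translates of the kernel, integrated against [g a da]. *)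
Lemma mollified_stein e : 0 < e ->
  Rintegral P setT (fun w =>
    (X w - beta) * blur (kernel 1) g e (X w) - blur (kernel 1) (jop g) e (X w)) = 0.
Proof.
move=> e0; have [K nk] := tf_kernel e0; have mk := tf_measurable nk; have K0 := tf_ge0 nk.
have [B bB] := jump_op_bounded m1 m2 alpha_gt0 alpha_lt2 nk.
have mj := measurable_jump_op m1 m2 alpha_gt0 alpha_lt2 nk.
have one_L1 : L1 P (fun _ : T => 1 : R).
  by apply: (@L1_bounded _ _ _ P _ 1) => // x; rewrite normr1.
pose H1 (w : T) (a : R) := g a * ((X w - beta) * kernel e (X w - 1 * a)).
pose G a := K * ((1 + `|beta|) * `|g a| + `|a * g a|).
have iG : L1 leb G.
  apply: L1Zl; apply: L1D; first by apply: L1Zl; apply: L1_norm; exact: (tf_L1 ng).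
  by apply: L1_norm; exact: (tf_L1_moment ng).
have [|w a|_ _ j3 _ E1] := @Rint_fubini_dominated _ _ _ _ R P leb H1 _ _ G one_L1 iG.
- by rewrite /H1; meas.
- rewrite mul1r /H1 /G mul1r normrM.
  have h : `|(X w - beta) * kernel e (X w - a)| <= K * (1 + `|beta|) + K * `|a|.
    rewrite (_ : _ * _ = (X w - a) * kernel e (X w - a) + (a - beta) * kernel e (X w - a)); last by ring.
    rewrite (le_trans (ler_normD _ _))//.
    have h1 := tf_decay nk (X w - a).
    have h2 := ler_wpM2l (normr_ge0 (a - beta)) (tf_bounded nk (X w - a)).
    have h3 := ler_wpM2r K0 (ler_normB a beta).
    rewrite [`|(a - beta) * _|]normrM; lra.
  have := ler_wpM2l (normr_ge0 (g a)) h; rewrite normrM [`|a * _|]normrM; lra.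
pose H2 (w : T) (a : R) := g a * jop (kernel e) (X w - 1 * a).
have iG2 : L1 leb (fun a => B * `|g a|) by apply: L1Zl; apply: L1_norm; exact: (tf_L1 ng).
have [|w a|_ _ k3 _ E2] := @Rint_fubini_dominated _ _ _ _ R P leb H2 _ _ _ one_L1 iG2.
- by rewrite /H2; meas.
- by rewrite mul1r /H2 normrM mulrC ler_wpM2r.
have F1 w : Rintegral leb setT (H1 w) = (X w - beta) * blur (kernel 1) g e (X w).
  rewrite (blur_kernel _ e0 ng) /blur -(RintZl _ (blur_L1 1 (X w) (tf_L1 ng) nk)).
  by apply: eq_Rint => a; rewrite /H1; ring.
have F2 w : Rintegral leb setT (H2 w) = blur (kernel 1) (jop g) e (X w).
  by rewrite (jump_op_mollify m1 m2 alpha_gt0 alpha_lt2 _ e0 ng).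
rewrite (eq_Rint P (g := fun w => Rintegral leb setT (H1 w) - Rintegral leb setT (H2 w))); last first.
  by move=> w; rewrite F1 F2.
rewrite (RintB j3 k3) E1 E2; apply/eqP; rewrite subr_eq0; apply/eqP.
apply: eq_Rint => a.
have i1 : L1 P (fun w => (X w - beta) * kernel e (X w - a)).
  apply: (@L1_bounded _ _ _ P _ (K + `|a - beta| * K)); first by meas.
  move=> w; rewrite (_ : _ * _ = (X w - a) * kernel e (X w - a) + (a - beta) * kernel e (X w - a)); last by ring.
  rewrite (le_trans (ler_normD _ _))// lerD ?(tf_decay nk)// normrM.
  by rewrite ler_wpM2l ?(tf_bounded nk).
have i2 : L1 P (fun w => jop (kernel e) (X w - a)).
  by apply: (@L1_bounded _ _ _ P _ B); [meas|move=> w; exact: bB].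
rewrite /H1 /H2 mul1r (RintZl _ i1) (RintZl _ i2).
by rewrite (translated_kernel_stein a e0).
Qed.

Lemma tf_cvg x (x_ : nat -> R) : x_ n @[n --> \oo] --> x ->
  g (x_ n) @[n --> \oo] --> g x.
Proof.
move=> cx; apply/subr_cvg0/norm_cvg0P.
apply: (@squeeze_cvgr _ _ _ _ (fun=> 0) (fun n => C * `|x_ n - x|)).
- by apply: nearW => n; rewrite normr_ge0/= (tf_lipschitz ng).
- exact: cvg_cst.
- by rewrite -(mulr0 C); apply: cvgMr; apply/norm_cvg0P/subr_cvg0.
Qed.

Lemma jump_op_cvg x (x_ : nat -> R) (M : R) : (forall n, `|x_ n| <= M) ->
  x_ n @[n --> \oo] --> x -> jop g (x_ n) @[n --> \oo] --> jop g x.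
Proof.
move=> bx cx; have C0 := tf_ge0 ng.
have iW := @levy_weight0_L1 R alpha m1 m2 alpha_gt0 alpha_lt2.
have [] := @Rint_dominated_cvg _ _ _ leb (fun n u => jump_term g (x_ n) u * rho u)
  (fun u => jump_term g x u * rho u) _ _ _ (L1Zl (C * (1 + M)) iW).
- move=> n; apply: measfunM; last by meas.
  by apply: (measurable_jump_term mg); meas.
- move=> u; apply: cvgMl; apply: cvgMl; apply: cvgB.
    by apply: tf_cvg; apply: cvgD => //; exact: cvg_cst.
  by apply: cvgMl; exact: tf_cvg.
- move=> n u; have r0 : 0 <= rho u := levy_density_ge0 _ _ _ _.
  rewrite normrM (ger0_norm r0) mulrA ler_wpM2r//.
  rewrite (le_trans (jump_le (x_ n) u ng))// ler_wpM2r ?levy_weight0_ge0//.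
  by rewrite ler_wpM2l// lerD2l.
by [].
Qed.

(** The mollified identity passes to the limit by dominated convergence, in the
mollification variable and then under the expectation; the factor [X - beta] is
dominated because [g] decays and the kernel has a first moment. *)
Lemma real_stein :
  [/\ L1 P (fun w => (X w - beta) * g (X w) - jop g (X w)) &
      Rintegral P setT (fun w => (X w - beta) * g (X w) - jop g (X w)) = 0].
Proof.
have C0 := tf_ge0 ng.
have [B bB] := jump_op_bounded m1 m2 alpha_gt0 alpha_lt2 ng.
have mj := measurable_jump_op m1 m2 alpha_gt0 alpha_lt2 ng.
have B0 : 0 <= B := le_trans (normr_ge0 _) (bB 0).
pose q w := (X w - beta) * g (X w) - jop g (X w).
have mq : measurable_fun [set: T] q by rewrite /q; meas.
have iq : L1 P q.
  apply: (@L1_bounded _ _ _ P _ (C + `|beta| * C + B)) => // w.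
  rewrite /q mulrBl (le_trans (ler_normB _ _))// lerD// (le_trans (ler_normB _ _))//.
  by rewrite lerD ?(tf_decay ng)// normrM ler_wpM2l ?(tf_bounded ng).
split => //.
have n1 := @tf_kernel1 R.
have mk1 := tf_measurable n1.
pose e_ (n : nat) : R := n.+1%:R^-1.
have e0 n : 0 < e_ n by rewrite invr_gt0.
have e1 n : e_ n <= 1 by rewrite invf_le1// ler1n.
pose D w n y := kernel 1 y * ((X w - beta) * g (X w - e_ n * y) - jop g (X w - e_ n * y)).
pose G y := (C + `|beta| * C + B) * `|kernel 1 y| + C * `|y * kernel 1 y|.
have iG : L1 leb G.
  apply: L1D; apply: L1Zl; apply: L1_norm; [exact: (tf_L1 n1)|exact: (tf_L1_moment n1)].
have ey n y : `|e_ n * y| <= `|y|.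
  by rewrite normrM (gtr0_norm (e0 n)) ler_piMl.
have bD w n y : `|D w n y| <= G y.
  have h : `|(X w - beta) * g (X w - e_ n * y) - jop g (X w - e_ n * y)|
      <= C + `|beta| * C + B + C * `|y|.
    rewrite (_ : (X w - beta) * _ = (X w - e_ n * y) * g (X w - e_ n * y) +
       (e_ n * y) * g (X w - e_ n * y) - beta * g (X w - e_ n * y)); last by ring.
    set t := X w - e_ n * y.
    rewrite (le_trans (ler_normB _ _))//.
    have := ler_normB (t * g t + e_ n * y * g t) (beta * g t).
    have := ler_normD (t * g t) (e_ n * y * g t).
    have := tf_decay ng t; have := bB t.
    have := ler_wpM2l (normr_ge0 beta) (tf_bounded ng t).
    have := ler_wpM2l (normr_ge0 (e_ n * y)) (tf_bounded ng t).
    have := ler_wpM2r C0 (ey n y).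
    rewrite [`|beta * g t|]normrM [`|e_ n * y * g t|]normrM; lra.
  rewrite /D normrM /G [`|y * _|]normrM.
  have := ler_wpM2l (normr_ge0 (kernel 1 y)) h; lra.
have mD' w n : measurable_fun [set: R] (D w n) by rewrite /D; meas.
have cx w y : X w - e_ n * y @[n --> \oo] --> X w.
  have : X w - e_ n * y @[n --> \oo] --> X w - 0 * y.
    apply: cvgB; first exact: cvg_cst.
    by apply: cvgMl; exact: cvg_harmonic.
  by rewrite mul0r subr0.
have bx w y n : `|X w - e_ n * y| <= `|X w| + `|y|.
  by rewrite (le_trans (ler_normB _ _))// lerD2l.
have cD w y : D w n y @[n --> \oo] --> kernel 1 y * q w.
  apply: cvgMr; apply: cvgB; last exact: (jump_op_cvg (bx w y) (cx w y)).
  by apply: cvgMr; apply: tf_cvg; exact: cx.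
have cI w : Rintegral leb setT (D w n) @[n --> \oo] --> Rintegral leb setT (@kernel R 1) * q w.
  have [] := @Rint_dominated_cvg _ _ _ leb (D w) (fun y => kernel 1 y * q w) G (mD' w) (cD w) iG (bD w).
  by move=> _; rewrite (RintZr _ (tf_L1 n1)).
pose I n w := Rintegral leb setT (D w n).
have mI n : measurable_fun [set: T] (I n).
  apply: (@measurable_Rintegral_param _ _ _ _ R leb (fun w y => D w n y)).
    by rewrite /D; meas.
  by move=> w; exact: (@L1_le _ _ R leb (D w n) G (mD' w n) iG (bD w n)).
have bI n w : `|I n w| <= Rintegral leb setT G.
  exact: (Rint_le_norm iG (mD' w n) (bD w n)).
have iB : L1 P (fun=> Rintegral leb setT G).
  by apply: (@L1_bounded _ _ _ P _ `|Rintegral leb setT G|).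
have I0 n : Rintegral P setT (I n) = 0.
  rewrite -(mollified_stein (e0 n)); apply: eq_Rint => w.
  rewrite /I /D /blur.
  have b1 := blur_L1 (e_ n) (X w) (tf_L1 n1) ng.
  have b2 : L1 leb (fun s => kernel 1 s * jop g (X w - e_ n * s)).
    apply: (@L1_le _ _ R leb _ _ _ (L1Zr B (L1_norm (tf_L1 n1)))); first by meas.
    by move=> s; rewrite normrM ler_wpM2l.
  rewrite -(RintZl (X w - beta) b1) -(RintB (L1Zl (X w - beta) b1) b2).
  by apply: eq_Rint => y; ring.
have [_] := @Rint_dominated_cvg _ _ _ P I (fun w => Rintegral leb setT (@kernel R 1) * q w) _ mI cI iB bI.
rewrite (RintZl _ iq); under eq_fun do rewrite I0.
move=> h0; have h1 : (fun _ : nat => 0 : R) @ \oo --> (0 : R) by exact: cvg_cst.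
have /eqP : Rintegral leb setT (@kernel R 1) * Rintegral P setT q = 0.
  exact: (cvg_unique _ h0 h1).
by rewrite mulf_eq0 (gt_eqF (@kernel1_mass R))/= => /eqP.
Qed.

End real_stein.

(** * Schwartz functions and the stable law *)

Local Open Scope complex_scope.

Section schwartz_functions.
Context {R : realType}.
Local Notation leb := (@lebesgue_measure R).

Lemma schwartz_test_function (f : R -> R) : schwartz f -> exists C, test_function f C.
Proof.
move=> [df bf].
have [C0 b0] := bf 0%N 0%N; have [C1 b1] := bf 1%N 0%N; have [C2 b2] := bf 2%N 0%N.
have [C3 b3] := bf 3%N 0%N; have [C4 b4] := bf 0%N 1%N.
rewrite /= in b0 b1 b2 b3 b4.
have {}b0 x : `|f x| <= C0 by have := b0 x; rewrite expr0 mul1r.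
have {}b1 x : `|x * f x| <= C1 by have := b1 x; rewrite expr1.
have d1 x : has_deriv f x (f^`()%classic x).
  by rewrite derive1E; apply: derivableP; exact: (df 0%N x).
have {}b4 x : `|f^`()%classic x| <= C4 by have := b4 x; rewrite expr0 mul1r.
have mf : measurable_fun [set: R] f.
  by apply: continuous_measurable_fun => x; exact: has_deriv_continuous (d1 x).
have C0' : 0 <= C0 := le_trans (normr_ge0 _) (b0 0).
have C1' : 0 <= C1 := le_trans (normr_ge0 _) (b1 0).
have C4' : 0 <= C4 := le_trans (normr_ge0 _) (b4 0).
exists (C0 + C1 + C4); split => //.
- by move=> x; have := b0 x; lra.
- by move=> x; have := b1 x; lra.
- move=> x y; rewrite (le_trans (lipschitz_derive d1 b4 x y))// ler_wpM2r//; lra.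
- apply: (@quadratic_decay_L1 _ _ (C0 + C2)) => // x.
  rewrite mulrDl mul1r lerD// -(ger0_norm (sqr_ge0 x)) -normrM; exact: b2.
- apply: (@quadratic_decay_L1 _ _ (C1 + C3)); first by meas.
  move=> x; rewrite mulrDl mul1r lerD// -(ger0_norm (sqr_ge0 x)) -normrM mulrA -exprSr.
  exact: b3.
Qed.

End schwartz_functions.

Section stable_law.
Context {R : realType}.
Local Notation leb := (@lebesgue_measure R).
Variables (alpha beta : R) (m1 m2 : {nonneg R}).
Hypothesis alpha_gt0 : 0 < alpha.
Hypothesis alpha_lt2 : alpha < 2.
Local Notation rho := (levy_density alpha m1 m2).
Local Notation nu := (levy_measure alpha m1 m2).

(** The Levy measure is defined by its density. *)
Lemma Rint_levy (f : R -> R) : measurable_fun [set: R] f ->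
  L1 leb (fun u => f u * rho u) ->
  L1 nu f /\ Rintegral nu setT f = Rintegral leb setT (fun u => f u * rho u).
Proof.
move=> mf iF; apply: (@Rint_density _ _ R leb nu rho) => //.
- by move=> u; exact: levy_density_ge0.
- exact: measurable_levy_density.
Qed.

Lemma cexp_imag (z x : R) : cexp ('i%C * z%:C * x%:C) = cos (z * x) +i* sin (z * x).
Proof.
rewrite /cexp; simpc.
by rewrite expR0; simpc.
Qed.

Lemma stable_exponentE z : 0 < z -> stable_exponent alpha beta m1 m2 z =
  re_closed alpha m1 m2 z +i* (z * beta + im_closed alpha m1 m2 z).
Proof.
move=> z0; rewrite /stable_exponent.
have E u : cexp ('i%C * z%:C * u%:C) - 1 - 'i%C * z%:C * u%:C * (unit_indic u)%:C =
    (cos (z * u) - 1) +i* (sin (z * u) - z * u * unit_indic u).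
  by rewrite cexp_imag; simpc.
have -> : cintegral nu (fun u : R => cexp ('i%C * z%:C * u%:C) - 1 - 'i%C * z%:C * u%:C * (unit_indic u)%:C) =
    cintegral nu (fun u : R => (cos (z * u) - 1) +i* (sin (z * u) - z * u * unit_indic u)).
  by congr (cintegral _ _); exact: funext E.
rewrite /cintegral /=.
have [_ ->] := @Rint_levy (fun u => cos (z * u) - 1) ltac:(meas) (re_exponent_L1 m1 m2 alpha_gt0 alpha_lt2 z0).
have [_ ->] := @Rint_levy (fun u => sin (z * u) - z * u * unit_indic u) ltac:(meas) (im_exponent_L1 m1 m2 alpha_gt0 alpha_lt2 z0).
rewrite -(re_closedE m1 m2 alpha_gt0 alpha_lt2 z0) -(im_closedE m1 m2 alpha_gt0 alpha_lt2 z0).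
by rewrite /re_exponent /im_exponent; simpc.
Qed.

Variables (d : measure_display) (T : measurableType d) (P : probability T R).
Variable X : {RV P >-> R}.
Hypothesis X_stable : is_stable X alpha beta m1 m2.

Lemma stable_cf z : 0 < z ->
  Rintegral P setT (fun w => cos (z * X w)) = cf_re alpha m1 m2 beta z /\
  Rintegral P setT (fun w => sin (z * X w)) = cf_im alpha m1 m2 beta z.
Proof.
move=> z0; have := X_stable z; rewrite (stable_exponentE z0).
rewrite (funext (fun w => cexp_imag z (X w))) /cintegral /=.
rewrite /cexp; simpc => /eqP; rewrite eq_complex/= => /andP[/eqP -> /eqP ->].
by [].
Qed.

Lemma stable_stein (f : R -> R) : schwartz f ->
  [/\ forall x, L1 nu (jump_term f x),
      forall x, Rintegral nu setT (jump_term f x) = jump_op alpha m1 m2 f x,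
      L1 P (fun w => (X w - beta) * f (X w) - jump_op alpha m1 m2 f (X w)) &
      Rintegral P setT (fun w => (X w - beta) * f (X w) - jump_op alpha m1 m2 f (X w)) = 0].
Proof.
move=> /schwartz_test_function[C nf].
have measfunX : measurable_fun [set: T] (X : T -> R) by exact: measurable_funPT.
have [i e] := real_stein alpha_gt0 alpha_lt2 measfunX
  (fun z z0 => (stable_cf z0).1) (fun z z0 => (stable_cf z0).2) nf.
have h x : L1 nu (jump_term f x) /\ Rintegral nu setT (jump_term f x) = jump_op alpha m1 m2 f x.
  apply: (@Rint_levy (jump_term f x)).
    by apply: (measurable_jump_term (tf_measurable nf)); meas.
  exact: jump_L1 nf.
by split => // x; have [] := h x.
Qed.

End stable_law.

Theorem theorem3p3 (R : realType) (d : measure_display) (T : measurableType d)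
    (P : probability T R) (X : {RV P >-> R})
    (alpha beta : R) (m1 m2 : {nonneg R})
    (alpha_gt0 : 0 < alpha) (alpha_lt2 : alpha < 2)
    (m_gt0 : 0 < m1%:num + m2%:num)
    (X_stable : is_stable X alpha beta m1 m2)
    (g : R -> R[i]) (g_schwartz : cschwartz g) :
  let nu := levy_measure alpha m1 m2 in
  let jump := fun x u : R => (g (x + u) - g x * (unit_indic u)%:C) * u%:C in
  let stein := fun w : T =>
    (X w - beta)%:C * g (X w) - cintegral nu (jump (X w)) in
  [/\ forall x : R, cintegrable nu (jump x),
      cintegrable P stein
    & cintegral P stein = 0].
Proof.
case: g_schwartz => sre sim nu jump stein.
have [re1 re2 re3 re4] := stable_stein alpha_gt0 alpha_lt2 X_stable sre.
have [im1 im2 im3 im4] := stable_stein alpha_gt0 alpha_lt2 X_stable sim.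
have Ejump x u : jump x u = jump_term (fun y => complex.Re (g y)) x u +i*
    jump_term (fun y => complex.Im (g y)) x u.
  rewrite /jump /jump_term; case: (g (x + u)) => a b; case: (g x) => a' b'.
  by simpc.
have Ere x : (fun u => complex.Re (jump x u)) = jump_term (fun y => complex.Re (g y)) x.
  by apply/funext => u; rewrite Ejump.
have Eim x : (fun u => complex.Im (jump x u)) = jump_term (fun y => complex.Im (g y)) x.
  by apply/funext => u; rewrite Ejump.
have Estein w : stein w =
    ((X w - beta) * complex.Re (g (X w)) - jump_op alpha m1 m2 (fun y => complex.Re (g y)) (X w)) +i*
    ((X w - beta) * complex.Im (g (X w)) - jump_op alpha m1 m2 (fun y => complex.Im (g y)) (X w)).
  rewrite /stein /cintegral Ere Eim re2 im2.
  by case: (g (X w)) => a b /=; simpc.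
have Fre : (fun w => complex.Re (stein w)) = (fun w => (X w - beta) * complex.Re (g (X w)) -
    jump_op alpha m1 m2 (fun y => complex.Re (g y)) (X w)).
  by apply/funext => w; rewrite Estein.
have Fim : (fun w => complex.Im (stein w)) = (fun w => (X w - beta) * complex.Im (g (X w)) -
    jump_op alpha m1 m2 (fun y => complex.Im (g y)) (X w)).
  by apply/funext => w; rewrite Estein.
split.
- move=> x; rewrite /cintegrable Ere Eim; split; [exact: re1|exact: im1].
- rewrite /cintegrable Fre Fim; split; [exact: re3|exact: im3].
- by rewrite /cintegral Fre Fim re4 im4.
Qed.
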